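(* Let $N\ge2$, let $\Omega\subset\mathbb{R}^N$ be an open set, let $2\le p_1\le\dots\le p_{N-1}\le p_N$, $\mathbf{p}=(p_1,\dots,p_N)$, and let $f\in W^{1,\mathbf{p}'}_{\rm loc}(\Omega)$. Let $g_1,\dots,g_N:\mathbb{R}\to\mathbb{R}^+$ be $C^2$ convex functions such that, for some $\mathcal{C}\ge1$ and $\delta\ge0$, \[ \frac{1}{\mathcal{C}}(|s|-\delta)_+^{p_i-2}\le g_i''(s)\le\mathcal{C}\,(|s|^{p_i-2}+1),\qquad s\in\mathbb{R},\ i=1,\dots,N. \] Let $u\in W^{1,\mathbf{p}}_{\rm loc}(\Omega)$ be a local minimizer of \[ \mathfrak{F}(u;\Omega')=\sum_{i=1}^N\int_{\Omega'}g_i(u_{x_i})\,dx+\int_{\Omega'}f\,u\,dx,\qquad\Omega'\Subset\Omega, \] and set $\mathcal{V}_i=V_i(u_{x_i})$ with $V_i(t)=\int_0^t\sqrt{g_i''(\tau)}\,d\tau$. Suppose that $u\in L^\infty_{\rm loc}(\Omega)$ and that $\mathcal{V}_1,\dots,\mathcal{V}_N\in L^{2\chi}_{\rm loc}(\Omega)$ for some $\chi>1$. Then \[ \mathcal{V}_i\in\mathcal{N}^{\mathbf{r},2}_{\infty,{\rm loc}}(\Omega),\qquad i=1,\dots,N, \] where $\mathbf{r}=(r_1,\dots,r_N)$ is given by \[ r_j=\min\left\{\frac{p_j}{p_N}+\frac{p_j}{2}(\chi-1),\,1\right\},\qquad j=1,\dots,N. \]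
   Context: $W^{1,\mathbf{p}}_{\rm loc}(\Omega)=\{u\in W^{1,1}_{\rm loc}(\Omega): u_{x_i}\in L^{p_i}_{\rm loc}(\Omega)\ \forall i\}$ and $W^{1,\mathbf{p}}_0(E)=\{u\in W^{1,1}_0(E): u_{x_i}\in L^{p_i}(E)\ \forall i\}$; $\mathbf{p}'=(p_1',\dots,p_N')$ with $p_i'=p_i/(p_i-1)$; $(\cdot)_+$ is the positive part. $E\Subset\Omega$ means that $E$ is open with compact closure contained in $\Omega$. A function $u\in W^{1,\mathbf{p}}_{\rm loc}(\Omega)$ is a local minimizer of $\mathfrak{F}$ if $\mathfrak{F}(u;\Omega')\le\mathfrak{F}(v;\Omega')$ for every $\Omega'\Subset\Omega$ and every $v$ with $v-u\in W^{1,\mathbf{p}}_0(\Omega')$. Anisotropic Besov–Nikol'skiĭ spaces: let $\{\mathbf{e}_1,\dots,\mathbf{e}_N\}$ be the canonical basis and $\delta_{\mathbf{h}}\psi(x)=\psi(x+\mathbf{h})-\psi(x)$. For an open set $E$ and $\mathbf{h}\ne0$, $E_{\mathbf{h}}=\{x\in E: x+\tau\mathbf{h}\in E\ \text{for every }\tau\in[0,1]\}$. For $0<t\le1$, $m\ge1$ and $\psi\in L^m(E)$ set $[\psi]_{\mathfrak{n}^{t,m}_{\infty,i}(E)}=\sup_{|h|>0}\big\|\,|h|^{-t}\delta_{h\mathbf{e}_i}\psi\big\|_{L^m(E_{h\mathbf{e}_i})}$. For $\mathbf{t}=(t_1,\dots,t_N)\in(0,1]^N$, $\mathcal{N}^{\mathbf{t},m}_\infty(E)=\{\psi\in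 L^m(E):\sum_{i=1}^N[\psi]_{\mathfrak{n}^{t_i,m}_{\infty,i}(E)}<+\infty\}$, and $\mathcal{N}^{\mathbf{t},m}_{\infty,{\rm loc}}(\Omega)$ is the set of $\psi\in L^m_{\rm loc}(\Omega)$ with $\psi\in\mathcal{N}^{\mathbf{t},m}_\infty(E)$ for every $E\Subset\Omega$. *)

(* Defs.v *)
From HB Require Import structures.
From mathcomp Require Import all_boot all_order all_algebra.
From mathcomp Require Import all_classical all_reals all_analysis.

Set Implicit Arguments.
Unset Strict Implicit.
Unset Printing Implicit Defensive.

Import Order.TTheory GRing.Theory Num.Theory.
Import numFieldNormedType.Exports.

Local Open Scope classical_set_scope.
Local Open Scope ring_scope.

(* 'rV[R]_n carries the product sigma-algebra, generated by the coordinates; it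
   is the Borel sigma-algebra since it contains the open sets, see
   [open_measurable_row] below. *)
Section row_measurable.
Context {R : realType}.
Variable n : nat.

Let coord (i : 'I_n) (x : 'rV[R]_n) : R := x ord0 i.

Let row_set0 : g_sigma_preimage coord set0.
Proof. exact: sigma_algebra0. Qed.

Let row_setC A : g_sigma_preimage coord A -> g_sigma_preimage coord (~` A).
Proof. exact: sigma_algebraC. Qed.

Let row_bigcup (F : (set 'rV[R]_n)^nat) :
  (forall i, g_sigma_preimage coord (F i)) ->
  g_sigma_preimage coord (\bigcup_i (F i)).
Proof. exact: sigma_algebra_bigcup. Qed.

HB.instance Definition _ := @isMeasurable.Build default_measure_display
  'rV[R]_n (g_sigma_preimage coord) row_set0 row_setC row_bigcup.

End row_measurable.

Section row_measurable_theory.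
Context {R : realType}.

Lemma measurable_coord n (i : 'I_n) :
  measurable_fun [set: 'rV[R]_n] (fun x => x ord0 i).
Proof.
move=> _ Y mY; rewrite setTI; apply: sub_sigma_algebra => /=.
rewrite -bigcup_seq/=; exists i => /=; first by rewrite mem_index_enum.
by exists Y => //; rewrite setTI.
Qed.

Lemma measurable_fun_row d (T : measurableType d) n (f : T -> 'rV[R]_n) :
  (forall i, measurable_fun setT (fun x => f x ord0 i)) ->
  measurable_fun setT f.
Proof.
move=> mf _ Y; rewrite setTI /measurable/= => mY.
suff : g_sigma_preimage (fun i (x : 'rV[R]_n) => x ord0 i) `<=`
    [set A | measurable (f @^-1` A)] by exact.
apply: smallest_sub.
  split => /=.
  - by rewrite preimage_set0.
  - by move=> A mA; rewrite setTD -preimage_setC; exact: measurableC.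
  - by move=> F mF; rewrite preimage_bigcup; exact: bigcup_measurable.
rewrite -bigcup_seq => A [i _] [B mB <-]/=.
by have := mf i measurableT B mB; rewrite !setTI.
Qed.

Definition rcons_mx n (z : R * 'rV[R]_n) : 'rV[R]_n.+1 :=
  \row_i (if unlift ord0 i is Some j then z.2 ord0 j else z.1).

Definition runcons_mx n (x : 'rV[R]_n.+1) : R * 'rV[R]_n :=
  (x ord0 ord0, \row_j x ord0 (lift ord0 j)).

Lemma rcons_mxK n : cancel (@rcons_mx n) (@runcons_mx n).
Proof.
move=> [a y]; rewrite /runcons_mx; congr pair; first by rewrite mxE unlift_none.
by apply/rowP => j; rewrite !mxE liftK.
Qed.

Lemma runcons_mxK n : cancel (@runcons_mx n) (@rcons_mx n).
Proof.
by move=> x; apply/rowP => i; rewrite mxE; case: unliftP => [j ->|->] /=;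
  rewrite ?mxE.
Qed.

Lemma measurable_rcons_mx n : measurable_fun setT (@rcons_mx n).
Proof.
apply: measurable_fun_row => i.
rewrite (_ : (fun _ => _) = fun z : R * 'rV[R]_n =>
   if unlift ord0 i is Some j then z.2 ord0 j else z.1); last first.
  by apply/funext => z; rewrite mxE.
case: (unlift ord0 i) => [j|]; last exact: measurable_fst.
exact: (measurableT_comp (measurable_coord j) measurable_snd).
Qed.

Lemma measurable_runcons_mx n : measurable_fun setT (@runcons_mx n).
Proof.
apply/measurable_fun_pairP; split; first exact: measurable_coord.
apply: measurable_fun_row => i /=.
rewrite (_ : (fun _ => _) = fun x : 'rV[R]_n.+1 => x ord0 (lift ord0 i)).
  exact: measurable_coord.
by apply/funext => x; rewrite mxE.
Qed.

End row_measurable_theory.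

Section lebesgue_rV.
Context {R : realType}.
Local Open Scope ereal_scope.

Section step.
Variables (n : nat) (mu : {sigma_finite_measure set 'rV[R]_n -> \bar R}).

Definition leb_step : set 'rV[R]_n.+1 -> \bar R :=
  pushforward (@lebesgue_measure R \x mu) (@rcons_mx R n).

Let leb_step0 : leb_step set0 = 0.
Proof. by apply: (@measure0 _ _ _ (pushforward _ _)); exact: measurable_rcons_mx. Qed.

Let leb_step_ge0 A : 0 <= leb_step A.
Proof. by apply: measure_ge0; exact: measurable_rcons_mx. Qed.

Let leb_step_sigma_additive : semi_sigma_additive leb_step.
Proof.
by apply: measure_semi_sigma_additive; exact: measurable_rcons_mx.
Qed.

HB.instance Definition _ := isMeasure.Build _ _ _ leb_step
  leb_step0 leb_step_ge0 leb_step_sigma_additive.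

Let leb_step_sigma_finite : sigma_finite setT leb_step.
Proof.
have [F FT Foo] : sigma_finite setT (@lebesgue_measure R \x mu).
  have /sigma_finiteP[F [TF ndF Foo]] := sigma_finiteT (@lebesgue_measure R).
  have /sigma_finiteP[G [TG ndG Goo]] := sigma_finiteT mu.
  exists (fun k => F k `*` G k).
    rewrite -setXTT TF TG predeqE => -[x y]; split.
      move=> [/= [k _ Fkx] [l _ Gly]]; exists (maxn k l) => //; split.
      - by move: x Fkx; exact/subsetPset/ndF/leq_maxl.
      - by move: y Gly; exact/subsetPset/ndG/leq_maxr.
    by move=> [k _ []/= ? ?]; split; exists k.
  move=> k; have [? ?] := Foo k; have [? ?] := Goo k.
  split; first exact: measurableX.
  by rewrite product_measure1E// lte_mul_pinfty// ge0_fin_numE.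
exists (fun k => @runcons_mx R n @^-1` F k) => [|k].
  by rewrite -preimage_bigcup -FT preimage_setT.
have [mF Fk] := Foo k; split.
  by rewrite -[X in measurable X]setTI; exact: measurable_runcons_mx.
rewrite /leb_step /pushforward -comp_preimage.
by rewrite (_ : _ \o _ = id)// ; apply/funext => z /=; rewrite rcons_mxK.
Qed.

HB.instance Definition _ :=
  Measure_isSigmaFinite.Build _ _ _ leb_step leb_step_sigma_finite.

End step.

(* The Lebesgue measure on R^n, as the n-fold product of the one on R; see
   [lebesgue_rV_box]. *)
Fixpoint lebesgue_rV (n : nat) :
    {sigma_finite_measure set 'rV[R]_n -> \bar R} :=
  if n is m.+1 then leb_step (lebesgue_rV m) else \d_(0%R : 'rV[R]_0).

Lemma lebesgue_rV_box n (A : 'I_n -> set R) :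
  (forall i, measurable (A i)) ->
  lebesgue_rV n [set x | forall i, A i (x ord0 i)] =
  \prod_(i < n) lebesgue_measure (A i).
Proof.
elim: n A => [|n IH] A mA /=.
  rewrite big_ord0 diracE mem_set//= => -[]//.
rewrite big_ord_recl -IH//.
have mB : measurable [set x : 'rV[R]_n | forall i, A (lift ord0 i) (x ord0 i)].
  rewrite (_ : [set _ | _] = \bigcap_(i in [set: 'I_n])
      ((fun x : 'rV[R]_n => x ord0 i) @^-1` A (lift ord0 i))).
    apply: fin_bigcap_measurable => // i _.
    rewrite -[X in measurable X]setTI; exact: measurable_coord.
  by apply/seteqP; split=> x /= Ax i; [move=> _|]; exact: Ax.
rewrite -product_measure1E//=; last exact: mA.
rewrite /leb_step /pushforward; congr product_measure1.
apply/seteqP; split => [[a y]/= Ay|[a y]/= [Aa Ay] i].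
  split; first by have := Ay ord0; rewrite mxE unlift_none.
  by move=> i; have := Ay (lift ord0 i); rewrite mxE liftK.
by rewrite mxE; case: unliftP => [j ->|->].
Qed.

Lemma open_measurable_row n (A : set 'rV[R]_n) : open A -> measurable A.
Proof.
move=> oA.
pose box (q : {ffun 'I_n -> rat * rat}) : set 'rV[R]_n :=
  [set x | forall i, (ratr (q i).1 < x ord0 i < ratr (q i).2)%R].
have mbox q : measurable (box q).
  rewrite (_ : box q = \bigcap_(i in [set: 'I_n]) ((fun x : 'rV[R]_n => x ord0 i)
      @^-1` `]ratr (q i).1, ratr (q i).2[%classic)); last first.
    by apply/seteqP; split=> x /= qx i; [move=> _; rewrite /= in_itv/=|
      have := qx i I; rewrite /= in_itv/=]; last exact; exact: qx.
  apply: fin_bigcap_measurable => // i _.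
  rewrite -[X in measurable X]setTI; exact: measurable_coord.
rewrite (_ : A = \bigcup_k (if unpickle k is Some q then
    (if `[< box q `<=` A >] then box q else set0) else set0)).
  apply: bigcupT_measurable => k; case: unpickle => [q|]//.
  by case: ifPn.
apply/seteqP; split => [x Ax|x [k _]]; last first.
  by case: unpickle => [q|]//; case: ifPn => // /asboolP; exact.
have /nbhs_ballP[e /= e0 xeA] : nbhs x A by exact: open_nbhs_nbhs.
have /boolp.choice[q qx] : forall i : 'I_n, exists q : rat * rat,
    (x ord0 i - e < ratr q.1 < x ord0 i)%R /\
    (x ord0 i < ratr q.2 < x ord0 i + e)%R.
  move=> i.
  have /rat_in_itvoo[a] : (x ord0 i - e < x ord0 i)%R by rewrite ltrBlDr ltrDl.
  have /rat_in_itvoo[b] : (x ord0 i < x ord0 i + e)%R by rewrite ltrDl.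
  by rewrite !in_itv/= => xb ax; exists (a, b).
exists (pickle (finfun q)) => //; rewrite pickleK ifT.
  by move=> i; rewrite /= !ffunE; have [/andP[_ ->] /andP[->]] := qx i.
apply/asboolP => y qy; apply: xeA; split => // i j; rewrite ord1.
have := qy j; rewrite ffunE => /andP[ay yb].
have [/andP[xa _] /andP[_ bx]] := qx j.
rewrite /ball/= ltr_distlC; apply/andP; split.
  exact: lt_trans xa ay.
exact: lt_trans yb bx.
Qed.

End lebesgue_rV.
Arguments lebesgue_rV {R} n.

Section function_spaces.
Context {R : realType} {N : nat}.
Implicit Types (E Omega : set 'rV[R]_N) (m : \bar R) (i : 'I_N).
Implicit Types (u v w f phi psi : 'rV[R]_N -> R).
Implicit Types (Du Dv Dw : 'I_N -> 'rV[R]_N -> R).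

Local Notation leb := (lebesgue_rV N).

Definition compactly_inside E Omega :=
  [/\ open E, compact (closure E) & closure E `<=` Omega].

(* Functions on E are represented by total functions whose values outside of E
   are discarded by the restriction [psi \_ E], which vanishes outside of E. *)
Definition Lnorm_on m E psi : \bar R := 'N[leb]_m [EFin \o (psi \_ E)].

Definition Lp m E psi := psi \_ E \in Lfun leb m.

Definition Lp_loc m Omega psi :=
  forall E, compactly_inside E Omega -> Lp m E psi.

Definition basis i : 'rV[R]_N := delta_mx ord0 i.

Definition partial i phi : 'rV[R]_N -> R := fun x => 'D_(basis i) phi x.

Fixpoint Ck (k : nat) phi : Prop :=
  continuous phi /\
  if k is l.+1 then
    forall i, (forall x, derivable phi x (basis i)) /\ Ck l (partial i phi)
  else True.

Definition test_function Omega phi :=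
  [/\ forall k, Ck k phi,
      compact (closure [set x | phi x != 0]) &
      closure [set x | phi x != 0] `<=` Omega].

Definition weak_partial Omega i u w :=
  [/\ Lp_loc 1%E Omega u, Lp_loc 1%E Omega w &
      forall phi, test_function Omega phi ->
        \int[leb]_(x in Omega) (u x * partial i phi x) =
        - \int[leb]_(x in Omega) (w x * phi x)].

Definition weak_gradient Omega u Du := forall i, weak_partial Omega i u (Du i).

(* Sobolev functions come with a chosen representative [Du] of their weak
   gradient, which is unique up to equality almost everywhere. *)
Definition W1p_loc Omega (p : 'I_N -> R) u Du :=
  weak_gradient Omega u Du /\ forall i, Lp_loc (p i)%:E Omega (Du i).

(* The closure of the test functions in W^{1,1}(E). *)
Definition W11_0 E w Dw :=
  [/\ weak_gradient E w Dw, Lp 1%E E w, forall i, Lp 1%E E (Dw i) &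
      exists phi : nat -> 'rV[R]_N -> R,
        [/\ forall k, test_function E (phi k),
            Lnorm_on 1%E E (w \- phi k) @[k --> \oo] --> 0%E &
            forall i,
              Lnorm_on 1%E E (Dw i \- partial i (phi k)) @[k --> \oo] --> 0%E]].

Definition W1p_0 E (p : 'I_N -> R) w :=
  exists Dw, W11_0 E w Dw /\ forall i, Lp (p i)%:E E (Dw i).

Definition energy (g : 'I_N -> R -> R) f u Du E : \bar R :=
  ((\sum_(i < N) \int[leb]_(x in E) (g i (Du i x))%:E)
   + \int[leb]_(x in E) (f x * u x)%:E)%E.

Definition local_minimizer Omega (p : 'I_N -> R) (g : 'I_N -> R -> R) f u Du :=
  W1p_loc Omega p u Du /\
  forall E, compactly_inside E Omega ->
  forall v Dv, weak_gradient E v Dv -> W1p_0 E p (v \- u) ->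
    (energy g f u Du E <= energy g f v Dv E)%E.

(* The set E_h of the points that stay in E along the segment of direction h. *)
Definition segment_in E (h : 'rV[R]_N) : set 'rV[R]_N :=
  [set x | E x /\ forall tau : R, 0 <= tau <= 1 -> E (x + tau *: h)].

Definition diff_quot (t : R) i (h : R) psi : 'rV[R]_N -> R :=
  fun x => `|h| `^ (- t) * (psi (x + h *: basis i) - psi x).

Definition nikolskii_seminorm (t : R) m i E psi : \bar R :=
  ereal_sup [set Lnorm_on m (segment_in E (h *: basis i)) (diff_quot t i h psi)
            | h in [set h : R | h != 0]].

Definition nikolskii (t : 'I_N -> R) m E psi :=
  Lp m E psi /\ (\sum_(i < N) nikolskii_seminorm (t i) m i E psi < +oo)%E.

Definition nikolskii_loc (t : 'I_N -> R) m Omega psi :=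
  Lp_loc m Omega psi /\
  forall E, compactly_inside E Omega -> nikolskii t m E psi.

End function_spaces.

Section integrands.
Context {R : realType}.

Definition C2 (g : R -> R) :=
  [/\ forall s, derivable g s 1, forall s, derivable (derive1 g) s 1 &
      continuous (derive1n 2 g)].

(* The oriented integral from 0 to t of the square root of g''. *)
Definition Vfun (g : R -> R) (t : R) : R :=
  let I a b := \int[lebesgue_measure]_(tau in `[a, b]) Num.sqrt (derive1n 2 g tau)
  in
  if 0 <= t then I 0 t else - I t 0.

(* At a base equal to 0 this uses the convention 0 `^ 0 = 1, so that the growth
   condition with p = 2 reads 1 / C <= g'' <= 2 * C. *)
Definition growth (C delta p : R) (g : R -> R) :=
  forall s : R,
    C^-1 * (Num.max (`|s| - delta) 0) `^ (p - 2) <= derive1n 2 g s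
      <= C * (`|s| `^ (p - 2) + 1).

End integrands.

(* Main.v *)
Require Import Defs.
From mathcomp Require Import all_boot all_order all_algebra.
From mathcomp Require Import all_classical all_reals all_analysis.
From mathcomp Require Import measurable_realfun lra ring.

(* The proof is Nirenberg's method of difference quotients. Testing the
   Euler-Lagrange equation with zeta^2 (u(x + h e_j) - u(x)) and with the
   translate of this function by h e_j, shifting the second equation back and
   subtracting, gives the Caccioppoli inequality
     int zeta^2 |delta V_i|^2 <= K sum_k int |d_k zeta|^2 |delta u|^2
         (|a_k|^(p_k - 2) + |b_k|^(p_k - 2) + 1) + K int zeta^2 |delta f| |delta u|,
   where a_k and b_k are the values of u_{x_k} at x and at x + h e_j. The
   hypothesis on V_k means u_{x_k} in L^(p_k chi), so that delta u / h is bounded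
   in L^(p_j chi); as u is bounded, interpolating delta u between L^oo and
   L^(p_j chi) yields, uniformly in k,
     |a_k|^(p_k - 2) |delta u|^2
       <= K h^(2 r_j) (|a_k|^(p_k chi) + |delta u / h|^(p_j chi) + 1),
   and Young's inequality bounds the term with f by a multiple of h^2. *)

Set Implicit Arguments.
Unset Strict Implicit.
Unset Printing Implicit Defensive.

Import Order.TTheory GRing.Theory Num.Theory.
Import numFieldNormedType.Exports.

Local Open Scope classical_set_scope.
Local Open Scope ring_scope.

(* Otherwise [basis] denotes the bases of a topology. *)
Local Notation basis := Defs.basis.

(** * Translation invariance of the Lebesgue measure *)

(** All the Sobolev calculus rests on one fact, the continuity of translations in L^1. It makes
    mollification converge, which gives both the bound of difference quotients by weak derivatives
    and the membership of compactly supported perturbations in [W11_0], a closure of test functions.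
    Translations leave a domain while the equation is local: u, its gradient, f and its gradient are
    therefore extended by zero from a neighbourhood [S] of [E], their weak derivatives are tested
    only inside [S], and nested neighbourhoods whose radii are multiples of d leave room for the
    shifts. Origin of r_j: with D = delta u / h ^ r, the growth of g_k'' produces |a_k| ^ (p_k - 2)
    D ^ 2, and only |a_k| ^ (p_k chi) and |delta u / h| ^ (p_j chi) are integrable. Balancing the
    two powers and spending the boundedness of u on the excess exponent allows r up to p_j / p_k +
    p_j (chi - 1) / 2. The worst k is the last index, whence p_N in the denominator. The cap at 1
    reflects that delta u and delta f are at best of order h. *)

Section translation.
Context {R : realType}.
Local Open Scope ereal_scope.

Lemma lebesgue_measure_shift (a : R) (A : set R) : measurable A ->
  lebesgue_measure ((fun x => x + a)%R @^-1` A) = lebesgue_measure A.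
Proof.
move=> mA.
have ms : measurable_fun [set: measurableTypeR R] ((fun x => x + a)%R : measurableTypeR R ->
  measurableTypeR R).
  exact: measurable_funD.
pose m : {measure set (measurableTypeR R) -> \bar R} :=
  pushforward lebesgue_measure ((fun x => x + a)%R : measurableTypeR R -> measurableTypeR R).
suff : lebesgue_measure A = m ms A by move=> ->.
apply: lebesgue_measure_unique => //= _ [[c b]] _ <-.
rewrite /pushforward.
rewrite (_ : _ @^-1` _ = `]c - a, b - a]%classic)%R.
  rewrite /= !lebesgue_measure_itv/= !lte_fin ltrD2r -!EFinB.
  by case: ifPn => // _; congr EFin; ring.
by apply/seteqP; split=> x /=; rewrite !in_itv/= ltrBlDr lerBrDr.
Qed.

Lemma measurable_shift_row n (a : 'rV[R]_n) :
  measurable_fun setT (fun x : 'rV[R]_n => x + a)%R.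
Proof.
apply: measurable_fun_row => i.
rewrite (_ : (fun _ => _) = fun x : 'rV[R]_n => x ord0 i + a ord0 i)%R; last first.
  by apply/funext => x; rewrite mxE.
by apply: measurable_funD => //; exact: measurable_coord.
Qed.

(** Induction on the dimension: each step is a product measure, which is determined by its values on
    products of measurable sets, and a translation acts on the two factors separately. *)
Lemma lebesgue_rV_shift n (a : 'rV[R]_n) (A : set 'rV[R]_n) : measurable A ->
  lebesgue_rV n ((fun x => x + a)%R @^-1` A) = lebesgue_rV n A.
Proof.
elim: n a A => [|n IH] a A mA /=.
  by rewrite (_ : _ @^-1` A = A)//; apply/seteqP; split=> x /=; rewrite (thinmx0 a) addr0.
rewrite /leb_step /pushforward.
pose T : measurableTypeR R * 'rV[R]_n -> measurableTypeR R * 'rV[R]_n :=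
  fun z : R * 'rV[R]_n => (z.1 + (runcons_mx a).1, z.2 + (runcons_mx a).2)%R.
have mT : measurable_fun setT T.
  apply/measurable_fun_pairP; split.
    by apply: measurable_funD => //; exact: measurable_fst.
  exact: (measurableT_comp (measurable_shift_row _) measurable_snd).
pose m : {measure set (measurableTypeR R * 'rV[R]_n) -> \bar R} :=
  pushforward (lebesgue_measure \x lebesgue_rV n) T.
have rT z : rcons_mx (T z) = (rcons_mx z + a)%R.
  apply/rowP => i; rewrite !mxE; case: unliftP => [j ->|->] /=; rewrite ?mxE//.
have -> : rcons_mx (n:=n) @^-1` ((fun x => x + a)%R @^-1` A) = T @^-1` (rcons_mx (n:=n) @^-1` A).
  by apply/seteqP; split=> z /=; rewrite rT.
suff : (lebesgue_measure \x lebesgue_rV n) (rcons_mx (n:=n) @^-1` A) = m mT (rcons_mx (n:=n)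
  @^-1` A).
  by move=> ->.
apply: (@product_measure_unique _ _ _ _ R (@lebesgue_measure R) (lebesgue_rV n) (m mT)).
  move=> B D mB mD; rewrite /= /pushforward.
  rewrite (_ : T @^-1` _ = ((fun x => x + (runcons_mx a).1)%R @^-1` B) `*` ((fun x => x +
    (runcons_mx a).2)%R @^-1` D)) //.
  rewrite product_measure1E; last 2 first.
  - rewrite -[X in measurable X]setTI.
    have ms : measurable_fun [set: R] (fun x : R => x + (runcons_mx a).1)%R by exact:
      measurable_funD.
    exact: ms.
  - by rewrite -[X in measurable X]setTI; exact: measurable_shift_row.
  by rewrite /= lebesgue_measure_shift// IH.
by rewrite -[X in measurable X]setTI; exact: measurable_rcons_mx.
Qed.

Variable n : nat.
Local Notation leb := (lebesgue_rV n).

Lemma ge0_integral_shift (a : 'rV[R]_n) (F : 'rV[R]_n -> \bar R) :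
  measurable_fun setT F -> (forall x, 0 <= F x) ->
  \int[leb]_x F (x + a)%R = \int[leb]_x F x.
Proof.
move=> mF F0.
have := ge0_integral_pushforward (measurable_shift_row a) leb measurableT mF.
rewrite preimage_setT => <-; last by move=> y _; exact: F0.
apply: eq_measure_integral => [|mf A mA _]; first exact: measurable_shift_row.
exact: lebesgue_rV_shift.
Qed.

Lemma integrable_shift (a : 'rV[R]_n) (F : 'rV[R]_n -> \bar R) :
  leb.-integrable setT F -> leb.-integrable setT (fun x => F (x + a)%R).
Proof.
move=> /integrableP[mF iF]; apply/integrableP; split.
  exact: measurableT_comp mF (measurable_shift_row a).
by rewrite (ge0_integral_shift a (F := fun x => `|F x|))//; exact: measurableT_comp.
Qed.

Lemma integral_shift (a : 'rV[R]_n) (F : 'rV[R]_n -> \bar R) :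
  measurable_fun setT F -> 
  \int[leb]_x F (x + a)%R = \int[leb]_x F x.
Proof.
move=> mF; rewrite integralE [RHS]integralE.
congr (_ - _); rewrite -[RHS](ge0_integral_shift a) //=.
- by apply: eq_integral => x _; rewrite !funeposE.
- exact: measurable_funepos.
- by apply: eq_integral => x _; rewrite !funenegE.
- exact: measurable_funeneg.
Qed.

End translation.

Section Rintegral_shift.
Context {R : realType} (n : nat).
Local Notation leb := (lebesgue_rV n).

Lemma Rintegral_shift (a : 'rV[R]_n) (F : 'rV[R]_n -> R) :
  measurable_fun setT F ->
  \int[leb]_x F (x + a) = \int[leb]_x F x.
Proof.
move=> mF; rewrite /Rintegral (integral_shift a (F := EFin \o F))//.
exact/measurable_EFinP.
Qed.
End Rintegral_shift.

(** * Smooth functions *)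

Section row_norm.
Context {R : realType} {N : nat}.
Implicit Types x y : 'rV[R]_N.

Lemma normr_coord_le x i : `|x ord0 i| <= `|x|.
Proof.
rewrite [leRHS]mx_normrE.
exact: (@le_bigmax _ _ _ 0 (fun k : 'I_1 * 'I_N => `|x k.1 k.2|) (ord0, i)).
Qed.

Lemma row_norm_le x (r : R) : 0 <= r -> (forall i, `|x ord0 i| <= r) -> `|x| <= r.
Proof.
move=> r0 xr; rewrite [leLHS]mx_normrE; apply: bigmax_le => // -[i j] _ /=.
by rewrite (ord1 i).
Qed.

Lemma norm_basis (i : 'I_N) : `|basis i : 'rV[R]_N| = 1.
Proof.
apply/eqP; rewrite eq_le; apply/andP; split.
  by apply: row_norm_le => // j; rewrite mxE eqxx/=; case: eqP => _; rewrite ?normr1 ?normr0.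
by have := normr_coord_le (basis i) i; rewrite mxE !eqxx normr1.
Qed.

Lemma row_sum_basis x : x = \sum_i x ord0 i *: basis i.
Proof. exact: row_sum_delta. Qed.

End row_norm.

Section derivation.
Context {R : realType}.

Lemma is_derive_cvg (V : normedModType R) (f : V -> R) (x v : V) (l : R) :
  is_derive x v f l <-> h^-1 * (f (h *: v + x) - f x) @[h --> (0:R)^'] --> l.
Proof.
split => [[df <-]|fl]; first exact: df.
have df : derivable f x v by apply/cvg_ex; exists l; exact: fl.
by split => //; apply/cvg_lim => //; exact: fl.
Qed.

(** Reduces a derivative in direction v to one on the real line, where the mean value theorem and
    the chain rule are available. *)
Lemma is_derive_line (V : normedModType R) (f : V -> R) (x v : V) (t l : R) :
  is_derive (t *: v + x) v f l <-> is_derive t 1 (fun h : R => f (h *: v + x)) l.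
Proof.
rewrite !is_derive_cvg.
suff -> : (fun h : R => h^-1 * (f (h *: v + (t *: v + x)) - f (t *: v + x))) =
  (fun h => h^-1 * (f ((h *: 1 + t) *: v + x) - f (t *: v + x))) by [].
by apply/funext => h; rewrite addrA -scalerDl /GRing.scale /= mulr1.
Qed.

(** An explicit quadratic remainder replaces the passage to the limit in difference quotients. It is
    available for [flat] at the origin and, uniformly under the integral sign, for mollified
    functions. *)
Lemma is_derive_quad (V : normedModType R) (f : V -> R) (x v : V) (l K : R) :
  (forall h : R, `|h| <= 1 -> `|f (h *: v + x) - f x - h * l| <= K * h ^+ 2) ->
  is_derive x v f l.
Proof.
move=> fK; apply/is_derive_cvg.
have K0 : 0 <= K by have := fK 1; rewrite normr1 expr1n mulr1 => /(_ (lexx _)); exact: le_trans.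
apply/cvgrPdist_le => /= e e0; near=> h.
have h0 : h != 0 by near: h; exact: nbhs_dnbhs_neq.
have h1 : `|h| <= 1 by near: h; apply: dnbhs0_le.
have he : `|h| <= e / (K + 1) by near: h; apply: dnbhs0_le; rewrite divr_gt0// ltr_wpDl.
have -> : l - h^-1 * (f (h *: v + x) - f x) =
    - (h^-1 * (f (h *: v + x) - f x - h * l)).
  by rewrite (mulrBr _ _ (h * l)) mulKf// opprB.
rewrite normrN normrM normfV ler_pdivrMl ?normr_gt0//.
apply: (le_trans (fK _ h1)).
rewrite -(real_normK (num_real h)) expr2 mulrCA ler_wpM2l//.
apply: (le_trans (ler_wpM2l K0 he)).
by rewrite mulrA ler_pdivrMr ?ltr_wpDl// mulrC ler_pM2l// lerDl.
Unshelve. all: by end_near. Qed.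

End derivation.

(** * A smooth function that is flat at the origin *)

Section flat.
Context {R : realType}.

(* The powers of [t^-1] make the family stable under differentiation. *)
Definition flat n (t : R) : R :=
  if 0 < t then t^-1 ^+ n * expR (- t^-1) else 0.

Lemma flat_ge0 n t : 0 <= flat n t.
Proof.
rewrite /flat; case: ifP => // t0.
by rewrite mulr_ge0 ?expR_ge0// exprn_ge0// invr_ge0 ltW.
Qed.

Lemma flat_gt0 n t : 0 < t -> 0 < flat n t.
Proof. by move=> t0; rewrite /flat t0 mulr_gt0 ?expR_gt0// exprn_gt0// invr_gt0. Qed.

Lemma flat_le0 n t : t <= 0 -> flat n t = 0.
Proof. by rewrite /flat leNgt => /negbTE ->. Qed.

(** With s = 1 / t this is the bound s ^ (n + 2) / (n + 2)! <= exp s from the exponential series. It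
    gives every [flat n] the derivative 0 at the origin. *)
Lemma flat_quad n t : flat n t <= (n.+2)`!%:R * t ^+ 2.
Proof.
have [t0|t0] := ltP 0 t; last first.
  by rewrite flat_le0// mulr_ge0// sqr_ge0.
rewrite /flat t0 expRN ler_pdivrMr ?expR_gt0//.
have s0 : 0 < t^-1 by rewrite invr_gt0.
have := expR_ge1Dxn n.+1 (ltW s0).
set F := (n.+2)`!%:R; have F0 : 0 < F by rewrite ltr0n fact_gt0.
move=> es.
have {es}es : t^-1 ^+ n.+2 / F <= expR t^-1 by rewrite (le_trans _ es)// lerDr.
apply: le_trans (ler_wpM2l _ es); last by rewrite mulr_ge0 ?sqr_ge0// ltW.
rewrite le_eqVlt; apply/orP; left; apply/eqP.
rewrite [n.+2](_ : _ = 2 + n)%N// exprD !exprVn.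
by field; rewrite !gt_eqF//= exprn_gt0.
Qed.

Lemma is_derive_flat (n : nat) (t : R) :
  is_derive t 1 (flat n) (- (n%:R * flat n.+1 t) + flat n.+2 t).
Proof.
have [t0|t0|->] := ltgtP t 0.
- rewrite !flat_le0 ?ltW// mulr0 oppr0 addr0.
  have := is_derive_cst (0 : R) t (1 : R); apply: near_eq_is_derive.
  near=> s; rewrite flat_le0// ltW//; near: s; exact: lt_nbhsl.
- have dV : is_derive t 1 (fun y : R => y^-1) (- t^-2).
    have did : derivable (id : R -> R) t 1 by exact: derivable_id.
    have t0' := lt0r_neq0 t0.
    split; first exact: (derivableV (f := id)).
    by rewrite (deriveV (f := id))// derive_id /GRing.scale/= mulr1.
  have dX := is_deriveX n dV.
  have dN : is_derive t 1 (fun y : R => - y^-1) (t^-2).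
    by have := is_deriveN dV; rewrite opprK.
  have dE := @is_derive1_comp R expR (fun y => - y^-1) t _ _ (is_derive_expR _) dN.
  have := is_deriveM dX dE; move/(near_eq_is_derive (g := flat n)).
  (* A cut: the equality of [flat n] with the product of its two factors near t > 0 is proved
     first. *)
  apply: (fun A B f => A (f B)); last first.
    near=> s; rewrite /flat ifT; last by near: s; exact: lt_nbhsr.
    by rewrite [LHS]/GRing.mul /= fctE.
  move=> dM.
  apply: is_derive_eq dM _.
  rewrite /flat t0 /GRing.scale/= fctE -[t^-2]exprVn.
  case: n {dX} => [|n]; first by rewrite !expr0 /= ; ring.
  by rewrite /= !exprS; ring.
- rewrite !flat_le0// mulr0 oppr0 addr0.
  apply: (@is_derive_quad _ _ _ _ _ _ (n.+2)`!%:R) => h _.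
  rewrite /GRing.scale/= mulr1 addr0 (flat_le0 n (lexx 0)) mulr0 !subr0.
  by rewrite ger0_norm ?flat_ge0// flat_quad.
Unshelve. all: by end_near. Qed.

End flat.

Section mean_value.
Context {R : realType}.
Variables (g dg : R -> R).
Hypothesis gdg : forall s : R, is_derive s 1 g (dg s).

Lemma is_derive_continuous : continuous g.
Proof.
move=> s; apply: differentiable_continuous; apply/derivable1_diffP.
by have [] := gdg s.
Qed.

Lemma mean_value a b : exists2 c, `|c - a| <= `|b - a| & g b - g a = dg c * (b - a).
Proof.
have cg (c d : R) : {within `[c, d], continuous g}.
  by apply: continuous_subspaceT; exact: is_derive_continuous.
have [ab|ba] := leP a b.
  have [c /[!in_itv]/= /andP[ac cb] ->] := MVT_segment ab (fun s _ => gdg s) (cg _ _).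
  by exists c => //; rewrite !ger0_norm ?subr_ge0// lerD2r.
have [c /[!in_itv]/= /andP[bc ca] gab] := MVT_segment (ltW ba) (fun s _ => gdg s) (cg _ _).
exists c; first by rewrite !ler0_norm ?subr_le0// ?(ltW ba)// lerN2 lerD2r.
by rewrite -opprB gab -mulrN opprB.
Qed.

End mean_value.

(** * Functions of class C^k and of bounded support *)

Section Ck_theory.
Context {R : realType} {N : nat}.
Implicit Types (phi psi : 'rV[R]_N -> R) (x v : 'rV[R]_N).

Lemma Ck_continuous k phi : Ck k phi -> continuous phi.
Proof. by case: k => [|k] []. Qed.

Lemma CkS k phi : Ck k.+1 phi -> Ck k phi.
Proof.
elim: k phi => [|k IH] phi [c d]; first by split.
by split => // i; have [di Ci] := d i; split => //; exact: IH.
Qed.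

Lemma Ck_is_derive k phi i x : Ck k.+1 phi -> is_derive x (basis i) phi (partial i phi x).
Proof. by move=> [_ /(_ i)[d _]]; exact/derivableP. Qed.

Lemma partial_eq phi psi i :
  (forall x, is_derive x (basis i) phi (psi x)) -> partial i phi = psi.
Proof. by move=> d; apply/funext => x; have := d x => dx; exact: derive_val. Qed.

Lemma Ck_intro k phi (dphi : 'I_N -> 'rV[R]_N -> R) : continuous phi ->
  (forall i x, is_derive x (basis i) phi (dphi i x)) -> (forall i, Ck k (dphi i)) ->
  Ck k.+1 phi.
Proof.
move=> c d Cd; split => // i; split; first by move=> x; have [] := d i x.
by rewrite (partial_eq (d i)).
Qed.

Lemma continuous_funD phi psi : continuous phi -> continuous psi ->
  continuous (fun x => phi x + psi x).
Proof. by move=> c d x; exact: (continuousD (c x) (d x)). Qed.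

Lemma continuous_funM phi psi : continuous phi -> continuous psi ->
  continuous (fun x => phi x * psi x).
Proof. by move=> c d x; exact: (continuousM (c x) (d x)). Qed.

Lemma Ck_cst k (a : R) : Ck k (fun _ : 'rV[R]_N => a).
Proof.
elim: k a => [|k IH] a; first by split => // x; exact: cst_continuous.
have D (i : 'I_N) (x : 'rV[R]_N) : is_derive x (basis i) (fun _ : 'rV[R]_N => a) 0.
  exact: is_derive_cst.
by apply: (Ck_intro _ D (fun=> IH 0)) => x; exact: cst_continuous.
Qed.

Lemma CkD k phi psi : Ck k phi -> Ck k psi -> Ck k (fun x => phi x + psi x).
Proof.
elim: k phi psi => [|k IH] phi psi Cphi Cpsi.
  by split => //; apply: continuous_funD; [exact: (Ck_continuous Cphi)|exact: (Ck_continuous Cpsi)].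
apply: (@Ck_intro _ _ (fun i x => partial i phi x + partial i psi x)) => [|i x|i].
- by apply: continuous_funD; [move: Cphi|move: Cpsi] => /Ck_continuous.
- by apply: is_deriveD; [exact: (Ck_is_derive _ _ Cphi)|exact: (Ck_is_derive _ _ Cpsi)].
- by apply: IH; [case: Cphi => _ /(_ i)[]|case: Cpsi => _ /(_ i)[]].
Qed.

Lemma CkM k phi psi : Ck k phi -> Ck k psi -> Ck k (fun x => phi x * psi x).
Proof.
elim: k phi psi => [|k IH] phi psi Cphi Cpsi.
  by split => //; apply: continuous_funM; [exact: (Ck_continuous Cphi)|exact: (Ck_continuous Cpsi)].
apply: (@Ck_intro _ _ (fun i x => phi x * partial i psi x + psi x * partial i phi x)) => [|i x|i].
- by apply: continuous_funM; [move: Cphi|move: Cpsi] => /Ck_continuous.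
- by apply: is_deriveM; [exact: (Ck_is_derive _ _ Cphi)|exact: (Ck_is_derive _ _ Cpsi)].
- apply: CkD; apply: IH.
  + exact: CkS Cphi.
  + by case: Cpsi => _ /(_ i)[].
  + exact: CkS Cpsi.
  + by case: Cphi => _ /(_ i)[].
Qed.

Lemma CkZ k (a : R) phi : Ck k phi -> Ck k (fun x => a * phi x).
Proof. by move=> C; apply: CkM => //; exact: Ck_cst. Qed.

Lemma Ck_prod k (I : Type) (s : seq I) (f : I -> 'rV[R]_N -> R) :
  (forall i, Ck k (f i)) -> Ck k (fun x => \prod_(i <- s) f i x).
Proof.
move=> Cf; elim: s => [|i s IH].
  by rewrite (_ : (fun _ => _) = fun=> 1); [exact: Ck_cst|apply/funext => x; rewrite big_nil].
rewrite (_ : (fun _ => _) = fun x => f i x * \prod_(i <- s) f i x); first exact: CkM.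
by apply/funext => x; rewrite big_cons.
Qed.

Lemma is_derive_shift_row phi a x v l : is_derive (x + a) v phi l ->
  is_derive x v (fun x => phi (x + a)) l.
Proof.
move=> /is_derive_cvg d; apply/is_derive_cvg.
by under eq_fun do rewrite -addrA.
Qed.

Lemma Ck_shift k phi a : Ck k phi -> Ck k (fun x => phi (x + a)).
Proof.
have cs phi' : continuous phi' -> continuous (fun x => phi' (x + a)).
  move=> c x; apply: (@continuous_comp _ _ _ (fun x : 'rV[R]_N => x + a) phi'); last exact: c.
  exact: (continuousD (@cvg_id _ (nbhs x)) (@cst_continuous _ _ a x)).
elim: k phi => [|k IH] phi C; first by split => //; exact/cs/Ck_continuous/C.
apply: (@Ck_intro _ _ (fun i x => partial i phi (x + a))) => [|i x|i].
- exact/cs/Ck_continuous/C.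
- by apply: is_derive_shift_row; exact: (Ck_is_derive _ _ C).
- by apply: IH; case: C => _ /(_ i)[].
Qed.

Lemma partial_shift phi i a :
  partial i (fun x => phi (x + a)) = fun x => partial i phi (x + a).
Proof.
apply/funext => x; rewrite /partial /derive /=.
by under eq_fun do rewrite -addrA.
Qed.

Lemma continuous_flat n : continuous (@flat R n).
Proof. exact: (is_derive_continuous (is_derive_flat n)). Qed.

Lemma is_derive_affine (m q t : R) : is_derive t 1 (fun h => m * h + q) m.
Proof.
apply: (@is_derive_quad _ _ _ _ _ _ 0) => h _.
by rewrite mul0r (_ : _ - _ - _ = 0) ?normr0// /GRing.scale/=; ring.
Qed.

Lemma continuous_coord_row (i : 'I_N) : continuous (fun x : 'rV[R]_N => x ord0 i).
Proof. by move=> x; exact: coord_continuous. Qed.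

Lemma Ck_flat k n (c d : R) (i : 'I_N) : Ck k (fun x => flat n (c * x ord0 i + d)).
Proof.
have cf m : continuous (fun x : 'rV[R]_N => flat m (c * x ord0 i + d)).
  move=> x; apply: (@continuous_comp _ _ _ (fun x : 'rV[R]_N => c * x ord0 i + d) (@flat R m));
    last exact: continuous_flat.
  apply: continuousD; last exact: cst_continuous.
  by apply: continuousM; [exact: cst_continuous|exact: continuous_coord_row].
elim: k n => [|k IH] n; first by split.
apply: (@Ck_intro _ _ (fun j x => (- n%:R * flat n.+1 (c * x ord0 i + d) +
   flat n.+2 (c * x ord0 i + d)) * (c * (j == i)%:R))) => // [j x|j].
  rewrite -[x]add0r -(scale0r (basis j)); apply/is_derive_line; rewrite scale0r add0r.
  rewrite (_ : (fun _ => _) = flat n \o (fun h => c * (j == i)%:R * h + (c * x ord0 i + d))).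
    apply: is_derive1_comp; last exact: is_derive_affine.
    rewrite mulr0 add0r mulNr; exact: is_derive_flat.
  apply/funext => h /=; congr flat; rewrite !mxE eqxx/= eq_sym; ring.
apply: CkM; last exact: Ck_cst.
by apply: CkD => //; exact: CkZ.
Qed.

End Ck_theory.

Definition bounded_support {R : realType} {N : nat} (r : R) (phi : 'rV[R]_N -> R) :=
  forall x, r < `|x| -> phi x = 0.

Section bounded_support.
Context {R : realType} {N : nat}.
Implicit Types (phi psi : 'rV[R]_N -> R) (x v : 'rV[R]_N).

Lemma closed_norm_le (r : R) : closed [set x : 'rV[R]_N | `|x| <= r].
Proof.
apply: (@closed_comp _ _ (fun x : 'rV[R]_N => `|x|) [set y | y <= r]).
  by move=> x _; exact: norm_continuous.
exact: closed_le.
Qed.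

Lemma compact_norm_le (r : R) : compact [set x : 'rV[R]_N | `|x| <= r].
Proof.
apply: bounded_closed_compact; last exact: closed_norm_le.
exists r; split; first exact: num_real.
by move=> s rs x /= xr; exact: le_trans xr (ltW rs).
Qed.

Lemma bounded_support_bounded r phi : continuous phi -> bounded_support r phi ->
  exists2 M, 0 <= M & forall x, `|phi x| <= M.
Proof.
move=> c s.
have [r0|r0] := leP 0 r; last first.
  by exists 0 => // x; rewrite s ?normr0// (lt_le_trans r0).
have [||x0 _ m] := @compact_EVT_max _ R (fun x => `|phi x|) _ _ (@compact_norm_le r).
- by exists 0; rewrite /= normr0.
- apply: continuous_subspaceT => x; apply: (@continuous_comp _ _ _ phi (fun y => `|y|)).
    exact: c.
  exact: norm_continuous.
exists `|phi x0| => // x.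
have [xr|xr] := leP `|x| r; first by apply: m; rewrite inE.
by rewrite s// normr0.
Qed.

Lemma bounded_support_partial r phi i :
  bounded_support r phi -> bounded_support r (partial i phi).
Proof.
move=> s x xr; rewrite /partial -(derive_cst (0 : R) x (basis i)).
apply: near_eq_derive; near=> y; apply: s; near: y.
apply: (@open_nbhs_nbhs _ x [set y | r < `|y|]); split => //.
have : open (~` [set y : 'rV[R]_N | `|y| <= r]) by apply: closed_openC; exact: closed_norm_le.
by congr open; apply/seteqP; split => y /=; rewrite ltNge => /negP.
Unshelve. all: by end_near. Qed.

Lemma mean_value_partial phi i x t : Ck 1 phi ->
  exists2 c, `|c| <= `|t| &
    phi (t *: basis i + x) - phi x = partial i phi (c *: basis i + x) * t.
Proof.
move=> C.
have d (s : R) : is_derive s 1 (fun h : R => phi (h *: basis i + x)) (partial i phi (s *: basis i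
  + x)).
  by have /is_derive_line := @Ck_is_derive _ _ 0%N phi i (s *: basis i + x) C.
have [c] := mean_value d 0 t.
by rewrite !subr0 scale0r add0r => ct e; exists c.
Qed.

(** Going from x to x + v along one coordinate direction at a time uses the mean value theorem for
    partial derivatives only. The starting point of each piece is arbitrary, hence the bounds of the
    partial derivatives on the whole space. *)
Lemma bounded_support_lipschitz r phi : Ck 1 phi -> bounded_support r phi ->
  exists2 L, 0 <= L & forall x v, `|phi (x + v) - phi x| <= L * `|v|.
Proof.
move=> C s.
have [M M0 Mb] : exists2 M, 0 <= M & forall i x, `|partial i phi x| <= M.
  have /boolp.choice[M Mb] : forall i : 'I_N, exists M, 0 <= M /\ forall x, `|partial i phi x| <= M.
    move=> i; have [|M M0 Mb] := bounded_support_bounded _ (bounded_support_partial i s).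
      by case: C => _ /(_ i)[_ []].
    by exists M.
  exists (\sum_i M i); first by apply: sumr_ge0 => i _; have [] := Mb i.
  move=> i x; have [_ /(_ x) h] := Mb i; apply: (le_trans h).
  by rewrite (bigD1 i)//= lerDl sumr_ge0// => j _; have [] := Mb j.
exists (N%:R * M) => [|x v]; first by rewrite mulr_ge0.
have H (l : seq 'I_N) y : `|phi (\sum_(i <- l) v ord0 i *: basis i + y) - phi y| <= (size l)%:R *
  M * `|v|.
  elim: l y => [|i l IH] y; first by rewrite big_nil add0r subrr normr0 !mul0r.
  rewrite big_cons -addrA.
  set z := \sum_(_ <- _) _ + y.
  have -> : phi (v ord0 i *: basis i + z) - phi y =
    (phi (v ord0 i *: basis i + z) - phi z) + (phi z - phi y) by ring.
  apply: (le_trans (ler_normD _ _)).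
  have [c _ ->] := mean_value_partial i z (v ord0 i) C.
  rewrite /= -natr1 mulrDl mul1r mulrDl [leRHS]addrC; apply: lerD; last exact: IH.
  by rewrite normrM ler_pM// normr_coord_le.
have := H (index_enum 'I_N) x.
by rewrite -row_sum_basis [X in phi X]addrC /index_enum -enumT size_enum_ord.
Qed.

End bounded_support.

(** * Continuity of translations in L1 *)

Section integral_norm.
Context d (T : measurableType d) (R : realType) (mu : {measure set T -> \bar R}).
Local Open Scope ereal_scope.

Lemma ge0_measurable_norm (D : set T) (f : T -> R) : measurable_fun D f ->
  measurable_fun D (fun x => (`|f x|%R)%:E).
Proof. by move=> mf; apply/measurable_EFinP; exact: measurableT_comp. Qed.

Lemma le_integral_normD (D : set T) (f g h : T -> R) : measurable D ->
  measurable_fun D f -> measurable_fun D g -> measurable_fun D h ->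
  (forall x, D x -> `|f x| <= `|g x| + `|h x|)%R ->
  \int[mu]_(x in D) (`|f x|%R)%:E <=
  \int[mu]_(x in D) (`|g x|%R)%:E + \int[mu]_(x in D) (`|h x|%R)%:E.
Proof.
move=> mD mf mg mh fgh.
rewrite -ge0_integralD//; try exact: ge0_measurable_norm.
apply: ge0_le_integral => //.
- exact: ge0_measurable_norm.
- by apply: emeasurable_funD; exact: ge0_measurable_norm.
Qed.

Lemma integral_norm_subset (A B : set T) (f : T -> R) : measurable A -> measurable B ->
  measurable_fun B f -> A `<=` B ->
  \int[mu]_(x in A) (`|f x|%R)%:E <= \int[mu]_(x in B) (`|f x|%R)%:E.
Proof.
move=> mA mB mf AB; apply: ge0_subset_integral => //.
exact: ge0_measurable_norm.
Qed.

End integral_norm.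

Definition nball {R : realType} (N : nat) (r : R) : set 'rV[R]_N := [set x | `|x| <= r].

Section nball.
Context {R : realType} {N : nat}.
Local Notation leb := (lebesgue_rV N).
Implicit Types (x z : 'rV[R]_N).

Lemma measurable_nball (r : R) : measurable (@nball R N r).
Proof.
rewrite -[X in measurable X]setCK; apply: measurableC; apply: open_measurable_row.
by apply: closed_openC; exact: closed_norm_le.
Qed.

Lemma nballE (r : R) : 0 <= r -> @nball R N r = [set x | forall i, `[- r, r]%classic (x ord0 i)].
Proof.
move=> r0; apply/seteqP; split=> x /=.
  move=> xr i; rewrite in_itv/= -ler_norml; exact: le_trans (normr_coord_le x i) xr.
by move=> xr; apply: row_norm_le => // i; rewrite ler_norml; have := xr i; rewrite in_itv.
Qed.

Lemma nball_lt0 (r : R) : r < 0 -> @nball R N r = set0.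
Proof.
by move=> r0; apply/seteqP; split=> x //=; rewrite /nball/= leNgt (lt_le_trans r0).
Qed.

Lemma lebesgue_rV_nball (r : R) : (leb (@nball R N r) < +oo)%E.
Proof.
have [r0|r0] := leP 0 r; last by rewrite nball_lt0// measure0.
rewrite nballE//.
rewrite (lebesgue_rV_box (A := fun=> `[- r, r]%classic))//.
rewrite (eq_bigr (fun=> (r + r)%:E)); last first.
  move=> i _; rewrite /= lebesgue_measure_itv/= lte_fin.
  case: ifPn => [_|]; first by rewrite -EFinD opprK.
  rewrite -leNgt => r0'; have -> : r = 0 by lra.
  by rewrite addr0.
by rewrite ltey_eq prode_fin_num.
Qed.

Lemma measurable_fun_shift d (T : measurableType d) z (f : 'rV[R]_N -> T) :
  measurable_fun setT f -> measurable_fun setT (fun x => f (x + z)).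
Proof. move=> mf; exact: (measurableT_comp mf (measurable_shift_row z)). Qed.

Lemma measurable_continuous_row (f : 'rV[R]_N -> R) : continuous f -> measurable_fun setT f.
Proof.
move=> /continuousP cf; apply: (measurability _ (RGenOpens.measurableE R)) => /=.
move=> _ [_ [a [b ->]] <-]; rewrite setTI; apply: open_measurable_row.
by apply: cf; exact: interval_open.
Qed.

End nball.

Section translation_continuity.
Context {R : realType} {N : nat}.
Local Notation leb := (lebesgue_rV N).
Local Notation B := (@nball R N).
Implicit Types (x z : 'rV[R]_N) (f g : 'rV[R]_N -> R).

Definition translation_osc f z (r : R) : \bar R :=
  (\int[leb]_(x in B r) (`|f (x + z)%R - f x|%R)%:E)%E.

(** Continuity is measured on balls, so that constants and indicators of halfspaces, which are not
    integrable, belong to the class and complements of sets stay in it. *)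
Definition translation_continuous f := forall r e : R, 0 < e ->
  exists2 d, 0 < d & forall z, `|z| <= d -> (translation_osc f z r <= e%:E)%E.

Lemma integral_shift_nball f z (r : R) : measurable_fun setT f -> `|z| <= 1 ->
  (\int[leb]_(x in B r) (`|f (x + z)%R|%R)%:E <= \int[leb]_(x in B (r + 1)) (`|f x|%R)%:E)%E.
Proof.
move=> mf z1.
rewrite integral_mkcond [leRHS]integral_mkcond.
have mF : measurable_fun setT ((fun x => (`|f x|)%:E) \_ (B (r + 1))).
  apply/(measurable_restrictT _ (measurable_nball _)).
  exact/ge0_measurable_norm/measurable_funTS.
rewrite -(ge0_integral_shift z mF).
  apply: ge0_le_integral => //.
  - by move=> x _; rewrite patchE; case: ifP.
  - apply/(measurable_restrictT _ (measurable_nball _)).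
    apply: ge0_measurable_norm; apply: measurable_funTS; exact: measurable_fun_shift.
  - exact: (measurable_fun_shift z mF).
  - move=> x _; rewrite !patchE; case: ifPn => [xr|_]; last by case: ifPn => // _; rewrite lee_fin.
    rewrite ifT// inE /nball /=.
    by move: xr; rewrite inE /nball/= => xr; apply: (le_trans (ler_normD _ _)); rewrite lerD.
by move=> x; rewrite patchE; case: ifP.
Qed.

(** Three epsilons. The approximation is taken on the ball of radius r + 1 because a translation by
    |z| <= 1 moves the ball of radius r into it. *)
Lemma translation_continuous_approx f : measurable_fun setT f ->
  (forall r e : R, 0 < e -> exists g, [/\ measurable_fun setT g, translation_continuous g &
    (\int[leb]_(x in B r) (`|f x - g x|%R)%:E <= e%:E)%E]) ->
  translation_continuous f.
Proof.
move=> mf H r e e0.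
have e3 : 0 < e / 3 by rewrite divr_gt0.
have [g [mg tg fg]] := H (r + 1) (e / 3) e3.
have [d d0 dg] := tg r (e / 3) e3.
exists (Num.min d 1); first by rewrite lt_min d0 ltr01.
move=> z; rewrite le_min => /andP[zd z1].
have mfz := measurable_fun_shift z mf; have mgz := measurable_fun_shift z mg.
have mfg : measurable_fun setT (fun x => f x - g x) by exact: measurable_funB.
have mfgz : measurable_fun setT (fun x => f (x + z) - g (x + z)) by exact: measurable_funB.
have mB (r' : R) : measurable (B r') by exact: measurable_nball.
apply: (@le_trans _ _ (\int[leb]_(x in B r) (`|(f (x + z) - g (x + z))|%R)%:E +
  \int[leb]_(x in B r) (`| `|g (x + z) - g x| + `|f x - g x| |%R)%:E)%E).
  apply: le_integral_normD => //; try exact: measurable_funTS.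
  - by apply: measurable_funTS; exact: measurable_funB.
  - by apply: measurable_funTS; apply: measurable_funD; apply: measurableT_comp => //;
    exact: measurable_funB.
  - move=> x _; apply: (@le_trans _ _ (`|f (x + z) - g (x + z)| + (`|g (x + z) - g x| + `|f x - g
    x|))); last by rewrite lerD2l ler_norm.
    have -> : f (x + z) - f x = (f (x + z) - g (x + z)) + ((g (x + z) - g x) - (f x - g x)) by ring.
    apply: (le_trans (ler_normD _ _)); rewrite lerD2l.
    exact: ler_normB.
have -> : e%:E = (e / 3 + (e / 3 + e / 3))%:E by congr EFin; field.
rewrite EFinD leeD//.
  apply: (le_trans _ fg).
  exact: (integral_shift_nball r mfg z1).
apply: (@le_trans _ _ (\int[leb]_(x in B r) (`|g (x + z) - g x|%R)%:E +
  \int[leb]_(x in B r) (`| f x - g x |%R)%:E)%E).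
  apply: le_integral_normD => //; try exact: measurable_funTS.
  - by apply: measurable_funTS; apply: measurable_funD; apply: measurableT_comp => //;
    exact: measurable_funB.
  - by apply: measurable_funTS; exact: measurable_funB.
  - by move=> x _; rewrite ger0_norm ?addr_ge0.
rewrite EFinD leeD//; first exact: dg.
apply: (le_trans _ fg); apply: integral_norm_subset => //; first exact: measurable_funTS.
by move=> x /= /le_trans; apply; rewrite lerDl.
Qed.

Lemma translation_continuousD f g : measurable_fun setT f -> measurable_fun setT g ->
  translation_continuous f -> translation_continuous g ->
  translation_continuous (fun x => f x + g x).
Proof.
move=> mf mg tf tg r e e0.
have e2 : 0 < e / 2 by rewrite divr_gt0.
have [d d0 df] := tf r _ e2; have [d' d'0 dg] := tg r _ e2.
exists (Num.min d d'); first by rewrite lt_min d0.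
move=> z; rewrite le_min => /andP[zd z1].
rewrite [e]splitr EFinD; apply: le_trans (leeD (df z zd) (dg z z1)).
have mfz := measurable_fun_shift z mf; have mgz := measurable_fun_shift z mg.
apply: le_integral_normD; first exact: measurable_nball.
- apply: measurable_funTS; apply: measurable_funB; exact: measurable_funD.
- by apply: measurable_funTS; exact: measurable_funB.
- by apply: measurable_funTS; exact: measurable_funB.
- move=> x _; apply: le_trans (ler_normD _ _).
  by rewrite le_eqVlt; apply/orP; left; apply/eqP; congr `| _ |; ring.
Qed.

Lemma translation_continuousZ (c : R) f : measurable_fun setT f ->
  translation_continuous f -> translation_continuous (fun x => c * f x).
Proof.
move=> mf tf r e e0.
have c0 : 0 < `|c| + 1 by rewrite ltr_wpDl.
have [d d0 df] := tf r (e / (`|c| + 1)) (divr_gt0 e0 c0).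
exists d => // z zd; rewrite /translation_osc.
have mfz := measurable_fun_shift z mf.
under eq_integral => x _ do rewrite -mulrBr normrM EFinM.
rewrite ge0_integralZl//; last 2 first.
- exact: measurable_nball.
- by apply: ge0_measurable_norm; apply: measurable_funTS; exact: measurable_funB.
apply: (@le_trans _ _ (`|c|%:E * (e / (`|c| + 1))%:E)%E).
  by rewrite lee_wpmul2l// df.
rewrite -EFinM lee_fin mulrC -mulrA ler_piMr// ?(ltW e0)//.
by rewrite mulrC ler_pdivrMr// mul1r lerDl.
Qed.

End translation_continuity.

Section translation_continuous_measurable.
Context {R : realType} {N : nat}.
Local Notation leb := (lebesgue_rV N).
Local Notation B := (@nball R N).
Implicit Types (x z : 'rV[R]_N) (f g : 'rV[R]_N -> R) (A : set 'rV[R]_N).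

Lemma cvge_ltP (e : R) (u : (\bar R)^nat) : 0 < e ->
  u @ \oo --> 0%E -> exists n, (u n < e%:E)%E.
Proof.
move=> e0 u0.
have [n _ H] : \forall n \near \oo, (u n < e%:E)%E.
  by apply: (u0 [set y | (y < e%:E)%E]); apply: open_nbhs_nbhs; split;
    [exact: open_ereal_lt_ereal|rewrite /= lte_fin].
by exists n; apply: H => /=.
Qed.

Lemma translation_continuous_cst (c : R) : translation_continuous (fun _ : 'rV[R]_N => c).
Proof.
move=> r e e0; exists 1 => // z _; rewrite /translation_osc.
rewrite (eq_integral (fun=> 0%E)); last by move=> x _; rewrite subrr normr0.
by rewrite integral0 lee_fin ltW.
Qed.

Lemma measurable_halfspace (i : 'I_N) (c : R) :
  measurable [set x : 'rV[R]_N | x ord0 i < c].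
Proof.
rewrite -[X in measurable X]setTI.
have := @measurable_coord R N i measurableT `]-oo, c[%classic (measurable_itv _).
by congr measurable; apply/seteqP; split=> x /=; rewrite in_itv.
Qed.

(** For |z| <= d the translation changes the indicator only in the slab |x_i - c| <= d, whose part
    in the ball of radius r has measure at most 2 d (2 r) ^ (N - 1). *)
Lemma translation_continuous_halfspace (i : 'I_N) (c : R) :
  translation_continuous (\1_[set x : 'rV[R]_N | x ord0 i < c] : _ -> R).
Proof.
move=> r e e0.
have [r0|r0] := ltP r 0.
  by exists 1 => // z _; rewrite /translation_osc nball_lt0// integral_set0 lee_fin ltW.
pose K := (r + r) ^+ N.-1.
have K0 : 0 <= K by rewrite exprn_ge0// addr_ge0.
(* Makes 2 d K = e K / (K + 1) <= e, also when K = 0. *)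
pose d := e / (K + 1) / 2.
have K1 : 0 < K + 1 by rewrite ltr_wpDl.
have d0 : 0 < d by rewrite !divr_gt0.
exists d => // z zd.
pose S := [set x : 'rV[R]_N | forall j, (if j == i then `[c - d, c + d] else `[- r, r])%classic
  (x ord0 j)].
have mS : measurable S.
  rewrite (_ : S = \bigcap_(j in [set: 'I_N]) ((fun x : 'rV[R]_N => x ord0 j)
      @^-1` (if j == i then `[c - d, c + d] else `[- r, r])%classic)).
    apply: fin_bigcap_measurable => // j _.
    rewrite -[X in measurable X]setTI; apply: measurable_coord => //.
    by case: ifP => _; exact: measurable_itv.
  by apply/seteqP; split=> x /= Ax j; [move=> _|]; exact: Ax.
have SE : leb S = ((d + d) * K)%:E.
  rewrite (lebesgue_rV_box (A := fun j => (if j == i then `[c - d, c + d] else `[- r,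
    r])%classic)); last first.
    by move=> j; case: ifP => _; exact: measurable_itv.
  rewrite (bigD1 i)//= eqxx lebesgue_measure_itv/= lte_fin ifT; last by lra.
  rewrite (eq_bigr (fun=> (r + r)%:E)); last first.
    move=> j /negbTE ->; rewrite /= lebesgue_measure_itv/= lte_fin.
    case: ifPn => [_|]; first by rewrite -EFinD opprK.
    rewrite -leNgt => r0'; have -> : r = 0 by lra.
    by rewrite addr0.
  rewrite prodEFin -EFinD -EFinM; congr EFin; congr (_ * _); first by ring.
  by rewrite prodr_const cardC1 card_ord.
apply: (@le_trans _ _ (leb S)); last first.
  have dK : d + d = e / (K + 1) by rewrite /d; field; rewrite gt_eqF.
  by rewrite SE lee_fin dK mulrAC ler_pdivrMr// ler_pM2l// lerDl.
rewrite -(setIT S) -integral_indic// /translation_osc [leLHS]integral_mkcond.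
have mH := measurable_halfspace i c.
apply: ge0_le_integral => //.
- by move=> x _; rewrite patchE; case: ifP.
- apply/(measurable_restrictT _ (measurable_nball _)).
  apply/ge0_measurable_norm/measurable_funTS/measurable_funB => //.
  apply: (@measurable_fun_shift _ _ _ _ z (\1_[set x : 'rV[R]_N | x ord0 i < c] : _ -> R)).
  exact: measurable_indic.
- by apply/measurable_EFinP; exact: measurable_indic.
- move=> x _; rewrite patchE; case: ifPn => [|_]; last by rewrite lee_fin indicE.
  rewrite inE => xr.
  have [xS|xS] := boolP (x \in S).
    rewrite !indicE xS lee_fin.
    by case: (x + z \in _); case: (x \in _); rewrite ?subrr ?subr0 ?sub0r ?normrN ?normr1 ?normr0.
  rewrite [leLHS](_ : _ = 0%E) ?lee_fin ?indicE//; congr EFin; apply/eqP.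
  rewrite normr_eq0 subr_eq0; apply/eqP; congr ((nat_of_bool _)%:R).
  have := le_trans (normr_coord_le z i) zd; rewrite ler_norml => /andP[zi1 zi2].
  have xi : ~~ (c - d <= x ord0 i <= c + d).
    apply/negP => xi; move/negP: xS; apply; rewrite inE => j.
    case: eqP => [->|_]; rewrite /= in_itv/=; first by [].
    by rewrite -ler_norml (le_trans (normr_coord_le x j)).
  apply/idP/idP; rewrite !inE /= mxE => xc.
    rewrite ltNge; apply: contra xi => cx; lra.
  move: xi; rewrite negb_and -!ltNge => /orP[]; lra.
Qed.

(** The sets with this property form a sigma-algebra that contains the halfspaces, hence all
    measurable sets. *)
Lemma translation_continuous_indic A : measurable A ->
  translation_continuous (\1_A : _ -> R).
Proof.
suff : measurable `<=` [set A | measurable A /\ translation_continuous (\1_A : 'rV[R]_N -> R)].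
  by move=> H mA; have [] := H _ mA.
have mu A' : measurable A' -> measurable_fun setT (\1_A' : 'rV[R]_N -> R).
  by move=> mA; exact: measurable_indic.
have S0 : sigma_algebra setT [set A | measurable A /\ translation_continuous (\1_A : 'rV[R]_N ->
  R)].
  split => /=.
  - split => //; rewrite (_ : \1_set0 = fun=> 0); first exact: translation_continuous_cst.
    by apply/funext => x; rewrite indic0.
  - move=> A' [mA tA]; rewrite setTD; split; first exact: measurableC.
    rewrite (_ : \1_(~` A') = fun x => 1 + (-1) * \1_A' x).
      apply: translation_continuousD => //; last exact: translation_continuousZ.
        by apply: measurable_funM => //; exact: mu.
      exact: translation_continuous_cst.
    by apply/funext => x; rewrite !indicE in_setC; case: (x \in A') => /=; ring.
  move=> F FH.
  have mF k : measurable (F k) by have [] := FH k.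
  split; first exact: bigcupT_measurable.
  have mU n : measurable (\bigcup_(k < n) F k) by exact: bigcup_measurable.
  (* Finite unions are treated directly: the increment of the indicator of a union is at most the
     sum of the increments of the two indicators. *)
  have tU n : translation_continuous (\1_(\bigcup_(k < n) F k) : 'rV[R]_N -> R).
    elim: n => [|n IH].
      rewrite bigcup_mkord big_ord0 (_ : \1_set0 = fun=> 0);
        first exact: translation_continuous_cst.
      by apply/funext => x; rewrite indic0.
    rewrite (_ : \bigcup_(k < n.+1) F k = (\bigcup_(k < n) F k) `|` F n); last first.
      by rewrite !bigcup_mkord big_ord_recr.
    set U := \bigcup_(k < n) F k.
    have [d0 tn] := FH n.
    move=> r e e0.
    have e2 : 0 < e / 2 by rewrite divr_gt0.
    have [d dp df] := IH r _ e2; have [d' d'p dg] := tn r _ e2.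
    exists (Num.min d d'); first by rewrite lt_min dp.
    move=> z; rewrite le_min => /andP[zd z1].
    rewrite [e]splitr EFinD; apply: le_trans (leeD (df z zd) (dg z z1)).
    have ms A' : measurable A' -> measurable_fun setT (fun x => \1_A' (x + z) - \1_A' x : R).
      by move=> mA; apply: measurable_funB; [apply: measurable_fun_shift|]; exact: mu.
    apply: le_integral_normD; first exact: measurable_nball.
    - by apply: measurable_funTS; apply: ms; exact: (measurableU _ _ (mU n) (mF n)).
    - by apply: measurable_funTS; exact: ms.
    - by apply: measurable_funTS; exact: ms.
    - move=> x _; rewrite !indicE !in_setU.
      by case: (_ \in U); case: (_ \in U); case: (_ \in F n); case: (_ \in F n);
        rewrite /= ?subrr ?subr0 ?sub0r ?normrN ?normr1 ?normr0 ?addr0 ?add0r ?lerDl ?addr_ge0.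
  apply: translation_continuous_approx; first by apply: mu; exact: bigcupT_measurable.
  move=> r e e0.
  pose g n x : R := \1_(\bigcup_k F k) x - \1_(\bigcup_(k < n) F k) x.
  have mg n : measurable_fun setT (g n).
    by apply: measurable_funB; apply: mu => //; exact: bigcupT_measurable.
  have i1 : leb.-integrable (B r) (fun=> 1%E).
    apply/integrableP; split; first exact: measurable_cst.
    under eq_integral do rewrite abse1.
    by rewrite integral_cst ?mul1e ?lebesgue_rV_nball//; exact: measurable_nball.
  (* The indicators of the partial unions converge boundedly on a ball, which has finite measure. *)
  have [||||_ + _] := @dominated_convergence _ _ _ leb (B r) (measurable_nball _)
    (fun n x => (g n x)%:E) (fun=> 0%E) (fun=> 1%E) _ _ _ i1.
  - by move=> n; apply: measurable_funTS; apply/measurable_EFinP; exact: mg.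
  - exact: measurable_cst.
  - apply: aeW => x _; apply: cvg_near_cst.
    have [[k _ Fkx]|nFx] := pselect ((\bigcup_k F k) x).
      exists k.+1 => // n /= kn; rewrite /g !indicE !mem_set//; first by rewrite subrr.
        by exists k.
      by exists k.
    near=> n; rewrite /g !indicE !memNset//; first by rewrite subrr.
    by move=> [k _ Fkx]; apply: nFx; exists k.
  - apply: aeW => x n _; rewrite lee_fin /g !indicE.
    by case: (_ \in _); case: (_ \in _); rewrite ?subrr ?subr0 ?sub0r ?normrN ?normr1 ?normr0.
  move=> /(cvge_ltP e0) [n gn].
  exists (\1_(\bigcup_(k < n) F k)); split => //.
  apply: le_trans (ltW gn); rewrite le_eqVlt; apply/orP; left; apply/eqP.
  by apply: eq_integral => x _; rewrite sube0.
(* The Borel sets of the line are generated by the rays below c, whose preimages under a coordinate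
   are halfspaces. *)
have S1 (i : 'I_N) (S : set R) : measurable S ->
    [set A | measurable A /\ translation_continuous (\1_A : 'rV[R]_N ->
      R)] ((fun x => x ord0 i) @^-1` S).
  move=> mS; have {mS} : (@ocitv R).-sigma.-measurable S := mS.
  rewrite RGenInftyO.measurableE.
  pose P := [set S | [set A | measurable A /\ translation_continuous (\1_A : 'rV[R]_N ->
    R)] ((fun x : 'rV[R]_N => x ord0 i) @^-1` S)].
  have [S00 S0C S0U] := S0.
  suff : <<s (@RGenInftyO.G R) >> `<=` P by exact.
  apply: smallest_sub.
    split; rewrite /P /=.
    - by rewrite preimage_set0.
    - by move=> A' PA; rewrite setTD -preimage_setC -setTD; exact: S0C.
    - by move=> F PF; rewrite preimage_bigcup; exact: S0U.
  move=> _ [c ->]; rewrite /P/=.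
  have -> : (fun x : 'rV[R]_N => x ord0 i) @^-1` `]-oo, c[ = [set x | x ord0 i < c].
    by apply/seteqP; split=> x /=; rewrite in_itv.
  by split; [exact: measurable_halfspace|exact: translation_continuous_halfspace].
suff : g_sigma_preimage (fun i (x : 'rV[R]_N) => x ord0 i) `<=`
  [set A | measurable A /\ translation_continuous (\1_A : 'rV[R]_N -> R)] by exact.
apply: smallest_sub => //.
rewrite -bigcup_seq => A' [i _] [S mS <-]; rewrite setTI; exact: S1.
Unshelve. all: by end_near. Qed.

Import HBSimple.

Lemma translation_continuous_integrable f : leb.-integrable setT (EFin \o f) ->
  translation_continuous f.
Proof.
move=> intf.
have mf : measurable_fun setT f by have /integrableP[/measurable_EFinP] := intf.
apply: translation_continuous_approx => // r e e0.
have [//|g [_ _ /(cvge_ltP e0)[n gn]]] := approximation_sfun_integrable _ intf.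
exists (g n); split => //.
  rewrite (_ : (g n : _ -> R) = fun x => \sum_(y \in range (g n)) y * \1_(g n @^-1` [set y]) x);
    last first.
    by apply/funext => x; rewrite fimfunE.
  have fS : finite_set (range (g n)) by [].
  pose h (s : seq R) x := \sum_(y <- s) y * \1_(g n @^-1` [set y]) x.
  have mg (y : R) : measurable (g n @^-1` [set y]) by exact: measurable_sfunP.
  have H (s : seq R) : measurable_fun setT (h s) /\ translation_continuous (h s).
    elim: s => [|y s [IH1 IH2]].
      have -> : h [::] = fun=> 0 by apply/funext => x; rewrite /h big_nil.
      by split; [exact: measurable_cst|exact: translation_continuous_cst].
    have -> : h (y :: s) = fun x => y * \1_(g n @^-1` [set y]) x + h s x.
      by apply/funext => x; rewrite /h big_cons.
    have my : measurable_fun setT (fun x => y * \1_(g n @^-1` [set y]) x).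
      by apply: measurable_funM => //; exact: measurable_indic.
    split; first exact: measurable_funD.
    apply: translation_continuousD => //; apply: translation_continuousZ.
      exact: measurable_indic.
    exact: translation_continuous_indic.
  have [_ ] := H (finmap.enum_fset (fset_set (range (g n)))).
  by congr translation_continuous; apply/funext => x; rewrite /h fsbig_finite.
apply: le_trans (ltW gn).
apply: (@le_trans _ _ (\int[leb]_x `|f x - g n x|%:E)%E).
  apply: ge0_subset_integral => //; first exact: measurable_nball.
  by apply: ge0_measurable_norm; apply: measurable_funB.
rewrite le_eqVlt; apply/orP; left; apply/eqP.
by apply: eq_integral.
Qed.

(** Bounded support turns the statement on balls into a global one: for |z| <= 1 the difference
    vanishes outside of the ball of radius r + 1. *)
Lemma translation_L1 f (r e : R) : leb.-integrable setT (EFin \o f) ->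
  bounded_support r f -> 0 < e ->
  exists2 d, 0 < d & forall z, `|z| <= d ->
    (\int[leb]_x (`|f (x + z)%R - f x|%R)%:E <= e%:E)%E.
Proof.
move=> intf fr e0.
have mf : measurable_fun setT f by have /integrableP[/measurable_EFinP] := intf.
have [d d0 df] := translation_continuous_integrable intf (r + 1) e0.
exists (Num.min d 1); first by rewrite lt_min d0 ltr01.
move=> z; rewrite le_min => /andP[zd z1].
apply: le_trans (df z zd); rewrite /translation_osc [leRHS]integral_mkcond.
rewrite le_eqVlt; apply/orP; left; apply/eqP; apply: eq_integral => x _.
rewrite patchE; case: ifPn => // /negP; rewrite inE /nball /= => /negP; rewrite -ltNge => xr.
rewrite !fr ?subrr ?normr0//; first by apply: le_lt_trans xr; rewrite lerDl.
by apply: lt_le_trans (lerB_normD x z); lra.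
Qed.

End translation_continuous_measurable.

(** * Mollification *)

Section real_integrable.
Context d (T : measurableType d) (R : realType) (mu : {measure set T -> \bar R}).
Implicit Types (f g : T -> R).

Lemma integrable_measurable f (D : set T) : mu.-integrable D (EFin \o f) -> measurable_fun D f.
Proof. by move=> /integrableP[/measurable_EFinP]. Qed.

Lemma integrable_addr f g (D : set T) : measurable D ->
  mu.-integrable D (EFin \o f) -> mu.-integrable D (EFin \o g) ->
  mu.-integrable D (EFin \o (fun x => f x + g x)).
Proof. by move=> mD If Ig; exact: (integrableD mD If Ig). Qed.

Lemma integrable_subr f g (D : set T) : measurable D ->
  mu.-integrable D (EFin \o f) -> mu.-integrable D (EFin \o g) ->
  mu.-integrable D (EFin \o (fun x => f x - g x)).
Proof. by move=> mD If Ig; exact: (integrableB mD If Ig). Qed.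

Lemma integrable_scaler (c : R) f (D : set T) : measurable D ->
  mu.-integrable D (EFin \o f) ->
  mu.-integrable D (EFin \o (fun x => c * f x)).
Proof. by move=> mD If; exact: (integrableZl mD c If). Qed.

Lemma integrable_sumr (I : Type) (s : seq I) (h : I -> T -> R) (D : set T) : measurable D ->
  (forall i, mu.-integrable D (EFin \o h i)) ->
  mu.-integrable D (EFin \o (fun x => \sum_(i <- s) h i x)).
Proof.
move=> mD Ih; elim: s => [|i s IH].
  rewrite (_ : _ \o _ = cst 0%E); first exact: integrable0.
  by apply/funext => x /=; rewrite big_nil.
rewrite (_ : (fun _ => _) = fun x => h i x + \sum_(i <- s) h i x).
  exact: integrable_addr.
by apply/funext => x; rewrite big_cons.
Qed.

Lemma integrable_dominated f g (D : set T) : measurable D -> measurable_fun D f ->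
  (forall x, D x -> `|f x| <= g x) ->
  mu.-integrable D (EFin \o g) -> mu.-integrable D (EFin \o f).
Proof.
move=> mD mf fg; apply: le_integrable => //; first exact/measurable_EFinP.
by move=> x Dx /=; rewrite lee_fin (le_trans (fg x Dx))// ler_norm.
Qed.

Lemma integrable_mulr_bounded f g (M : R) (D : set T) : measurable D ->
  mu.-integrable D (EFin \o f) -> measurable_fun D g -> (forall x, D x -> `|g x| <= M) ->
  mu.-integrable D (EFin \o (fun x => f x * g x)).
Proof.
move=> mD If mg gM.
apply: (@integrable_dominated _ (fun x => M * `|f x|)) => //.
- by apply: measurable_funM => //; exact: integrable_measurable If.
- by move=> x Dx; rewrite normrM mulrC ler_wpM2r// gM.
- by apply: integrable_scaler => //; exact: integrable_norm.
Qed.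

Lemma Rintegral_sumr (I : Type) (s : seq I) (h : I -> T -> R) (D : set T) : measurable D ->
  (forall i, mu.-integrable D (EFin \o h i)) ->
  \int[mu]_(x in D) (\sum_(i <- s) h i x) = \sum_(i <- s) \int[mu]_(x in D) h i x.
Proof.
move=> mD Ih; elim: s => [|i s IH].
  by rewrite big_nil; under eq_Rintegral do rewrite big_nil; rewrite /Rintegral integral0.
rewrite big_cons -IH -RintegralD//; last exact: integrable_sumr.
by apply: eq_Rintegral => x _; rewrite big_cons.
Qed.

Lemma EFin_Rintegral f (D : set T) : measurable D -> mu.-integrable D (EFin \o f) ->
  (\int[mu]_(x in D) f x)%:E = (\int[mu]_(x in D) (f x)%:E)%E.
Proof. by move=> mD If; rewrite /Rintegral fineK//; exact: integrable_fin_num. Qed.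

Lemma ge0_integrable_lty f (D : set T) : measurable D -> measurable_fun D f ->
  (forall x, D x -> 0 <= f x) -> (\int[mu]_(x in D) (f x)%:E < +oo)%E ->
  mu.-integrable D (EFin \o f).
Proof.
move=> mD mf f0 foo; apply/integrableP; split; first exact/measurable_EFinP.
apply: le_lt_trans foo; rewrite le_eqVlt; apply/orP; left; apply/eqP.
by apply: eq_integral => x /set_mem Dx /=; rewrite ger0_norm// f0.
Qed.

End real_integrable.

Section bounded_integrable.
Context {R : realType} {N : nat}.
Local Notation leb := (lebesgue_rV N).
Local Notation X := 'rV[R]_N.
Implicit Types (f g : X -> R).

Lemma integrable_bounded_support f (M r : R) : measurable_fun setT f ->
  (forall x, `|f x| <= M) -> bounded_support r f -> leb.-integrable setT (EFin \o f).
Proof.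
move=> mf fM fr.
have mB := @measurable_nball R N r.
have : leb.-integrable (@nball R N r) (EFin \o f).
  apply: measurable_bounded_integrable => //.
  - exact: lebesgue_rV_nball.
  - exact: measurable_funTS.
  - exists M; split; first exact: num_real.
    by move=> y My x _; exact: le_trans (fM x) (ltW My).
move=> /(integrable_mkcond _ mB); congr integrable; apply/funext => x.
rewrite patchE; case: ifPn => // /negP; rewrite inE /nball/= => /negP; rewrite -ltNge => /fr.
by move=> /= ->.
Qed.

Lemma integrable_continuous_bounded_support f (r : R) : continuous f ->
  bounded_support r f -> leb.-integrable setT (EFin \o f).
Proof.
move=> cf fr; have [M _ fM] := bounded_support_bounded cf fr.
by apply: integrable_bounded_support fM fr; exact: measurable_continuous_row.
Qed.

End bounded_integrable.

Definition smooth {R : realType} {N : nat} (phi : 'rV[R]_N -> R) := forall k, Ck k phi.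

Section mollifier.
Context {R : realType} {N : nat}.
Local Notation leb := (lebesgue_rV N).
Local Notation X := 'rV[R]_N.
Implicit Types (x y z : X) (phi rho : X -> R).

Lemma smooth_continuous phi : smooth phi -> continuous phi.
Proof. by move=> /(_ 0%N)[]. Qed.

Lemma smooth_partial phi i : smooth phi -> smooth (partial i phi).
Proof. by move=> s k; have [_ /(_ i)[]] := s k.+1. Qed.

Lemma smoothM phi psi : smooth phi -> smooth psi -> smooth (fun x => phi x * psi x).
Proof. by move=> s t k; exact: CkM. Qed.

Lemma smoothZ (c : R) phi : smooth phi -> smooth (fun x => c * phi x).
Proof. by move=> s k; exact: CkZ. Qed.

Lemma smooth_shift phi a : smooth phi -> smooth (fun x => phi (x + a)).
Proof. by move=> s k; exact: Ck_shift. Qed.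

Lemma smooth_is_derive phi i x : smooth phi -> is_derive x (basis i) phi (partial i phi x).
Proof. by move=> s; exact: (@Ck_is_derive _ _ 0%N phi i x (s 1%N)). Qed.

Lemma partialM phi psi i : smooth phi -> smooth psi ->
  partial i (fun x => phi x * psi x) = fun x => phi x * partial i psi x + psi x * partial i phi x.
Proof.
move=> s t; apply: partial_eq => x.
by apply: is_deriveM; exact: smooth_is_derive.
Qed.

(** The norm on rows is the maximum norm. Hence a product of one-variable factors, the i-th of which
    is positive exactly for |x_i| < e, is positive exactly on the open ball of radius e. *)
Definition bump (e : R) x : R :=
  \prod_(i < N) (flat 0 (- e^-1 * x ord0 i + 1) * flat 0 (e^-1 * x ord0 i + 1)).

Lemma smooth_bump e : smooth (bump e).
Proof. by move=> k; apply: Ck_prod => i; apply: CkM; exact: Ck_flat. Qed.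

Lemma bump_ge0 e x : 0 <= bump e x.
Proof. by apply: prodr_ge0 => i _; rewrite mulr_ge0// flat_ge0. Qed.

Lemma bump_support e : 0 < e -> bounded_support e (bump e).
Proof.
move=> e0 x ex.
have [i xi] : exists i, e < `|x ord0 i|.
  apply: contrapT => /forallNP H; move: ex; rewrite ltNge => /negP; apply.
  by apply: row_norm_le => [|i]; [exact: ltW|rewrite leNgt; exact/negP/H].
rewrite /bump (bigD1 i)//=.
move: xi; rewrite ltr_normr => /orP[xi|xi].
  rewrite (@flat_le0 _ _ (- e^-1 * _ + _)) ?mul0r//.
  by rewrite mulNr addrC subr_le0 mulrC ler_pdivlMr// mul1r ltW.
rewrite (@flat_le0 _ _ (e^-1 * _ + _)) ?mulr0 ?mul0r//.
by rewrite -lerBrDr sub0r mulrC ler_pdivrMr// mulN1r lerNr ltW.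
Qed.

Lemma bump_gt0 e x : 0 < e -> `|x| < e -> 0 < bump e x.
Proof.
move=> e0 xe; apply: prodr_gt0 => i _.
have := le_lt_trans (normr_coord_le x i) xe; rewrite ltr_norml => /andP[x1 x2].
by rewrite mulr_gt0// flat_gt0// ?mulNr -ltrBlDr sub0r ?ltrN2 mulrC ?ltr_pdivlMr ?ltr_pdivrMr//
  ?mulN1r ?mul1r.
Qed.

Lemma lebesgue_rV_nball_gt0 (r : R) : 0 < r -> (0 < leb (@nball R N r))%E.
Proof.
move=> r0; rewrite nballE ?ltW//.
rewrite (lebesgue_rV_box (A := fun=> `[- r, r]%classic))//.
apply: (big_ind (fun x : \bar R => (0 < x)%E)) => //.
  by move=> x y x0 y0; exact: mule_gt0.
by move=> i _; rewrite /= lebesgue_measure_itv/= lte_fin ifT ?gtrN// -EFinD lte_fin; lra.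
Qed.

Lemma mollifier_exists (e : R) : 0 < e -> exists rho : X -> R,
  [/\ smooth rho, forall x, 0 <= rho x, bounded_support e rho & \int[leb]_x rho x = 1].
Proof.
move=> e0.
have Ib := integrable_continuous_bounded_support (smooth_continuous (smooth_bump e))
  (bump_support e0).
pose c := \int[leb]_x bump e x.
have c0 : 0 < c.
  (* The positive minimum of the bump on the ball of radius e / 2 bounds its integral from below. *)
  have [|||x0 x0B m] := @compact_EVT_min _ R (bump e) (@nball R N (e / 2)).
  - by exists 0; rewrite /nball/= normr0 divr_ge0// ltW.
  - exact: compact_norm_le.
  - exact: (continuous_subspaceT (smooth_continuous (smooth_bump e))).
  have b0 : 0 < bump e x0.
    apply: bump_gt0 => //; move: x0B; rewrite inE /nball/= => /le_lt_trans; apply.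
    by rewrite ltr_pdivrMr// ltr_pMr// ltr1n.
  rewrite -lte_fin /c EFin_Rintegral//.
  apply: (@lt_le_trans _ _ ((bump e x0)%:E * leb (@nball R N (e / 2)))%E).
    by rewrite mule_gt0// lebesgue_rV_nball_gt0// divr_gt0.
  rewrite -integral_cst; last exact: measurable_nball.
  apply: (@le_trans _ _ (\int[leb]_(x in @nball R N (e / 2)) (bump e x)%:E)%E).
    apply: ge0_le_integral => //.
    - exact: measurable_nball.
    - by move=> x _; rewrite lee_fin ltW.
    - by apply: measurable_funTS; have /integrableP[] := Ib.
    - by move=> x Bx; rewrite lee_fin m// inE.
  apply: ge0_subset_integral => //.
  - exact: measurable_nball.
  - by have /integrableP[] := Ib.
  - by move=> x _; rewrite lee_fin bump_ge0.
exists (fun x => c^-1 * bump e x); split.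
- exact/smoothZ/smooth_bump.
- by move=> x; rewrite mulr_ge0 ?bump_ge0// invr_ge0 ltW.
- by move=> x ex; rewrite bump_support// mulr0.
- by rewrite RintegralZl// mulVf// gt_eqF.
Qed.

End mollifier.

Section mollification.
Context {R : realType} {N : nat}.
Local Notation leb := (lebesgue_rV N).
Local Notation X := 'rV[R]_N.
Implicit Types (x y z : X) (phi rho w : X -> R).

(** The kernel is taken at y - x, without the reflection of a convolution. Differentiating in x then
    puts a minus sign on [partial i rho], the one that integration by parts against rho (y - x)
    removes. *)
Definition moll rho w x : R := \int[leb]_y (w y * rho (y - x)).

Lemma integrable_moll rho w r x : continuous rho -> bounded_support r rho ->
  leb.-integrable setT (EFin \o w) ->
  leb.-integrable setT (EFin \o (fun y => w y * rho (y - x))).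
Proof.
move=> cr sr Iw; have [M _ rM] := bounded_support_bounded cr sr.
apply: (@integrable_mulr_bounded _ _ _ _ _ _ M) => //.
by apply: (measurable_fun_shift (- x)); exact: measurable_continuous_row.
Qed.

Lemma lipschitz_continuous_row (f : X -> R) (L : R) :
  (forall x v, `|f (x + v) - f x| <= L * `|v|) -> continuous f.
Proof.
move=> fL x; suff : f @ nbhs x --> f x by [].
apply/cvgrPdist_le => /= e e0; near=> y.
have L0 : 0 < `|L| + 1 by rewrite ltr_wpDl.
have yx : `|x - y| <= e / (`|L| + 1).
  by near: y; apply: (@cvgr_dist_le _ _ _ _ _ id x) => //; rewrite divr_gt0.
have := fL x (y - x); rewrite (addrC x) subrK distrC => H; apply: (le_trans H).
rewrite distrC in yx; apply: (le_trans (ler_wpM2r (normr_ge0 _) (ler_norm L))).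
apply: (le_trans (ler_wpM2l (normr_ge0 L) yx)).
by rewrite mulrCA ler_piMr ?(ltW e0)// ler_pdivrMr// mul1r lerDl.
Unshelve. all: by end_near. Qed.

Lemma le_normr_Rintegral_mul (D : X -> R) w (K : R) : leb.-integrable setT (EFin \o w) ->
  measurable_fun setT D -> (forall y, `|D y| <= K) ->
  `|\int[leb]_y (w y * D y)| <= K * \int[leb]_y `|w y|.
Proof.
move=> Iw mD DK.
have Iwn : leb.-integrable setT (EFin \o (fun y => `|w y|)) by exact: integrable_norm.
have I1 : leb.-integrable setT (EFin \o (fun y => w y * D y)).
  exact: (integrable_mulr_bounded _ Iw mD (fun y _ => DK y)).
apply: (le_trans (le_normr_Rintegral _ I1)) => //.
rewrite -RintegralZl//; apply: le_Rintegral => //.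
- exact: integrable_norm.
- exact: integrable_scaler.
- by move=> y _; rewrite normrM mulrC ler_wpM2r.
Qed.

Lemma continuous_moll rho w r : Ck 1 rho -> bounded_support r rho ->
  leb.-integrable setT (EFin \o w) -> continuous (moll rho w).
Proof.
move=> Cr sr Iw.
have [L L0 rL] := bounded_support_lipschitz Cr sr.
have cr := Ck_continuous Cr; have mr := measurable_continuous_row cr.
apply: (@lipschitz_continuous_row _ (L * \int[leb]_y `|w y|)) => x v.
rewrite /moll -RintegralB//; try exact: integrable_moll cr sr Iw.
under eq_Rintegral do rewrite -mulrBr.
rewrite mulrAC; apply: le_normr_Rintegral_mul => //.
  by apply: measurable_funB; exact: measurable_fun_shift.
by move=> y; rewrite -[`|v|]normrN opprD addrA rL.
Qed.

(** [partial i rho] is Lipschitz, so the Taylor remainder of the kernel is at most L h ^ 2 uniformly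
    in y; integrated against w it gives a quadratic remainder for the mollification. *)
Lemma is_derive_moll rho w r i x : Ck 2 rho -> bounded_support r rho ->
  leb.-integrable setT (EFin \o w) ->
  is_derive x (basis i) (moll rho w) (moll (fun y => - partial i rho y) w x).
Proof.
move=> Cr sr Iw.
have C1 : Ck 1 (partial i rho) by case: Cr => _ /(_ i)[].
have sp := bounded_support_partial i sr.
have [L L0 rL] := bounded_support_lipschitz C1 sp.
have cr := Ck_continuous Cr; have mr := measurable_continuous_row cr.
have cp := Ck_continuous C1; have mp := measurable_continuous_row cp.
have cpN : continuous (fun y => - partial i rho y).
  by move=> y; exact: (continuousN (cp y)).
have spN : bounded_support r (fun y => - partial i rho y).
  by move=> y /sp ->; rewrite oppr0.
apply: (@is_derive_quad _ _ _ _ _ _ (L * \int[leb]_y `|w y|)) => h _.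
have Im a := integrable_moll a cr sr Iw.
have IN := integrable_moll x cpN spN Iw.
rewrite /moll -RintegralB// -RintegralZl// -RintegralB//; last 2 first.
- exact: integrable_subr.
- exact: integrable_scaler.
rewrite (_ : (fun _ => _) = fun y => w y * (rho (y - (h *: basis i + x)) - rho (y - x) + h *
  partial i rho (y - x))); last first.
  by apply/funext => y; ring.
rewrite mulrAC; apply: le_normr_Rintegral_mul => //.
  apply: measurable_funD; first by apply: measurable_funB; exact: measurable_fun_shift.
  by apply: measurable_funM => //; exact: measurable_fun_shift.
move=> y.
have [c ch] := mean_value_partial i (y - x) (- h) (CkS Cr).
have -> : - h *: basis i + (y - x) = y - (h *: basis i + x).
  by rewrite scaleNr opprD addrCA.
move=> ->; set A := partial i rho (c *: _ + _); set B := partial i rho _.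
have -> : A * - h + h * B = h * (B - A) by ring.
rewrite normrM distrC -(real_normK (num_real h)) expr2 mulrCA ler_wpM2l//.
rewrite /A [c *: _ + _]addrC; apply: (le_trans (rL _ _));
  rewrite normrZ norm_basis mulr1 ler_wpM2l//.
by rewrite normrN in ch.
Qed.

Lemma partial_moll rho w r i : Ck 2 rho -> bounded_support r rho ->
  leb.-integrable setT (EFin \o w) ->
  partial i (moll rho w) = moll (fun y => - partial i rho y) w.
Proof. by move=> C s Iw; apply: partial_eq => x; exact: is_derive_moll C s Iw. Qed.

Lemma smooth_moll rho w r : smooth rho -> bounded_support r rho ->
  leb.-integrable setT (EFin \o w) -> smooth (moll rho w).
Proof.
move=> sr br Iw k; elim: k rho sr br => [|k IH] rho sr br.
  by split => //; exact: (continuous_moll (sr 1%N) br Iw).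
apply: (@Ck_intro _ _ _ _ (fun i => moll (fun y => - partial i rho y) w)).
- exact: (continuous_moll (sr 1%N) br Iw).
- by move=> i x; exact: (is_derive_moll i x (sr 2%N) br Iw).
move=> i; apply: IH; last by move=> y /(bounded_support_partial i br) ->; rewrite oppr0.
rewrite (_ : (fun _ => _) = fun y => -1 * partial i rho y); last by apply/funext => y; ring.
exact/smoothZ/smooth_partial.
Qed.

Lemma moll_eq0 rho w r x : bounded_support r rho ->
  (forall y, `|y - x| <= r -> w y = 0) -> moll rho w x = 0.
Proof.
move=> sr w0; rewrite /moll /Rintegral (eq_integral (fun=> 0%E)) ?integral0// => y _.
have [yr|yr] := leP `|y - x| r; first by rewrite w0// mul0r.
by rewrite sr// mulr0.
Qed.

Lemma moll_eq1 rho w r x : bounded_support r rho -> continuous rho -> \int[leb]_x rho x = 1 ->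
  (forall y, `|y - x| <= r -> w y = 1) -> moll rho w x = 1.
Proof.
move=> sr cr r1 w1; rewrite -r1 /moll.
rewrite -[RHS](Rintegral_shift (- x)); last exact: measurable_continuous_row.
apply: eq_Rintegral => y _.
have [yr|yr] := leP `|y - x| r; first by rewrite w1// mul1r.
by rewrite sr// mulr0.
Qed.

(** As rho has integral 1, [moll rho w x - w x] is the mean of w (x + z) - w x with weight rho z. By
    Tonelli its L^1 norm is at most the mean of the L^1 norms of these increments, each at most e on
    the support of rho. *)
Lemma moll_L1 rho w (d e : R) : Ck 1 rho -> (forall x, 0 <= rho x) ->
  bounded_support d rho -> \int[leb]_x rho x = 1 ->
  leb.-integrable setT (EFin \o w) ->
  (forall z, `|z| <= d -> (\int[leb]_x (`|w (x + z)%R - w x|%R)%:E <= e%:E)%E) ->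
  (\int[leb]_x (`|w x - moll rho w x|%R)%:E <= e%:E)%E.
Proof.
move=> C1 r0 sr r1 Iw we; have cr := Ck_continuous C1.
have mw := integrable_measurable Iw; have mr := measurable_continuous_row cr.
have Ir := integrable_continuous_bounded_support cr sr.
have [M _ rM] := bounded_support_bounded cr sr.
pose G x z := (w (x + z) - w x) * rho z.
have Iws x : leb.-integrable setT (EFin \o (fun z => w (x + z))).
  by have := integrable_shift x Iw; congr integrable; apply/funext => z /=; rewrite addrC.
have IG x : leb.-integrable setT (EFin \o G x).
  rewrite (_ : G x = fun z => w (x + z) * rho z - w x * rho z); last first.
    by apply/funext => z; rewrite /G mulrBl.
  apply: integrable_subr => //; last exact: integrable_scaler.
  exact: (integrable_mulr_bounded _ (Iws x) mr (fun z _ => rM z)).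
have mollE x : moll rho w x - w x = \int[leb]_z G x z.
  rewrite /G; under eq_Rintegral do rewrite mulrBl.
  rewrite RintegralB//; last exact: integrable_scaler.
    rewrite RintegralZl// r1 mulr1; congr (_ - _); rewrite /moll.
    rewrite -(Rintegral_shift x); last first.
      by apply: measurable_funM => //; exact: measurable_fun_shift.
    by apply: eq_Rintegral => z _; rewrite addrK addrC.
  exact: (integrable_mulr_bounded _ (Iws x) mr (fun z _ => rM z)).
have mG : measurable_fun setT (fun p : X * X => (`|G p.1 p.2|%:E)).
  apply/measurable_EFinP; apply: measurableT_comp => //; apply: measurable_funM; last first.
    exact: measurableT_comp mr measurable_snd.
  apply: measurable_funB; last exact: measurableT_comp mw measurable_fst.
  apply: (measurableT_comp mw); apply: measurable_fun_row => i.
  rewrite (_ : (fun _ => _) = fun p : X * X => p.1 ord0 i + p.2 ord0 i); last first.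
    by apply/funext => p; rewrite mxE.
  apply: measurable_funD.
    exact: (measurableT_comp (measurable_coord i) measurable_fst).
  exact: (measurableT_comp (measurable_coord i) measurable_snd).
apply: (@le_trans _ _ (\int[leb]_x \int[leb]_z (`|G x z|%:E))%E).
  apply: ge0_le_integral => //.
  - apply: ge0_measurable_norm; apply: measurable_funB => //.
    exact: measurable_continuous_row (continuous_moll C1 sr Iw).
  - exact: (measurable_fun_fubini_tonelli_F (fun p : X * X => (`|G p.1 p.2|%:E)) mG).
  - move=> x _; rewrite distrC mollE EFin_normr_Rintegral//.
    apply: le_abse_integral => //; exact: measurable_int (IG x).
rewrite (fubini_tonelli (fun p : X * X => (`|G p.1 p.2|%:E)) mG)//.
apply: (@le_trans _ _ (\int[leb]_z (e%:E * (rho z)%:E))%E).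
  apply: ge0_le_integral => //.
  - by move=> z _; exact: integral_ge0.
  - exact: (measurable_fun_fubini_tonelli_G (fun p : X * X => (`|G p.1 p.2|%:E)) mG).
  - apply/measurable_EFinP; exact: measurable_funM.
  move=> z _ /=.
  have [zd|zd] := leP `|z| d; last first.
    rewrite (eq_integral (fun=> 0%E)); first by rewrite integral0 sr// mule0.
    by move=> x _; rewrite /G sr// mulr0 normr0.
  under eq_integral do rewrite /G normrM EFinM.
  rewrite ge0_integralZr//; last first.
    by apply: ge0_measurable_norm; apply: measurable_funB => //; exact: measurable_fun_shift.
  rewrite (ger0_norm (r0 z)); apply: lee_wpmul2r; first by rewrite lee_fin.
  exact: we.
(* The hypothesis at z = 0 gives this if d >= 0. If d < 0 then rho vanishes identically, against its
   integral being 1. *)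
have e0 : 0 <= e.
  have [d0|d0] := leP 0 d.
    by have := we 0; rewrite normr0 => /(_ d0); rewrite -lee_fin; apply: le_trans;
      exact: integral_ge0.
  have : \int[leb]_x rho x = 0.
    rewrite /Rintegral (eq_integral (fun=> 0%E)) ?integral0// => y _.
    by rewrite sr// (lt_le_trans d0).
  by move/eqP; rewrite r1 oner_eq0.
rewrite ge0_integralZl//; last 2 first.
- exact/measurable_EFinP.
- by move=> z _; rewrite lee_fin.
by rewrite -EFin_Rintegral// r1 mule1.
Qed.

End mollification.

(** * Weak derivatives *)

Section test_functions.
Context {R : realType} {N : nat}.
Local Notation leb := (lebesgue_rV N).
Local Notation X := 'rV[R]_N.
Implicit Types (x y z : X) (phi w v : X -> R) (E K : set X).

Lemma test_function_smooth E phi : test_function E phi -> smooth phi.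
Proof. by case. Qed.

Lemma test_function_bounded_support E phi : test_function E phi ->
  exists r, bounded_support r phi.
Proof.
move=> [_ /compact_bounded [M [_ HM]] _].
exists (M + 1) => x xM; apply/eqP/negPn/negP => phix.
have : `|x| <= M + 1 by apply: HM; [rewrite ltrDl|exact: subset_closure].
by rewrite leNgt xM.
Qed.

Lemma test_function_neq0 E phi x : test_function E phi -> phi x != 0 -> E x.
Proof. by move=> [_ _ sE] px; apply: sE; exact: subset_closure. Qed.

Lemma test_function_eq0 E phi x : test_function E phi -> ~ E x -> phi x = 0.
Proof.
by move=> t Ex; apply/eqP/negPn/negP => px; apply: Ex; exact: test_function_neq0 t px.
Qed.

Lemma test_function_intro E K phi : smooth phi -> compact K -> K `<=` E ->
  (forall x, phi x != 0 -> K x) -> test_function E phi.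
Proof.
move=> s cK KE phiK.
have sK : closure [set x | phi x != 0] `<=` K.
  have hX : hausdorff_space X := @norm_hausdorff R X.
  have -> : K = closure K by exact/closure_id/(compact_closed hX cK).
  exact: closure_subset.
split => //; last exact: subset_trans sK KE.
by apply: subclosed_compact cK sK; exact: closed_closure.
Qed.

Lemma test_function_setT r phi : smooth phi -> bounded_support r phi ->
  test_function setT phi.
Proof.
move=> s b; apply: (@test_function_intro _ (@nball R N r)) => //.
  exact: compact_norm_le.
by move=> x; apply: contraNP => /negP; rewrite /nball/= -ltNge => /b ->.
Qed.

Lemma test_function_subset E E' phi : E `<=` E' -> test_function E phi ->
  test_function E' phi.
Proof. by move=> EE' [s c sE]; split => //; exact: subset_trans EE'. Qed.

Lemma test_function_shift E E' a phi : (forall x, E x -> E' (x - a)) ->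
  test_function E phi -> test_function E' (fun x => phi (x + a)).
Proof.
move=> EE' [s c sE].
apply: (@test_function_intro _ ((fun x => x - a) @` closure [set x | phi x != 0])).
- exact: smooth_shift.
- apply: continuous_compact => //; apply: continuous_subspaceT => x.
  exact: (continuousD (@cvg_id _ (nbhs x)) (@cst_continuous _ _ (- a) x)).
- by move=> _ [x /sE Ex <-]; exact: EE'.
- move=> x px; exists (x + a); last by rewrite addrK.
  exact: subset_closure.
Qed.

Lemma test_functionM E phi psi : smooth psi -> test_function E phi ->
  test_function E (fun x => psi x * phi x).
Proof.
move=> t [s c sE].
apply: (test_function_intro _ c sE); first exact: smoothM.
by move=> x; rewrite mulf_eq0 negb_or => /andP[_ px]; exact: subset_closure.
Qed.

Lemma test_function_partial E phi i : test_function E phi -> test_function E (partial i phi).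
Proof.
move=> [s c sE]; apply: (test_function_intro _ c sE); first exact: smooth_partial.
move=> x; apply: contraNP => nx.
rewrite /partial -(derive_cst (0 : R) x (basis i)); apply/eqP.
apply: near_eq_derive; near=> y; apply/eqP/negPn/negP => py.
have : (~` closure [set x | phi x != 0]) y.
  near: y; apply: open_nbhs_nbhs; split => //; apply: closed_openC; exact: closed_closure.
by apply; exact: subset_closure.
Unshelve. all: by end_near. Qed.

Lemma test_function_bounded E phi : test_function E phi ->
  exists2 M, 0 <= M & forall x, `|phi x| <= M.
Proof.
move=> t; have [r b] := test_function_bounded_support t.
exact: bounded_support_bounded (smooth_continuous (test_function_smooth t)) b.
Qed.

Lemma test_function_measurable E phi : test_function E phi -> measurable_fun setT phi.
Proof.
move=> t; apply: measurable_continuous_row.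
exact: smooth_continuous (test_function_smooth t).
Qed.

Lemma integrable_test_functionM E phi w : test_function E phi ->
  leb.-integrable setT (EFin \o w) -> leb.-integrable setT (EFin \o (fun x => w x * phi x)).
Proof.
move=> t Iw; have [M _ pM] := test_function_bounded t.
by apply: (integrable_mulr_bounded _ Iw (test_function_measurable t) (fun x _ => pM x)).
Qed.

(** The integrals run over the whole space and [E] constrains the test functions only, so that
    functions extended by zero can be shifted and multiplied without changing the domain of
    integration. *)
Definition weak_deriv E i w v := forall phi, test_function E phi ->
  \int[leb]_x (w x * partial i phi x) = - \int[leb]_x (v x * phi x).

Lemma weak_deriv_subset E E' i w v : E `<=` E' -> weak_deriv E' i w v -> weak_deriv E i w v.
Proof. by move=> EE' H phi t; apply: H; exact: test_function_subset t. Qed.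

Lemma weak_deriv_shift E E' i w v a : (forall x, E x -> E' (x + a)) ->
  leb.-integrable setT (EFin \o w) -> leb.-integrable setT (EFin \o v) ->
  weak_deriv E' i w v -> weak_deriv E i (fun x => w (x + a)) (fun x => v (x + a)).
Proof.
move=> EE' Iw Iv H phi t.
have t' : test_function E' (fun x => phi (x - a)).
  by apply: test_function_shift t => x /EE'; rewrite opprK.
have := H _ t'; rewrite partial_shift.
rewrite -(Rintegral_shift a); last first.
  apply: measurable_funM; first exact: integrable_measurable Iw.
  apply: measurable_fun_shift; exact: test_function_measurable (test_function_partial i t).
rewrite -[in X in _ = - X -> _](Rintegral_shift a); last first.
  apply: measurable_funM; first exact: integrable_measurable Iv.
  exact: test_function_measurable t'.
under eq_Rintegral do rewrite addrK.
by under [in X in _ = - X -> _]eq_Rintegral do rewrite addrK.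
Qed.

Lemma weak_derivB E i w v w' v' :
  leb.-integrable setT (EFin \o w) -> leb.-integrable setT (EFin \o v) ->
  leb.-integrable setT (EFin \o w') -> leb.-integrable setT (EFin \o v') ->
  weak_deriv E i w v -> weak_deriv E i w' v' ->
  weak_deriv E i (fun x => w x - w' x) (fun x => v x - v' x).
Proof.
move=> Iw Iv Iw' Iv' H H' phi t.
have tp := test_function_partial i t.
have e (a b c : X -> R) : (fun x => (a x - b x) * c x) = fun x => a x * c x - b x * c x.
  by apply/funext => x; rewrite mulrBl.
rewrite !e !RintegralB//; try exact: (integrable_test_functionM t);
  try exact: (integrable_test_functionM tp).
by rewrite H// H'// opprB opprK addrC.
Qed.

Lemma weak_derivZ E i w v (c : R) :
  leb.-integrable setT (EFin \o w) -> leb.-integrable setT (EFin \o v) ->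
  weak_deriv E i w v -> weak_deriv E i (fun x => c * w x) (fun x => c * v x).
Proof.
move=> Iw Iv H phi t.
have tp := test_function_partial i t.
have e (a b : X -> R) : (fun x => (c * a x) * b x) = fun x => c * (a x * b x).
  by apply/funext => x; rewrite mulrA.
rewrite !e !RintegralZl//; try exact: (integrable_test_functionM t);
  try exact: (integrable_test_functionM tp).
by rewrite H// mulrN.
Qed.

(** [E'] is arbitrary because [zeta * phi] is a test function of [E] whatever the support of phi. A
    cutoff thus turns a weak derivative on [E] into one on the whole space. *)
Lemma weak_derivM E E' i w v zeta :
  leb.-integrable setT (EFin \o w) -> leb.-integrable setT (EFin \o v) ->
  test_function E zeta -> weak_deriv E i w v ->
  weak_deriv E' i (fun x => zeta x * w x) (fun x => zeta x * v x + partial i zeta x * w x).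
Proof.
move=> Iw Iv tz H phi t.
have sz := test_function_smooth tz; have sp := test_function_smooth t.
have tzp : test_function E (fun x => zeta x * phi x).
  have := test_functionM sp tz.
  by congr test_function; apply/funext => x; rewrite mulrC.
have := H _ tzp; rewrite partialM//.
have t1 := test_functionM sz (test_function_partial i t).
have t2 := test_functionM sp (test_function_partial i tz).
have I1 := integrable_test_functionM t1 Iw.
have I2 := integrable_test_functionM t2 Iw.
have I3 := integrable_test_functionM tzp Iv.
under eq_Rintegral do rewrite mulrDr.
rewrite (RintegralD _ I1 I2)// => e1.
have -> : (fun x => (zeta x * v x + partial i zeta x * w x) * phi x) =
   fun x => v x * (zeta x * phi x) + w x * (phi x * partial i zeta x).
  by apply/funext => x; ring.
rewrite (RintegralD _ I3 I2)// opprD -e1 addrK.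
by apply: eq_Rintegral => x _; ring.
Qed.

End test_functions.

(** * Smooth approximation and cutoff functions *)

Section approximation.
Context {R : realType} {N : nat}.
Local Notation leb := (lebesgue_rV N).
Local Notation X := 'rV[R]_N.
Implicit Types (x y z : X) (phi w : X -> R) (E K : set X).

(** Mollification commutes with weak derivatives, as one sees by testing with the translated kernels
    rho (y - x); x is arbitrary, hence weak derivatives on the whole space. One kernel serves [w]
    and all the [v i]. *)
Lemma weak_deriv_approx w (v : 'I_N -> X -> R) (r e : R) :
  leb.-integrable setT (EFin \o w) -> (forall i, leb.-integrable setT (EFin \o v i)) ->
  bounded_support r w -> (forall i, bounded_support r (v i)) ->
  (forall i, weak_deriv setT i w (v i)) -> 0 < e ->
  exists phi, [/\ smooth phi,
    forall x, phi x != 0 -> exists2 y, `|y - x| <= e & w y != 0,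
    (\int[leb]_x (`|w x - phi x|%R)%:E <= e%:E)%E &
    forall i, (\int[leb]_x (`|v i x - partial i phi x|%R)%:E <= e%:E)%E].
Proof.
move=> Iw Iv bw bv wd e0.
have [d0 d00 wd0] := translation_L1 Iw bw e0.
have /boolp.choice[dv dvP] : forall i, exists d, 0 < d /\ forall z, `|z| <= d ->
    (\int[leb]_x (`|v i (x + z)%R - v i x|%R)%:E <= e%:E)%E.
  by move=> i; have [d dp dP] := translation_L1 (Iv i) (bv i) e0; exists d.
(* The radius is also at most e, so that the mollification vanishes beyond distance e from the
   points where w is nonzero. *)
pose d := \big[Num.min/Num.min d0 e]_(i < N) dv i.
have dp : 0 < d.
  by rewrite lt_bigmin; [|rewrite lt_min d00|move=> i _; have [] := dvP i].
have dd0 : d <= Num.min d0 e by exact: bigmin_le_id.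
have ddv i : d <= dv i by exact: bigmin_le_cond.
have [rho [sr r0 br r1]] := @mollifier_exists R N d dp.
exists (moll rho w); split.
- exact: smooth_moll sr br Iw.
- move=> x; apply: contraNP => /forall2NP nx; apply/eqP/(moll_eq0 br) => y yd.
  have [] := nx y; last by move=> /negP/negPn/eqP.
  by rewrite (le_trans yd)// (le_trans dd0)// ge_min lexx orbT.
- apply: (moll_L1 (sr 1%N) r0 br r1 Iw) => z zd; apply: wd0.
  by rewrite (le_trans zd)// (le_trans dd0)// ge_min lexx.
move=> i; rewrite (partial_moll _ (sr 2%N) br Iw).
have -> : moll (fun y => - partial i rho y) w = moll rho (v i).
  apply/funext => x; rewrite /moll.
  have t : test_function setT (fun y => rho (y - x)).
    apply: (@test_function_shift _ _ setT setT (- x)) => //.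
    exact: test_function_setT sr br.
  have := wd i _ t; rewrite partial_shift.
  have -> : (fun y => w y * - partial i rho (y - x)) = fun y => -1 * (w y * partial i rho (y - x)).
    by apply/funext => y; ring.
  rewrite RintegralZl//; first by move=> ->; rewrite mulN1r opprK.
  have := integrable_test_functionM (test_function_partial i t) Iw.
  by rewrite partial_shift.
apply: (moll_L1 (sr 1%N) r0 br r1 (Iv i)) => z zd.
by have [_] := dvP i; apply; exact: le_trans (ddv i).
Qed.

(** Mollify, at scale d, the indicator of the neighbourhood of radius 2 d: within d of A the kernel
    sees only the value 1, beyond 3 d only the value 0. *)
Lemma cutoff_exists (A : set X) (d r : R) : 0 < d -> (forall x, A x -> `|x| <= r) ->
  exists zeta : X -> R, [/\ smooth zeta,
    forall x y, A x -> `|y - x| < d -> zeta y = 1 &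
    forall y, zeta y != 0 -> exists2 x, A x & `|y - x| < 3 * d].
Proof.
move=> d0 Ar.
pose U := \bigcup_(x in A) ball x (2 * d).
have oU : open U by apply: bigcup_open => x _; exact: ball_open.
have mU := open_measurable_row oU.
have UE y : U y <-> exists2 x, A x & `|y - x| < 2 * d.
  split=> [[x Ax]|[x Ax xy]].
    by rewrite -ball_normE /= distrC => xy; exists x.
  by exists x => //; rewrite -ball_normE /= distrC.
have Iw : leb.-integrable setT (EFin \o (\1_U : X -> R)).
  apply: (@integrable_bounded_support _ _ _ 1 (r + 2 * d)); first exact: measurable_indic.
    by move=> x; rewrite indicE; case: (_ \in _); rewrite ?normr1 ?normr0.
  move=> y yr; rewrite indicE memNset// => /UE[x Ax yx]; move: yr; rewrite ltNge => /negP; apply.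
  rewrite -[y](subrK x) addrC (le_trans (ler_normD _ _))// lerD//; first exact: Ar.
  exact: ltW.
have [rho [sr r0 br r1]] := @mollifier_exists R N d d0.
exists (moll rho (\1_U)); split.
- exact: smooth_moll sr br Iw.
- move=> x y Ax yx; apply: (moll_eq1 br (smooth_continuous sr) r1) => z zy.
  rewrite indicE mem_set//; apply/UE; exists x => //.
  rewrite -[z](subrK y) -addrA (le_lt_trans (ler_normD _ _))//.
  by have -> : 2 * d = d + d by [ring]; rewrite ler_ltD.
move=> y; apply: contraNP => /forall2NP ny; apply/eqP/(moll_eq0 br) => z zy.
rewrite indicE memNset// => /UE[x Ax zx].
have [] := ny x => //; apply.
rewrite -[y](subrK z) -addrA (le_lt_trans (ler_normD _ _))//.
have -> : 3 * d = d + 2 * d by ring.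
by rewrite distrC ler_ltD.
Qed.

End approximation.

(** * Difference quotients of weakly differentiable functions *)

Section unit_interval.
Context {R : realType}.
Local Open Scope ereal_scope.
Local Notation lebR := (@lebesgue_measure R).
Local Notation I01 := (`[0%R, 1%R]%classic : set R).

Lemma unit_interval_measure : lebR I01 = 1.
Proof. by rewrite lebesgue_measure_itv/= lte_fin ltr01 oppr0 adde0. Qed.

(* Jensen's inequality; [m] is any lower bound of the mean of [g], which may be
   infinite. *)
Lemma powR_mean_le (g : R -> R) (q m : R) : (1 <= q)%R -> (0 <= m)%R ->
  measurable_fun setT g -> (forall t, 0 <= g t)%R ->
  m%:E <= \int[lebR]_(t in I01) (g t)%:E ->
  (m `^ q)%:E <= \int[lebR]_(t in I01) (g t `^ q)%:E.
Proof.
move=> q1 m0 mg g0 mg1.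
have q0 : (0 < q)%R by exact: lt_le_trans q1.
have [->|mn0] := eqVneq m 0%R.
  by rewrite powR0 ?gt_eqF//; apply: integral_ge0 => t _; rewrite lee_fin powR_ge0.
have mp : (0 < m)%R by rewrite lt_neqAle eq_sym mn0.
(* The graph of s ^ q lies above its tangent at m. This is Young's inequality with exponents q and q
   / (q - 1), so q = 1 is treated apart. *)
have young (s : R) : (0 <= s)%R -> (q * m `^ (q - 1) * s <= s `^ q + (q - 1) * m `^ q)%R.
  move=> s0; move: q1; rewrite le_eqVlt => /predU1P[<-|q1].
    by rewrite subrr powRr0 mul0r addr0 !mul1r powRr1.
  have q10 : (0 < q - 1)%R by rewrite subr_gt0.
  have := @conjugate_powR R s (m `^ (q - 1))%R q (q / (q - 1))%R s0 (powR_ge0 _ _) q0.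
  move=> /(_ (divr_gt0 q0 q10)).
  have -> : (q^-1 + (q / (q - 1))^-1 = 1)%R by field; rewrite !gt_eqF.
  have e2 : ((q - 1) * (q / (q - 1)) = q)%R by field; rewrite gt_eqF.
  move=> /(_ erefl); rewrite -powRrM e2.
  move=> /(ler_wpM2l (ltW q0)) H.
  have e1 : (q * (s `^ q / q + m `^ q / (q / (q - 1))) = s `^ q + (q - 1) * m `^ q)%R.
    by field; rewrite !gt_eqF.
  by rewrite e1 in H; apply: le_trans H; rewrite -mulrA [(m `^ _ * s)%R]mulrC.
have mgq : measurable_fun setT (fun t => g t `^ q)%R.
  by apply: (measurableT_comp (measurable_powR q)).
have mq : (m `^ (q - 1) * m = m `^ q)%R.
  by rewrite -[X in (_ * X)%R]powRr1// -powRD ?subrK// mn0 implybT.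
have c0 : (0 <= q * m `^ (q - 1))%R by rewrite mulr_ge0 ?powR_ge0// ltW.
have c1 : (0 <= (q - 1) * m `^ q)%R by rewrite mulr_ge0 ?powR_ge0// subr_ge0.
have mI : measurable I01 by exact: measurable_itv.
have mgE : measurable_fun I01 (fun t => (g t)%:E).
  by apply: measurable_funTS; exact/measurable_EFinP.
have mgqE : measurable_fun I01 (fun t => (g t `^ q)%:E).
  by apply: measurable_funTS; exact/measurable_EFinP.
have : \int[lebR]_(t in I01) ((q * m `^ (q - 1))%:E * (g t)%:E) <=
    \int[lebR]_(t in I01) ((g t `^ q)%:E + ((q - 1) * m `^ q)%:E).
  apply: ge0_le_integral => //.
  - by move=> t _; rewrite mule_ge0// lee_fin.
  - exact: measurable_funeM.
  - by apply: emeasurable_funD.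
  - by move=> t _; rewrite -EFinM -EFinD lee_fin young.
rewrite ge0_integralZl//; last by move=> t _; rewrite lee_fin.
rewrite ge0_integralD//; last by move=> t _; rewrite lee_fin powR_ge0.
rewrite integral_cst// [X in _ + _ * X](_ : _ = 1) ?mule1; last exact: unit_interval_measure.
move=> H; have {H} : (q * m `^ (q - 1))%:E * m%:E <=
   \int[lebR]_(t in I01) (g t `^ q)%:E + ((q - 1) * m `^ q)%:E.
  by apply: le_trans H; apply: lee_wpmul2l.
rewrite -EFinM -mulrA mq -leeBlDr// -EFinB; apply: le_trans.
by rewrite lee_fin mulrBl mul1r opprB addrC subrK.
Qed.

End unit_interval.

Section line_average.
Context {R : realType} {N : nat}.
Local Notation leb := (lebesgue_rV N).
Local Notation lebR := (@lebesgue_measure R).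
Local Notation X := 'rV[R]_N.
Local Notation I01 := (`[0, 1]%classic : set R).
Implicit Types (x y z : X) (phi w : X -> R).

Lemma measurable_line (F : X -> R) (a : X) : measurable_fun setT F ->
  measurable_fun setT (fun p : X * measurableTypeR R => F (p.1 + p.2 *: a)).
Proof.
move=> mF; apply: (measurableT_comp mF); apply: measurable_fun_row => i.
rewrite (_ : (fun _ => _) = fun p : X * measurableTypeR R => p.1 ord0 i + p.2 * a ord0 i);
  last first.
  by apply/funext => p; rewrite !mxE.
apply: measurable_funD; first exact: (measurableT_comp (measurable_coord i) measurable_fst).
apply: measurable_funM => //; exact: measurable_snd.
Qed.

Lemma measurable_line1 (F : X -> R) x (a : X) : measurable_fun setT F ->
  measurable_fun setT (fun t : R => F (x + t *: a)).
Proof.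
by move=> mF; exact: (measurableT_comp (measurable_line a mF) (@pair1_measurable _ _ _
  (measurableTypeR R) x)).
Qed.

Definition line_mean (F : X -> R) (a : X) x : \bar R :=
  (\int[lebR]_(t in I01) (F (x + t *: a))%:E)%E.

(** By Tonelli the integral of the mean is the mean of the integrals of the translates of F, which
    are all equal. *)
Lemma line_mean_fubini (F : X -> R) (a : X) : measurable_fun setT F ->
  (forall x, 0 <= F x) ->
  measurable_fun setT (line_mean F a) /\
  (\int[leb]_x line_mean F a x = \int[leb]_x (F x)%:E)%E.
Proof.
move=> mF F0.
pose f (p : X * measurableTypeR R) : \bar R := (F (p.1 + p.2 *: a) * \1_I01 p.2)%:E.
have mf : measurable_fun setT f.
  apply/measurable_EFinP; apply: measurable_funM; first exact: measurable_line.
  have m1 : measurable_fun setT (\1_I01 : measurableTypeR R -> R) by exact: measurable_indic.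
  exact: (measurableT_comp m1 measurable_snd).
have f0 p : (0 <= f p)%E by rewrite lee_fin mulr_ge0// indicE.
have fE x t : f (x, t) = ((fun t => (F (x + t *: a))%:E) \_ I01) t.
  by rewrite patchE /f /= indicE; case: (t \in I01); rewrite ?mulr1 ?mulr0.
have lE x : line_mean F a x = (\int[lebR]_t f (x, t))%E.
  by rewrite /line_mean integral_mkcond; apply: eq_integral => t _; rewrite fE.
have -> : line_mean F a = fun x => (\int[lebR]_t f (x, t))%E by apply/funext.
split.
  exact: (@measurable_fun_fubini_tonelli_F _ _ _ _ _ lebR f).
rewrite (@fubini_tonelli _ _ _ _ _ leb lebR f mf f0).
under eq_integral => t _.
  rewrite (_ : (\int[leb]_x f (x, t) = (\1_I01 t)%:E * \int[leb]_x (F x)%:E)%E); last first.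
    rewrite /f /=.
    under eq_integral do rewrite mulrC EFinM.
    rewrite ge0_integralZl//; last 2 first.
    - apply/measurable_EFinP; exact: measurable_fun_shift.
    - by move=> x _; rewrite lee_fin.
    congr (_ * _)%E; apply: (ge0_integral_shift (t *: a) (F := EFin \o F)).
      exact/measurable_EFinP.
    by move=> x; rewrite lee_fin.
  over.
rewrite ge0_integralZr//; last 2 first.
- by apply/measurable_EFinP; exact: measurable_indic.
- by apply: integral_ge0 => x _; rewrite lee_fin.
rewrite [X in (X * _)%E](_ : _ = 1%E) ?mul1e//.
by rewrite integral_indic// setIT; exact: unit_interval_measure.
Qed.

Lemma smooth_increment_le phi (j : 'I_N) (h : R) x : Ck 2 phi ->
  ((`|phi (x + h *: basis j) - phi x|%R)%:E <=
   `|h|%:E * line_mean (fun y => `|partial j phi y|%R) (h *: basis j) x)%E.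
Proof.
move=> C2p; set a := h *: basis j.
have C1 : Ck 1 (partial j phi) by case: C2p => _ /(_ j)[].
have cp := Ck_continuous C1; have mp := measurable_continuous_row cp.
pose F (t : R) := phi (x + t *: a).
pose f (t : R) := partial j phi (x + t *: a) * h.
have dF (t : R) : is_derive t 1 F (f t).
  have -> : F = (fun s : R => phi (s *: basis j + x)) \o (fun t => h * t + 0).
    by apply/funext => s; rewrite /F /= addr0 addrC /a scalerA mulrC.
  apply: is_derive1_comp; last exact: is_derive_affine.
  rewrite addr0 -is_derive_line /a scalerA [t * h]mulrC [x + _]addrC.
  exact: (Ck_is_derive _ _ C2p).
have cf : continuous f.
  have cl : continuous (fun s : R => x + s *: a).
    by move=> t; exact: (continuousD (@cst_continuous _ _ x t) (@scalel_continuous _ _ a t)).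
  have cpl : continuous (fun s : R => partial j phi (x + s *: a)).
    by move=> t; apply: (@continuous_comp _ _ _ (fun s : R => x + s *: a) (partial j phi));
      [exact: cl|exact: cp].
  by move=> t; exact: (continuousM (cpl t) (@cst_continuous _ _ h t)).
have cF := is_derive_continuous dF.
have := @continuous_FTC2 R f F 0 1 ltr01 (continuous_subspaceT cf).
move=> /(_ _ _)/wrap[].
- split; first by move=> t _; have [] := dF t.
  + exact: cvg_at_right_filter (cF 0).
  + exact: cvg_at_left_filter (cF 1).
- by move=> t _; rewrite derive1E; have [] := dF t.
rewrite -EFinB /F scale1r scale0r addr0 => FTC.
rewrite (_ : (`|_|)%:E = `| (phi (x + a) - phi x)%:E |%E)// -FTC.
apply: (le_trans (le_abse_integral _ _ _)) => //.
  apply: measurable_funTS; apply/measurable_EFinP; apply: measurable_funM => //.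
  exact: measurable_line1.
rewrite /line_mean -ge0_integralZl//.
  rewrite le_eqVlt; apply/orP; left; apply/eqP; apply: eq_integral => t _.
  by rewrite /f /= normrM mulrC EFinM.
apply: measurable_funTS; apply/measurable_EFinP.
by apply: (@measurable_line1 (fun y => `|partial j phi y|)); exact: measurableT_comp.
Qed.

(** The inequality for smooth functions passes to the limit in integrated form: the positive part of
    the left side minus the right side has integral at most (2 + |h|) e for every e > 0, hence
    vanishes almost everywhere. *)
Lemma weak_increment_le w (v : 'I_N -> X -> R) (r : R) (j : 'I_N) (h : R) :
  leb.-integrable setT (EFin \o w) -> (forall i, leb.-integrable setT (EFin \o v i)) ->
  bounded_support r w -> (forall i, bounded_support r (v i)) ->
  (forall i, weak_deriv setT i w (v i)) ->
  {ae leb, forall x, ((`|w (x + h *: basis j) - w x|%R)%:E <=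
   `|h|%:E * line_mean (fun y => `|v j y|%R) (h *: basis j) x)%E}.
Proof.
move=> Iw Iv bw bv wd; set a := h *: basis j.
have mw := integrable_measurable Iw; have mv := integrable_measurable (Iv j).
have mnv : measurable_fun setT (fun y => `|v j y|) by exact: measurableT_comp.
pose P x := (`|w (x + a) - w x|%:E)%E.
pose Q x := (`|h|%:E * line_mean (fun y => `|v j y|%R) a x)%E.
have [mlv _] := line_mean_fubini a mnv (fun y => normr_ge0 _).
have mws := measurable_fun_shift a mw.
have mP : measurable_fun setT P.
  by apply: ge0_measurable_norm; exact: measurable_funB.
have mQ : measurable_fun setT Q by exact: measurable_funeM.
(* Q may be infinite; the difference is then -oo and D is 0. *)
pose D x := maxe (P x - Q x)%E 0%E.
have mD : measurable_fun setT D.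
  by apply: measurable_maxe => //; exact: emeasurable_funB.
have D0 x : (0 <= D x)%E by rewrite le_max lexx orbT.
have DE (e : R) : 0 < e -> (\int[leb]_x D x <= ((2 + `|h|) * e)%:E)%E.
  move=> e0.
  have [phi [sp _ wphi vphi]] := weak_deriv_approx Iw Iv bw bv wd e0.
  have mp := measurable_continuous_row (smooth_continuous sp).
  have mdp := measurable_continuous_row (smooth_continuous (smooth_partial j sp)).
  have mwp : measurable_fun setT (fun x => w x - phi x) by exact: measurable_funB.
  have mvp : measurable_fun setT (fun x => v j x - partial j phi x) by exact: measurable_funB.
  have mnvp : measurable_fun setT (fun x => `|v j x - partial j phi x|) by exact: measurableT_comp.
  have mndp : measurable_fun setT (fun x => `|partial j phi x|) by exact: measurableT_comp.
  have [ml iml] := line_mean_fubini a mnvp (fun y => normr_ge0 _).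
  pose S1 x := (`|w (x + a) - phi (x + a)|%:E)%E.
  pose S2 x := (`|w x - phi x|%:E)%E.
  pose S3 x := (`|h|%:E * line_mean (fun y => `|v j y - partial j phi y|%R) a x)%E.
  have mS1 : measurable_fun setT S1.
    by apply: ge0_measurable_norm; exact: (measurable_fun_shift a mwp).
  have mS2 : measurable_fun setT S2 by exact: ge0_measurable_norm.
  have mS3 : measurable_fun setT S3 by exact: measurable_funeM.
  have lm0 F x : (forall y, 0 <= F y) -> (0 <= line_mean F a x)%E.
    by move=> F0; apply: integral_ge0 => t _; rewrite lee_fin.
  have S30 x : (0 <= S3 x)%E by rewrite mule_ge0// lm0.
  have mline (F : X -> R) x : measurable_fun setT F ->
    measurable_fun I01 (fun t : R => (F (x + t *: a))%:E).
    by move=> mF; apply: measurable_funTS; apply/measurable_EFinP; exact: measurable_line1.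
  have dphi x : (`|phi (x + a) - phi x|%:E <= Q x + S3 x)%E.
    apply: (le_trans (smooth_increment_le j h x (sp 2%N))).
    rewrite -ge0_muleDr ?lm0//; apply: lee_wpmul2l => //.
    rewrite /line_mean -ge0_integralD//; try exact: (mline _ x mnv); try exact: (mline _ x mnvp).
    apply: ge0_le_integral => //.
    - exact: (mline _ x mndp).
    - by apply: emeasurable_funD; [exact: (mline _ x mnv)|exact: (mline _ x mnvp)].
    - move=> t _; rewrite -EFinD lee_fin distrC.
      by rewrite -[X in `|X| <= _](subrK (v j (x + t *: a))) addrC ler_normD.
  have PQS x : (P x <= Q x + (S1 x + S2 x + S3 x))%E.
    have -> : (Q x + (S1 x + S2 x + S3 x) = S1 x + S2 x + (Q x + S3 x))%E by rewrite addeCA.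
    apply: (@le_trans _ _ (S1 x + S2 x + (`|phi (x + a) - phi x|%:E))%E).
      rewrite -!EFinD lee_fin.
      have -> : w (x + a) - w x = (w (x + a) - phi (x + a)) - (w x - phi x) + (phi (x + a) - phi
        x) by ring.
      by rewrite (le_trans (ler_normD _ _))// lerD2r ler_normB.
    exact: leeD.
  apply: (@le_trans _ _ (\int[leb]_x (S1 x + S2 x + S3 x))%E).
    apply: ge0_le_integral => //.
    - by apply: emeasurable_funD => //; exact: emeasurable_funD.
    - move=> x _; rewrite /D ge_max; apply/andP; split; last first.
        by rewrite adde_ge0// adde_ge0// lee_fin.
      have := PQS x; have : (0 <= Q x)%E by rewrite mule_ge0// lm0.
      move: (Q x) (P x) (S1 x + S2 x + S3 x)%E => [q| |] P' S' //= _.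
        by rewrite EFinN leeBlDl.
      by move=> _; rewrite addeNy leNye.
  have S10 x : (0 <= S1 x)%E by rewrite lee_fin.
  have S20 x : (0 <= S2 x)%E by rewrite lee_fin.
  rewrite ge0_integralD//; try exact: emeasurable_funD; try by move=> x _; rewrite adde_ge0.
  rewrite ge0_integralD//.
  rewrite (ge0_integral_shift a (F := S2))//.
  have -> : ((2 + `|h|) * e)%:E = (e%:E + e%:E + `|h|%:E * e%:E)%E.
    by rewrite -EFinM -!EFinD; congr EFin; ring.
  rewrite ge0_integralZl//; last by move=> x _; exact: lm0.
  by rewrite iml; apply: leeD; [exact: leeD|exact: lee_wpmul2l].
have ID0 : (\int[leb]_x D x = 0)%E.
  apply/eqP; rewrite eq_le; apply/andP; split; last exact: integral_ge0.
  apply/lee_addgt0Pr => e e0; rewrite add0e.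
  have h2 : 0 < 2 + `|h| by rewrite ltr_pwDl.
  have := DE (e / (2 + `|h|)) (divr_gt0 e0 h2).
  by rewrite mulrC divfK// gt_eqF.
have : ae_eq leb setT D (cst 0%E).
  apply/ae_eq_integral_abs => //; rewrite -ID0; apply: eq_integral => x _.
  by rewrite gee0_abs.
apply: filterS => x /(_ I) Dx0.
have : (P x - Q x <= D x)%E by rewrite le_max lexx.
rewrite Dx0.
rewrite -/(P x) -/(Q x).
have : (0 <= Q x)%E by rewrite mule_ge0//; exact: integral_ge0.
case: (Q x) => [q| |]//= _; first by rewrite -EFinB !lee_fin subr_le0.
by rewrite leey.
Qed.

(** Jensen's inequality on almost every segment, then [line_mean_fubini]. Cutting |v j| ^ q off to B
    changes nothing for x in A, since the whole segment issuing from x lies in B. *)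
Lemma difference_quotient_le w (v : 'I_N -> X -> R) (r q : R) (j : 'I_N) (h : R) (A B : set X) :
  leb.-integrable setT (EFin \o w) -> (forall i, leb.-integrable setT (EFin \o v i)) ->
  bounded_support r w -> (forall i, bounded_support r (v i)) ->
  (forall i, weak_deriv setT i w (v i)) -> 1 <= q -> measurable A -> measurable B ->
  (forall x t, A x -> 0 <= t <= 1 -> B (x + t *: (h *: basis j))) ->
  (\int[leb]_(x in A) (`|w (x + h *: basis j) - w x| `^ q)%:E <=
   (`|h| `^ q)%:E * \int[leb]_(x in B) (`|v j x| `^ q)%:E)%E.
Proof.
move=> Iw Iv bw bv wd q1 mA mB AB; set a := h *: basis j.
have q0 : 0 < q by exact: lt_le_trans q1.
have mw := integrable_measurable Iw; have mv := integrable_measurable (Iv j).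
have [h0|h0] := eqVneq h 0.
  rewrite (eq_integral (fun=> 0%E)); last first.
    by move=> x _; rewrite /a h0 scale0r addr0 subrr normr0 powR0// gt_eqF.
  rewrite integral0; apply: mule_ge0; first by rewrite lee_fin powR_ge0.
  by apply: integral_ge0 => x _; rewrite lee_fin powR_ge0.
have hp : 0 < `|h| by rewrite normr_gt0.
pose Phi x := (`|v j x| `^ q) * \1_B x.
have mvq : measurable_fun setT (fun x => `|v j x| `^ q).
  by apply: (measurableT_comp (measurable_powR q)); exact: measurableT_comp.
have mPhi : measurable_fun setT Phi.
  by apply: measurable_funM => //; exact: measurable_indic.
have Phi0 x : 0 <= Phi x by rewrite mulr_ge0 ?powR_ge0// indicE.
have [ml iml] := line_mean_fubini a mPhi Phi0.
have lm0 x : (0 <= line_mean Phi a x)%E.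
  by apply: integral_ge0 => t _; rewrite lee_fin.
have mws : measurable_fun setT (fun x => `|w (x + a) - w x| `^ q).
  apply: (measurableT_comp (measurable_powR q)); apply: measurableT_comp => //.
  by apply: measurable_funB => //; exact: measurable_fun_shift.
apply: (@le_trans _ _ (\int[leb]_(x in A) ((`|h| `^ q)%:E * line_mean Phi a x))%E).
  apply: ae_ge0_le_integral => //.
  - by apply: measurable_funTS; exact/measurable_EFinP.
  - by move=> x _; rewrite mule_ge0// lee_fin powR_ge0.
  - by apply: measurable_funTS; exact: measurable_funeM.
  have := weak_increment_le j h Iw Iv bw bv wd.
  apply: filterS => x; rewrite -/a => H Ax.
  set m := `|w (x + a) - w x| in H *.
  have mh : ((m / `|h|)%:E <= \int[lebR]_(t in I01) (`|v j (x + t *: a)|)%:E)%E.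
    by rewrite EFinM muleC lee_pdivrMl.
  have mvx : measurable_fun setT (fun t : R => `|v j (x + t *: a)|).
    by apply: measurableT_comp => //; exact: measurable_line1.
  have m0 : 0 <= m by exact: normr_ge0.
  have mh0 : 0 <= m / `|h| by rewrite divr_ge0.
  have := powR_mean_le q1 mh0 mvx (fun t => normr_ge0 _) mh.
  have -> : (\int[lebR]_(t in I01) (`|v j (x + t *: a)| `^ q)%:E = line_mean Phi a x)%E.
    apply: eq_integral => t; rewrite inE /= in_itv/= => t01.
    by rewrite /Phi indicE mem_set ?mulr1//; exact: AB.
  have -> : m `^ q = `|h| `^ q * (m / `|h|) `^ q.
    by rewrite -powRM// mulrCA divff ?mulr1// gt_eqF.
  by move=> H'; rewrite EFinM; apply: lee_wpmul2l => //; rewrite lee_fin powR_ge0.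
rewrite ge0_integralZl//; last first.
- exact: measurable_funTS.
apply: lee_wpmul2l; first by rewrite lee_fin powR_ge0.
apply: (@le_trans _ _ (\int[leb]_x line_mean Phi a x)%E).
  by apply: ge0_subset_integral.
rewrite iml [leRHS]integral_mkcond le_eqVlt; apply/orP; left; apply/eqP.
apply: eq_integral => x _; rewrite patchE /Phi indicE.
by case: (x \in B); rewrite ?mulr1 ?mulr0.
Qed.

End line_average.

(** * One-dimensional estimates *)

Section monotone.
Context {R : realType}.

Lemma is_derive_nondecreasing (f df : R -> R) (a b : R) :
  (forall s : R, is_derive s 1 f (df s)) -> (forall s, a <= s <= b -> 0 <= df s) -> a <= b ->
  f a <= f b.
Proof.
move=> d d0 ab.
have cf : {within `[a, b], continuous f}.
  apply: continuous_subspaceT => s; apply: differentiable_continuous.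
  by apply/derivable1_diffP; have [] := d s.
have [c /[!in_itv]/= cab] := MVT_segment ab (fun s _ => d s) cf.
by rewrite -subr_ge0 => ->; rewrite mulr_ge0 ?subr_ge0// d0.
Qed.

End monotone.

Lemma normr_between {R : realDomainType} (a b s : R) :
  Num.min a b <= s <= Num.max a b -> `|s| <= Num.max `|a| `|b|.
Proof.
move=> /andP[s1 s2]; rewrite ler_norml; apply/andP; split.
  apply: le_trans s1; rewrite le_min; apply/andP; split; rewrite lerNl le_max.
    by rewrite -(normrN a) ler_norm.
  by rewrite -(normrN b) ler_norm orbT.
by apply: (le_trans s2); rewrite ge_max !le_max !ler_norm orbT.
Qed.

Lemma powR_ge1 {R : realType} (x q : R) : 1 <= x -> 0 <= q -> 1 <= x `^ q.
Proof.
move=> x1 q0; have H : 1 `^ q = 1 :> R by rewrite powR1.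
by rewrite -{1}H; apply: ge0_ler_powR; rewrite ?nnegrE// (le_trans ler01).
Qed.

Lemma powR_le1 {R : realType} (x q : R) : 0 <= x -> x <= 1 -> 0 <= q -> x `^ q <= 1.
Proof.
move=> x0 x1 q0; have H : 1 `^ q = 1 :> R by rewrite powR1.
by rewrite -H; apply: ge0_ler_powR; rewrite ?nnegrE.
Qed.

Section integrand.
Context {R : realType}.
Variables (g : R -> R) (C delta p : R).
Hypotheses (C2g : C2 g) (gg : growth C delta p g) (C1 : 1 <= C) (d0 : 0 <= delta) (p2 : 2 <= p).
Local Notation g' := (derive1 g).
Local Notation g'' := (derive1n 2 g).

Let C0 : 0 < C. Proof. exact: lt_le_trans C1. Qed.

Lemma integrand_derive1 (s : R) : is_derive s 1 g (g' s).
Proof. by case: C2g => d _ _; rewrite derive1E; exact/derivableP. Qed.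

Lemma integrand_derive2 (s : R) : is_derive s 1 g' (g'' s).
Proof. by case: C2g => _ d _; rewrite derive1nS derive1n1 derive1E; exact/derivableP. Qed.

Lemma integrand_derive2_ge0 (s : R) : 0 <= g'' s.
Proof.
have /andP[H _] := gg s; apply: le_trans H.
by rewrite mulr_ge0 ?powR_ge0// invr_ge0 ltW.
Qed.

Definition sqrt2 (s : R) := Num.sqrt (g'' s).

Lemma continuous_sqrt2 : continuous sqrt2.
Proof.
case: C2g => _ _ c s; apply: (@continuous_comp _ _ _ g'' Num.sqrt); first exact: c.
exact: sqrt_continuous.
Qed.

Lemma Vfun_is_derive (t : R) : is_derive t 1 (Vfun g) (sqrt2 t).
Proof.
(* A base point to the left of both t and 0: near t, both branches of [Vfun] are the integral from L
   minus the same constant. *)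
pose L := Num.min t 0 - 1.
have L0 : L < 0 by rewrite /L ltrBlDr add0r gt_min ltr01 orbT.
have Lt : L < t by rewrite /L ltrBlDr gt_min ltrDl ltr01.
have int a b : lebesgue_measure.-integrable `[a, b] (EFin \o sqrt2).
  apply: continuous_compact_integrable; first exact: segment_compact.
  exact: (continuous_subspaceT continuous_sqrt2).
have intS a b : lebesgue_measure.-integrable `]a, b] (EFin \o sqrt2).
  by apply: integrableS (int a b) => //; exact: subset_itv_oc_cc.
have VE (s : R) : L < s -> Vfun g s = \int[lebesgue_measure]_(x in `[L, s]) sqrt2 x -
    \int[lebesgue_measure]_(x in `[L, 0]) sqrt2 x.
  move=> Ls; rewrite /Vfun; case: ifPn => s0.
    rewrite (@Rintegral_itvB _ sqrt2 (BLeft L) (BRight s) 0)//.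
    - by rewrite Rintegral_itv_obnd_cbnd.
    - by rewrite bnd_simp ltW.
  rewrite -ltNge in s0.
  rewrite -opprB; congr (- _).
  rewrite (@Rintegral_itvB _ sqrt2 (BLeft L) (BRight 0) s)//.
  - by rewrite Rintegral_itv_obnd_cbnd.
  - by rewrite bnd_simp ltW.
  - by rewrite bnd_simp ltW.
have tt1 : t < t + 1 by rewrite ltrDl.
have [d e] := @continuous_FTC1_closed R sqrt2 L t (t + 1) tt1 (int L (t + 1)) Lt
  (@continuous_sqrt2 t).
pose F x := \int[lebesgue_measure]_(t in `[L, x]) sqrt2 t.
have dF : is_derive t 1 F (sqrt2 t).
  by apply: DeriveDef; [exact: d|rewrite -derive1E; exact: e].
have := is_deriveB dF (is_derive_cst (\int[lebesgue_measure]_(x in `[L, 0]) sqrt2 x : R) t (1 : R)).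
rewrite subr0; apply: near_eq_is_derive.
near=> s; rewrite VE//; near: s; exact: lt_nbhsr.
Unshelve. all: by end_near. Qed.

(* Cauchy-Schwarz in discriminant form: for every [l], the function
   [l ^+ 2 * s + g' s - 2 * l * Vfun g s] of [s] is nondecreasing. *)
Lemma integrand_incr_ge (a b : R) :
  (Vfun g b - Vfun g a) ^+ 2 <= (g' b - g' a) * (b - a).
Proof.
wlog ab : a b / a <= b => [H|].
  have [ab|/ltW ba] := leP a b; first exact: H.
  by have := H _ _ ba; rewrite -(opprB (Vfun g b)) sqrrN -(opprB (g' b)) -(opprB b) mulrNN.
have H (l : R) : 2 * l * (Vfun g b - Vfun g a) <= l ^+ 2 * (b - a) + (g' b - g' a).
  pose f s := l ^+ 2 * s + 0 + g' s - 2 * l * Vfun g s.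
  have df (s : R) : is_derive s 1 f ((l - sqrt2 s) ^+ 2).
    have d1 : is_derive s 1 (fun s => l ^+ 2 * s + 0) (l ^+ 2).
      apply: (@is_derive_quad _ _ _ _ _ _ 0) => h _.
      by rewrite mul0r (_ : _ - _ - _ = 0) ?normr0// /GRing.scale/=; ring.
    have d2 := integrand_derive2 s.
    have d3 := @is_deriveZ R R R (Vfun g) (2 * l) s 1 (sqrt2 s) (Vfun_is_derive s).
    have := is_deriveB (is_deriveD d1 d2) d3.
    move=> /is_derive_eq; move=> /(_ ((l - sqrt2 s) ^+ 2)) d.
    have -> : f = (fun s0 : R => l ^+ 2 * s0 + 0) + g' - 2 * l \*: Vfun g.
      by [].
    apply: d; rewrite sqrrB /sqrt2 sqr_sqrtr ?integrand_derive2_ge0// /GRing.scale/=; ring.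
  have := is_derive_nondecreasing df (fun s _ => sqr_ge0 _) ab.
  rewrite /f; lra.
have [->|ab0] := eqVneq a b; first by rewrite !subrr expr0n mulr0.
have ba : 0 < b - a by rewrite subr_gt0 lt_neqAle ab0.
have := H ((Vfun g b - Vfun g a) / (b - a)).
rewrite -(ler_pM2r ba) (mulrDl (_ ^+ 2 * _)).
set D := Vfun g b - _.
have -> : 2 * (D / (b - a)) * D * (b - a) = 2 * D ^+ 2 by field; rewrite gt_eqF.
have -> : (D / (b - a)) ^+ 2 * (b - a) * (b - a) = D ^+ 2 by field; rewrite gt_eqF.
lra.
Qed.

(** S V - g' has the derivative sqrt(g'') (S - sqrt(g'')), nonnegative between a and b; as V and g'
    are nondecreasing, this compares their increments. *)
Lemma integrand_incr_le (a b S : R) : 0 <= S ->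
  (forall s, Num.min a b <= s <= Num.max a b -> g'' s <= S ^+ 2) ->
  `|g' b - g' a| <= S * `|Vfun g b - Vfun g a|.
Proof.
move=> S0.
wlog ab : a b / a <= b => [H HS|HS].
  have [ab|/ltW ba] := leP a b; first exact: H.
  by rewrite distrC [X in _ * X]distrC; apply: H => // s; rewrite minC maxC; exact: HS.
rewrite (min_l ab) (max_r ab) in HS.
have q0 s : 0 <= sqrt2 s by exact: sqrtr_ge0.
have q2 s : sqrt2 s ^+ 2 = g'' s by rewrite sqr_sqrtr// integrand_derive2_ge0.
have qS s : a <= s <= b -> sqrt2 s <= S.
  move=> sab; have := HS s sab; rewrite -q2 => h; rewrite leNgt; apply/negP => h2.
  by have := q0 s; nra.
have gab : g' a <= g' b.
  by apply: (is_derive_nondecreasing integrand_derive2) => // s _; exact: integrand_derive2_ge0.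
have Vab : Vfun g a <= Vfun g b.
  exact: (is_derive_nondecreasing Vfun_is_derive).
rewrite !ger0_norm ?subr_ge0//.
have df (s : R) : is_derive s 1 (S \*: Vfun g - g') (S * sqrt2 s - g'' s).
  have d3 := @is_deriveZ R R R (Vfun g) S s 1 (sqrt2 s) (Vfun_is_derive s).
  exact: (is_deriveB d3 (integrand_derive2 s)).
have := is_derive_nondecreasing df _ ab.
rewrite /= !fctE /GRing.scale/= => H.
suff : S * Vfun g a - g' a <= S * Vfun g b - g' b by lra.
apply: H => s sab; rewrite (_ : g'^`()%classic s = sqrt2 s ^+ 2) ?q2//.
by rewrite -q2 expr2 -mulrBl mulr_ge0 ?subr_ge0//; exact: qS.
Qed.

Definition growth_bound (a b : R) := C * (`|a| `^ (p - 2) + `|b| `^ (p - 2) + 1).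

Lemma growth_bound_ge0 a b : 0 <= growth_bound a b.
Proof. by rewrite mulr_ge0 ?addr_ge0 ?powR_ge0// ltW. Qed.

Lemma integrand_derive2_le a b s : Num.min a b <= s <= Num.max a b -> g'' s <= growth_bound a b.
Proof.
move=> sab; have /andP[_ H] := gg s; apply: (le_trans H).
rewrite /growth_bound ler_pM2l// lerD2r.
have p20 : 0 <= p - 2 by rewrite subr_ge0.
have := normr_between sab.
rewrite le_max => /orP[sa|sb].
  by rewrite (le_trans (ge0_ler_powR p20 _ _ sa)) ?nnegrE// lerDl powR_ge0.
by rewrite (le_trans (ge0_ler_powR p20 _ _ sb)) ?nnegrE// lerDr powR_ge0.
Qed.

(** Pointwise form of the Caccioppoli inequality: [b - a] is the increment of u_{x_i}, [d] that of
    u, [z] the cutoff and [y] its partial derivative, so that the last factor is the i-th derivative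
    of z ^ 2 times the increment of u. The term with b - a dominates z ^ 2 (delta V) ^ 2, half of
    which absorbs the cross term through |delta g'| <= S |delta V|. *)
Lemma integrand_caccioppoli (a b z y d : R) :
  z ^+ 2 * (Vfun g b - Vfun g a) ^+ 2 / 2 - 2 * y ^+ 2 * d ^+ 2 * growth_bound a b <=
  (g' b - g' a) * (z ^+ 2 * (b - a) + 2 * z * y * d).
Proof.
have H1 := integrand_incr_ge a b.
pose S := Num.sqrt (growth_bound a b).
have S0 : 0 <= S by exact: sqrtr_ge0.
have S2 : S ^+ 2 = growth_bound a b by rewrite sqr_sqrtr// growth_bound_ge0.
have H2 : `|g' b - g' a| <= S * `|Vfun g b - Vfun g a|.
  by apply: integrand_incr_le => // s sab; rewrite S2; exact: integrand_derive2_le.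
rewrite -S2; set D := g' b - g' a in H1 H2 *; set W := Vfun g b - Vfun g a in H1 H2 *.
have H3 : z ^+ 2 * W ^+ 2 <= z ^+ 2 * (D * (b - a)) by rewrite ler_wpM2l// sqr_ge0.
have H4 : - (`|D| * `|2 * z * y * d|) <= D * (2 * z * y * d).
  by rewrite -normrM lerNl -normrN ler_norm.
have H5 : `|D| * `|2 * z * y * d| <= S * `|W| * `|2 * z * y * d| by rewrite ler_wpM2r.
have H6 : S * `|W| * `|2 * z * y * d| = 2 * ((`|z| * `|W|) * (`|y| * `|d| * S)).
  by rewrite !normrM (ger0_norm (ler0n _ 2)); ring.
(* Young's inequality 2 A B <= A ^ 2 / 2 + 2 B ^ 2, for A = |z| |W| and B = |y| |d| S. *)
have H7 : 0 <= (`|z| * `|W| - 2 * (`|y| * `|d| * S)) ^+ 2 by exact: sqr_ge0.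
have e1 : z ^+ 2 = `|z| ^+ 2 by rewrite real_normK ?num_real.
have e2 : W ^+ 2 = `|W| ^+ 2 by rewrite real_normK ?num_real.
have e3 : y ^+ 2 = `|y| ^+ 2 by rewrite real_normK ?num_real.
have e4 : d ^+ 2 = `|d| ^+ 2 by rewrite real_normK ?num_real.
rewrite mulrDr; set T := D * (2 * _ * _ * _) in H4 *.
have -> : D * (z ^+ 2 * (b - a)) = z ^+ 2 * (D * (b - a)) by ring.
rewrite H6 in H5; set A := `|z| * `|W| in H5 H7; set B := `|y| * `|d| * S in H5 H7.
have -> : z ^+ 2 * W ^+ 2 / 2 = A ^+ 2 / 2 by rewrite e1 e2 /A; ring.
have -> : 2 * y ^+ 2 * d ^+ 2 * S ^+ 2 = 2 * B ^+ 2 by rewrite e3 e4 /B; ring.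
have e5 : z ^+ 2 * W ^+ 2 = A ^+ 2 by rewrite e1 e2 /A; ring.
rewrite e5 in H3; move: (`|D| * _) (z ^+ 2 * (D * _)) H3 H4 H5 => u v H3 H4 H5.
have e6 : (A - 2 * B) ^+ 2 = A ^+ 2 - 4 * (A * B) + 4 * B ^+ 2 by ring.
rewrite e6 in H7; lra.
Qed.

Lemma Vfun0 : Vfun g 0 = 0.
Proof. by rewrite /Vfun lexx set_itv1 Rintegral_set1. Qed.

(** For |t| >= 4 delta, every s between t / 2 and t has |s| - delta >= |t| / 4, hence g''(s) >= C^-1
    (|t| / 4) ^ (p - 2), and the increment of V between t / 2 and t already yields c |t| ^ p <= V(t)
    ^ 2. Smaller t go into the constant. *)
Lemma Vfun_coercive (chi : R) : 0 < chi ->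
  exists2 K, 0 <= K & forall t, `|t| `^ (p * chi) <= K * (`|Vfun g t| `^ (2 * chi) + 1).
Proof.
move=> chi0.
have p20 : 0 <= p - 2 by rewrite subr_ge0.
have p0 : 0 < p by exact: lt_le_trans p2.
have pc0 : 0 <= p * chi by rewrite mulr_ge0// ltW.
(* The power of 1 / 4 comes from |t| / 4 and the last factor from (t / 2) ^ 2. *)
pose c := C^-1 * (4^-1 `^ (p - 2)) / 4.
have cp : 0 < c by rewrite !mulr_gt0 ?invr_gt0// powR_gt0.
have key t : 4 * delta <= `|t| -> c * `|t| `^ p <= Vfun g t ^+ 2.
  move=> dt.
  have [->|t0] := eqVneq t 0.
    by rewrite normr0 powR0 ?gt_eqF// mulr0 sqr_ge0.
  have tp : 0 < `|t| by rewrite normr_gt0.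
  have q0 s : 0 <= sqrt2 s by exact: sqrtr_ge0.
  have mV (a b : R) : a <= b -> Vfun g a <= Vfun g b.
    by apply: (is_derive_nondecreasing Vfun_is_derive) => s _; exact: q0.
  have [s st Vt] := mean_value Vfun_is_derive t (t / 2).
  have ht : `|t / 2 - t| = `|t| / 2.
    by rewrite (_ : t / 2 - t = - (t / 2)) ?normrN ?normrM ?normfV ?(ger0_norm (ler0n _ 2))//;
      field.
  rewrite ht in st.
  have s2 : `|t| / 2 <= `|s|.
    have := ler_normD s (t - s); rewrite addrC subrK distrC; lra.
  have : (Vfun g (t / 2) - Vfun g t) ^+ 2 <= Vfun g t ^+ 2.
    have [tneg|tpos] := ltP t 0.
      have h1 : Vfun g t <= Vfun g (t / 2) by apply: mV; lra.
      have h2 : Vfun g (t / 2) <= 0 by rewrite -Vfun0; apply: mV; lra.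
      nra.
    have h1 : Vfun g (t / 2) <= Vfun g t by apply: mV; lra.
    have h2 : 0 <= Vfun g (t / 2) by rewrite -Vfun0; apply: mV; lra.
    nra.
  apply: le_trans; rewrite Vt exprMn -(real_normK (num_real (t / 2 - t))) ht.
  rewrite /sqrt2 sqr_sqrtr ?integrand_derive2_ge0//.
  have /andP[H _] := gg s.
  have H' : C^-1 * (`|t| / 4) `^ (p - 2) <= g'' s.
    apply: le_trans H; rewrite ler_pM2l ?invr_gt0//; apply: ge0_ler_powR => //.
    - by rewrite nnegrE divr_ge0.
    - by rewrite nnegrE le_max lexx orbT.
    - by rewrite le_max; apply/orP; left; lra.
  have t20 : 0 <= (`|t| / 2) ^+ 2 by exact: sqr_ge0.
  apply: le_trans (ler_wpM2r t20 H'); rewrite powRM ?invr_ge0//.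
  have -> : `|t| `^ p = `|t| `^ (p - 2) * `|t| ^+ 2.
    by rewrite -powR_mulrn// -powRD ?subrK// (gt_eqF tp) implybT.
  by rewrite le_eqVlt; apply/orP; left; apply/eqP; rewrite /c; move: C^-1 => iC; field.
have cK : 0 <= c^-1 `^ chi by exact: powR_ge0.
have dK : 0 <= (4 * delta) `^ (p * chi) by exact: powR_ge0.
exists ((4 * delta) `^ (p * chi) + c^-1 `^ chi) => [|t]; first by rewrite addr_ge0.
have V0 : 0 <= `|Vfun g t| `^ (2 * chi) by exact: powR_ge0.
have [td|td] := leP (4 * delta) `|t|; last first.
  have h : `|t| `^ (p * chi) <= (4 * delta) `^ (p * chi).
    by apply: ge0_ler_powR; rewrite ?nnegrE ?(ltW td)// mulr_ge0.
  nra.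
have := key _ td; rewrite mulrC -ler_pdivlMr// => h.
have {}h : `|t| `^ (p * chi) <= `|Vfun g t| `^ (2 * chi) * c^-1 `^ chi.
  rewrite !powRrM -powRM ?powR_ge0 ?invr_ge0 ?(ltW cp)//.
  apply: ge0_ler_powR; rewrite ?nnegrE ?mulr_ge0 ?powR_ge0 ?invr_ge0 ?(ltW cp) ?(ltW chi0)//.
  by rewrite powR_mulrn// real_normK ?num_real.
nra.
Qed.

Definition growth_sum (a b : R) := `|a| `^ p + `|b| `^ p + 1.

(** The largest of |a|, |b| and 1 is at least a third of their sum. *)
Lemma growth_sum_ge (a b : R) : (`|a| + `|b| + 1) `^ p <= 3 `^ p * growth_sum a b.
Proof.
have p0 : 0 <= p by exact: le_trans p2.
have H (m : R) : 0 <= m -> `|a| <= m -> `|b| <= m -> 1 <= m ->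
    (`|a| + `|b| + 1) `^ p <= 3 `^ p * m `^ p.
  move=> m0 am bm m1; rewrite -powRM//; apply: ge0_ler_powR => //.
  - by rewrite nnegrE !addr_ge0.
  - by rewrite nnegrE mulr_ge0.
  - lra.
have pa := powR_ge0 `|a| p; have pb := powR_ge0 `|b| p.
have P3 := powR_ge0 3 p.
have : [\/ (`|a| <= 1) && (`|b| <= 1), (1 <= `|a|) && (`|b| <= `|a|) | (1 <= `|b|) && (`|a| <=
  `|b|)].
  have [a1|a1] := leP `|a| 1; have [b1|b1] := leP `|b| 1.
  - by constructor 1.
  - by constructor 3; rewrite ltW//=; lra.
  - by constructor 2; rewrite ltW//=; lra.
  - by have [ab|ab] := leP `|a| `|b|; [constructor 3|constructor 2]; rewrite ltW//= ltW.
case=> /andP[h1 h2].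
- by apply: (le_trans (H 1 ler01 h1 h2 (lexx _))); rewrite powR1 ler_wpM2l// /growth_sum; lra.
- by apply: (le_trans (H _ (normr_ge0 _) (lexx _) h2 h1)); rewrite ler_wpM2l// /growth_sum; lra.
- by apply: (le_trans (H _ (normr_ge0 _) h2 (lexx _) h1)); rewrite ler_wpM2l// /growth_sum; lra.
Qed.

Lemma integrand_derive1_incr (a b s : R) : `|s - a| <= `|b| ->
  `|g' s - g' a| <= `|s - a| * (2 * C * (`|a| + `|b| + 1) `^ (p - 2)).
Proof.
move=> sb; have p20 : 0 <= p - 2 by rewrite subr_ge0.
have [c ca ->] := mean_value integrand_derive2 a s.
rewrite normrM mulrC ler_wpM2l// ger0_norm ?integrand_derive2_ge0//.
have /andP[_ H] := gg c; apply: (le_trans H).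
have a0 := normr_ge0 a; have b0 := normr_ge0 b.
have cm : `|c| <= `|a| + `|b| + 1.
  by have := ler_normD a (c - a); rewrite addrC subrK; lra.
have h1 : `|c| `^ (p - 2) <= (`|a| + `|b| + 1) `^ (p - 2).
  by apply: ge0_ler_powR => //; rewrite nnegrE//; lra.
have h2 : 1 <= (`|a| + `|b| + 1) `^ (p - 2).
  by apply: powR_ge1 => //; lra.
rewrite [2 * C]mulrC -mulrA ler_pM2l//; lra.
Qed.

(** One majorant, integrable when a and b are in L^p, serves three purposes: finite energy, an
    integrable first variation, and a Taylor bound with a remainder quadratic in t. The last one
    replaces differentiation under the integral sign in the Euler-Lagrange equation. *)
Lemma integrand_growth : exists2 K, 0 <= K & forall a b,
  [/\ g a <= K * growth_sum a b, `|g' a * b| <= K * growth_sum a b &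
      forall t, `|t| <= 1 ->
        g (a + t * b) <= g a + t * (g' a * b) + t ^+ 2 * (K * growth_sum a b)].
Proof.
pose K := `|g 0| + `|g' 0| + 2 * C.
have K0 : 0 <= K by rewrite !addr_ge0// mulr_ge0// ltW.
have C20 : 0 <= 2 * C by rewrite mulr_ge0// ltW.
have T3 a b t : `|t| <= 1 ->
    g (a + t * b) <= g a + t * (g' a * b) + t ^+ 2 * (2 * C * (`|a| + `|b| + 1) `^ p).
  move=> t1; set m := `|a| + `|b| + 1.
  have m1 : 0 < m by rewrite ltr_wpDl// addr_ge0.
  have [c ca gc] := mean_value integrand_derive1 a (a + t * b).
  rewrite (addrC a) addrK in ca gc.
  have cb : `|c - a| <= `|b|.
    by apply: (le_trans ca); rewrite normrM ler_piMl.
  have H := integrand_derive1_incr cb; rewrite -/m in H.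
  have -> : g (a + t * b) = g a + t * (g' a * b) + (g' c - g' a) * (t * b).
    by rewrite addrC in gc; have := gc; lra.
  rewrite lerD2l; apply: (le_trans (ler_norm _)); rewrite normrM.
  apply: (le_trans (ler_wpM2r (normr_ge0 _) H)).
  have -> : m `^ p = m `^ (p - 2) * m ^+ 2.
    by rewrite -powR_mulrn ?(ltW m1)// -powRD ?subrK// (gt_eqF m1) implybT.
  have mp := powR_ge0 m (p - 2).
  have h1 : `|c - a| * `|t * b| <= t ^+ 2 * m ^+ 2.
    apply: (le_trans (ler_wpM2r (normr_ge0 _) ca)).
    rewrite normrM -(real_normK (num_real t)) mulrACA -!expr2.
    rewrite ler_wpM2l ?sqr_ge0// ler_sqr ?nnegrE ?(ltW m1)// /m.
    by have := normr_ge0 a; lra.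
  have := ler_wpM2l (mulr_ge0 C20 mp) h1.
  by congr (_ <= _); ring.
have mp_ge1 (a b : R) : 1 <= (`|a| + `|b| + 1) `^ p.
  have p0 : 0 <= p by exact: le_trans p2.
  have a0 := normr_ge0 a; have b0 := normr_ge0 b.
  by apply: powR_ge1 => //; lra.
have mp_ge (a b : R) : `|a| + `|b| + 1 <= (`|a| + `|b| + 1) `^ p.
  have a0 := normr_ge0 a; have b0 := normr_ge0 b.
  set m := `|a| + _ + _; have m1 : 1 <= m by rewrite /m; lra.
  by rewrite -[leLHS]powRr1 ?(le_trans ler01)//; apply: ler_powR => //; apply: le_trans p2;
    rewrite ler1n.
have T2 a b : `|g' a * b| <= K * (`|a| + `|b| + 1) `^ p.
  set m := `|a| + `|b| + 1.
  have m1 : 0 < m by rewrite ltr_wpDl// addr_ge0.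
  have := @integrand_derive1_incr 0 a a; rewrite subr0 normr0 add0r => /(_ (lexx _)) H.
  have p20 : 0 <= p - 2 by rewrite subr_ge0.
  have a0 := normr_ge0 a; have b0 := normr_ge0 b.
  have h1 : (`|a| + 1) `^ (p - 2) <= m `^ (p - 2).
    by apply: ge0_ler_powR => //; rewrite ?nnegrE /m; lra.
  have h2 : `|g' a| <= `|g' 0| + m * (2 * C * m `^ (p - 2)).
    have := ler_normD (g' 0) (g' a - g' 0); rewrite addrC subrK => h.
    have h3 : `|a| * (2 * C * (`|a| + 1) `^ (p - 2)) <= m * (2 * C * m `^ (p - 2)).
      apply: ler_pM => //; first by rewrite mulr_ge0 ?powR_ge0.
        by rewrite /m; lra.
      by rewrite ler_wpM2l.
    lra.
  rewrite normrM; apply: (@le_trans _ _ ((`|g' 0| + m * (2 * C * m `^ (p - 2))) * m)).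
    by apply: ler_pM => //; rewrite /m; lra.
  have mpE : m `^ p = m `^ (p - 2) * m ^+ 2.
    by rewrite -powR_mulrn ?(ltW m1)// -powRD ?subrK// (gt_eqF m1) implybT.
  have h4 : `|g' 0| * m <= `|g' 0| * m `^ p by rewrite ler_wpM2l// mp_ge.
  have h5 : 0 <= `|g 0| * m `^ p by rewrite mulr_ge0// powR_ge0.
  have -> : (`|g' 0| + m * (2 * C * m `^ (p - 2))) * m = `|g' 0| * m + 2 * C * m `^ p.
    by rewrite mpE; ring.
  rewrite /K; lra.
have P3 : 0 <= 3 `^ p by exact: powR_ge0.
exists (K * 3 `^ p) => [|a b]; first by rewrite mulr_ge0.
have S := growth_sum_ge a b; have mp1 := mp_ge1 a b.
have KS (x : R) : 0 <= x -> x <= K -> x * (`|a| + `|b| + 1) `^ p <= K * 3 `^ p * growth_sum a b.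
  move=> x0 xK; rewrite -mulrA; apply: ler_pM => //; exact: powR_ge0.
split.
- have := T3 0 a 1; rewrite normr1 normr0 !add0r !mul1r expr1n mul1r => /(_ (lexx _)) H.
  have p0 : 0 <= p by exact: le_trans p2.
  have h1 : (`|a| + 1) `^ p <= (`|a| + `|b| + 1) `^ p.
    have b0 := normr_ge0 b; have a0 := normr_ge0 a.
    by apply: ge0_ler_powR; rewrite ?nnegrE ?addr_ge0//; lra.
  have h2 : g 0 <= `|g 0| * (`|a| + `|b| + 1) `^ p.
    apply: (le_trans (ler_norm _)); exact: ler_peMr.
  have h3 : g' 0 * a <= `|g' 0| * (`|a| + `|b| + 1) `^ p.
    apply: (le_trans (ler_norm _)); rewrite normrM ler_wpM2l//.
    apply: le_trans (mp_ge a b); have := normr_ge0 b; lra.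
  have h4 : 2 * C * (`|a| + 1) `^ p <= 2 * C * (`|a| + `|b| + 1) `^ p by rewrite ler_wpM2l.
  apply: le_trans (KS K K0 (lexx _)); rewrite /K; lra.
- exact: le_trans (T2 a b) (KS K K0 (lexx _)).
- move=> t t1; apply: (le_trans (T3 a b t t1)); rewrite lerD2l ler_wpM2l ?sqr_ge0//.
  by apply: KS => //; rewrite /K lerDr addr_ge0.
Qed.

End integrand.

(* Put [D = d / h `^ r], where [r] is the exponent below. The exponent [k] balances
   [a `^ (p - 2) * D ^+ 2] and [a `^ (p * chi)] at [D = a `^ k], so that the former is
   at most [a `^ (p * chi) + D `^ Q] for [Q = p * chi / k]; the choice of [r] gives
   [r * Q <= s * chi], and [d <= M] absorbs the excess of [Q] over [s * chi]. *)
Lemma powR_interpolation {R : realType} (p s P chi M : R) :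
  2 <= p -> p <= P -> 2 <= s -> 1 < chi -> 1 <= M ->
  exists2 K, 0 <= K & forall a d h, 0 <= a -> 0 <= d -> d <= M -> 0 < h -> h <= 1 ->
    a `^ (p - 2) * d ^+ 2 <=
    K * h `^ (2 * Num.min (s / P + s / 2 * (chi - 1)) 1) *
      (a `^ (p * chi) + (d / h) `^ (s * chi) + 1).
Proof.
move=> p2 pP s2 chi1 M1; set r := Num.min _ 1.
have r1 : r <= 1 by rewrite /r ge_min lexx orbT.
pose k := (p * (chi - 1) + 2) / 2.
have p0 : 0 < p by lra.
have P0 : 0 < P by lra.
have s0 : 0 < s by lra.
have x0 : 0 < chi by lra.
have pc0 : 0 < p * (chi - 1) by rewrite mulr_gt0// subr_gt0.
have k0 : 0 < k by rewrite /k; lra.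
pose Q := p * chi / k.
have Q0 : 0 < Q by rewrite divr_gt0// mulr_gt0.
have sc0 : 0 < s * chi by rewrite mulr_gt0.
(* After clearing denominators this is r <= s / p + s (chi - 1) / 2, which follows from p <= P. *)
have rk : r * (p * chi) <= s * chi * k.
  have : r <= s / p + s / 2 * (chi - 1).
    rewrite /r ge_min; apply/orP; left; rewrite lerD2r ler_wpM2l ?(ltW s0)//.
    by rewrite lef_pV2 ?posrE.
  move=> /(ler_wpM2r (ltW (mulr_gt0 p0 x0))); congr (_ <= _).
  by rewrite /k; field; rewrite gt_eqF.
have rQ : r * Q <= s * chi by rewrite /Q mulrA ler_pdivrMr.
have r0 : 0 < r.
  have r1' : 0 < s / P by rewrite divr_gt0.
  have r2' : 0 < s / 2 * (chi - 1) by rewrite mulr_gt0 ?divr_gt0 ?subr_gt0.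
  by rewrite /r lt_min ltr01 andbT addr_gt0.
have M0 : 0 < M by lra.
exists (1 + M `^ Q) => [|a d h a0 d0 dM h0 h1]; first by rewrite addr_ge0 ?powR_ge0.
have MQ0 := powR_ge0 M Q.
have MQ1 : 1 <= M `^ Q by apply: powR_ge1 => //; exact: ltW.
have pa0 := powR_ge0 a (p * chi); have pd0 := powR_ge0 (d / h) (s * chi).
have hr0 : 0 < h `^ (2 * r) by rewrite powR_gt0.
have [->|dn0] := eqVneq d 0.
  by rewrite expr0n mulr0 !mulr_ge0 ?addr_ge0 ?powR_ge0.
have dp : 0 < d by rewrite lt_neqAle eq_sym dn0.
pose D := d / h `^ r.
have hrp : 0 < h `^ r by rewrite powR_gt0.
have Dp : 0 < D by rewrite divr_gt0.
have dE : d ^+ 2 = h `^ (2 * r) * D ^+ 2.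
  rewrite [2 * r]mulrC powRrM (powR_mulrn 2 (ltW hrp)) /D.
  by field; rewrite gt_eqF.
rewrite dE mulrCA [X in _ <= X * _]mulrC -[leRHS]mulrA ler_pM2l//.
(* If Q <= s chi then D <= d / h, as r <= 1 and h <= 1, and raising the exponent to s chi costs at
   most 1. Otherwise d ^ (Q - s chi) <= M ^ Q, and h ^ (s chi) <= h ^ (r Q) by [rQ]. *)
have DQ : D `^ Q <= M `^ Q * (d / h) `^ (s * chi) + 1.
  have [Qs|Qs] := leP Q (s * chi).
    have Dd : D <= d / h.
      rewrite /D ler_wpM2l ?(ltW dp)// lef_pV2 ?posrE//.
      rewrite -[leLHS]powRr1 ?(ltW h0)//; apply: ger_powR => //; exact/andP.
    have h2 : D `^ Q <= (d / h) `^ Q.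
      by apply: ge0_ler_powR; rewrite ?nnegrE ?(ltW Q0) ?(ltW Dp) ?divr_ge0 ?(ltW h0).
    have dh0 : 0 < d / h by rewrite divr_gt0.
    have h3 : (d / h) `^ Q <= (d / h) `^ (s * chi) + 1.
      have [dh|dh] := leP 1 (d / h).
        by apply: (@le_trans _ _ ((d / h) `^ (s * chi))); [exact: ler_powR|rewrite lerDl].
      apply: (@le_trans _ _ 1); last by rewrite lerDr.
      by rewrite powR_le1 ?(ltW Q0) ?(ltW dh0) ?(ltW dh).
    have h4 : (d / h) `^ (s * chi) <= M `^ Q * (d / h) `^ (s * chi) by exact: ler_peMl.
    lra.
  have dQ : d `^ Q = d `^ (Q - s * chi) * d `^ (s * chi).
    by rewrite -powRD ?subrK// dn0 implybT.
  have h2 : d `^ (Q - s * chi) <= M `^ Q.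
    have : d `^ (Q - s * chi) <= M `^ (Q - s * chi).
      by apply: ge0_ler_powR; rewrite ?nnegrE ?subr_ge0 ?(ltW Qs) ?(ltW M0).
    move=> /le_trans; apply; apply: ler_powR => //; lra.
  have h3 : h `^ (s * chi) <= (h `^ r) `^ Q.
    by rewrite -powRrM; apply: ger_powR => //; exact/andP.
  have hs0 : 0 < h `^ (s * chi) by rewrite powR_gt0.
  have e1 (x y z : R) : 0 < y -> 0 <= x -> (x / y) `^ z = x `^ z / y `^ z.
    by move=> y0 x00; rewrite powRM ?invr_ge0 ?(ltW y0)// -powR_inv1 ?(ltW y0)//
      -powRrM mulN1r powRN.
  rewrite /D !e1// dQ; apply: (@le_trans _ _ (M `^ Q * (d `^ (s * chi) / h `^ (s * chi))));
    last by rewrite lerDl.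
  rewrite -mulrA; apply: ler_pM => //; first exact: powR_ge0.
    by rewrite divr_ge0 ?powR_ge0.
  by rewrite ler_wpM2l ?powR_ge0// lef_pV2 ?posrE// powR_gt0.
have key : a `^ (p - 2) * D ^+ 2 <= a `^ (p * chi) + D `^ Q.
  have kk : k * (2 / k) = 2 by rewrite mulrCA mulfV ?mulr1// gt_eqF.
  have p20 : 0 <= p - 2 by lra.
  have [aD|aD] := leP D (a `^ k).
    have ap : 0 < a.
      rewrite lt_neqAle a0 andbT eq_sym; apply/eqP => a00.
      by move: aD; rewrite a00 powR0 ?gt_eqF// leNgt Dp.
    have h1' : D ^+ 2 <= a `^ (k * 2).
      by rewrite powRrM powR_mulrn ?powR_ge0// ler_sqr ?nnegrE ?powR_ge0 ?(ltW Dp).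
    have : a `^ (p - 2) * D ^+ 2 <= a `^ (p * chi).
      have -> : p * chi = (p - 2) + k * 2 by rewrite /k; field.
      have an0 : (p - 2 + k * 2 == 0) ==> (a != 0) by rewrite (gt_eqF ap) implybT.
      by rewrite (powRD an0); apply: ler_wpM2l h1'; exact: powR_ge0.
    by have := powR_ge0 D Q; lra.
  have h1' : a <= D `^ k^-1.
    have : (a `^ k) `^ k^-1 <= D `^ k^-1.
      by apply: ge0_ler_powR; rewrite ?nnegrE ?powR_ge0 ?invr_ge0 ?(ltW k0) ?(ltW Dp) ?(ltW aD).
    by rewrite -powRrM mulfV ?powRr1// gt_eqF.
  have h2' : a `^ (p - 2) <= (D `^ k^-1) `^ (p - 2).
    by apply: ge0_ler_powR; rewrite ?nnegrE ?powR_ge0.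
  have : a `^ (p - 2) * D ^+ 2 <= D `^ Q.
    have -> : Q = k^-1 * (p - 2) + 2 by rewrite /Q /k; field; rewrite gt_eqF//; lra.
    have Dn0 : (k^-1 * (p - 2) + 2 == 0) ==> (D != 0) by rewrite (gt_eqF Dp) implybT.
    rewrite (powRD Dn0) powRrM (powR_mulrn 2 (ltW Dp)).
    by apply: ler_wpM2r h2'; exact: sqr_ge0.
  lra.
have : a `^ (p * chi) <= (1 + M `^ Q) * a `^ (p * chi) by rewrite ler_peMl// lerDl.
set A := a `^ _ in key *; set B := (d / h) `^ _ in DQ pd0 *.
nra.
Qed.

(** * Neighbourhoods, Lebesgue and Sobolev spaces *)

Section thickening.
Context {R : realType} {N : nat}.
Local Notation X := 'rV[R]_N.
Implicit Types (x y z : X) (A E K Omega : set X) (s t d r : R).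

Definition thickening A s : set X := [set y | exists2 x, A x & `|y - x| < s].

Lemma open_thickening A s : open (thickening A s).
Proof.
have -> : thickening A s = \bigcup_(x in A) ball x s.
  apply/seteqP; split=> [y [x Ax yx]|y [x Ax]].
    by exists x => //; rewrite -ball_normE /= distrC.
  by rewrite -ball_normE /= distrC => yx; exists x.
by apply: bigcup_open => x _; exact: ball_open.
Qed.

Lemma measurable_thickening A s : measurable (thickening A s).
Proof. apply: open_measurable_row; exact: open_thickening. Qed.

Lemma subset_thickening A s : 0 < s -> A `<=` thickening A s.
Proof. by move=> s0 x Ax; exists x => //; rewrite subrr normr0. Qed.

Lemma thickening_le A s t : s <= t -> thickening A s `<=` thickening A t.
Proof. by move=> st y [x Ax yx]; exists x => //; exact: lt_le_trans st. Qed.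

Lemma thickening_shift A s t y v : thickening A s y -> `|v| <= t -> thickening A (s + t) (y + v).
Proof.
move=> [x Ax yx] vt; exists x => //; rewrite addrAC.
by rewrite (le_lt_trans (ler_normD _ _))// ltr_leD.
Qed.

Lemma closure_thickening A s d : 0 < d -> closure (thickening A s) `<=` thickening A (s + d).
Proof.
move=> d0 y yA; have [z [zA]] := yA _ (nbhsx_ballx y d d0).
rewrite -ball_normE /= => yz.
have -> : y = z + (y - z) by rewrite addrC subrK.
exact: thickening_shift zA (ltW yz).
Qed.

Lemma closed_bounded_compact K r : closed K -> (forall x, K x -> `|x| <= r) -> compact K.
Proof. by move=> cK Kr; apply: (subclosed_compact cK (@compact_norm_le R N r)). Qed.

(** The factor 10 is room for what follows: cutoff functions, supports and translates by at most d
    all stay in this neighbourhood. *)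
Lemma compactly_inside_thickening E Omega : open Omega -> compactly_inside E Omega ->
  exists d r, [/\ 0 < d, compactly_inside (thickening E (10 * d)) Omega &
    forall x, thickening E (10 * d) x -> `|x| <= r].
Proof.
move=> oO [oE cE EO].
have [e e0 eO] : exists2 e, 0 < e & thickening E e `<=` Omega.
  (* Compactness makes the radius of the balls contained in Omega uniform over the closure of E. *)
  have [e /= e0 H] : \forall e \near (0 : R)^'+, closure E `<=` [set x | ball x e `<=` Omega].
    move: cE => /compact_near_coveringP H; apply: H => x Ex.
    have /nbhs_ballP[e /= e0 xO] : nbhs x Omega by apply: open_nbhs_nbhs; split => //; exact: EO.
    have e2 : 0 < e / 2 by rewrite divr_gt0.
    exists (ball x (e / 2), [set t | 0 < t < e / 2]) => /=.
      split; first exact: nbhsx_ballx.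
      by near=> t; apply/andP; split; near: t; [exact: nbhs_right_gt|exact: nbhs_right_lt].
    move=> [y t] /= [xy /andP[t0 te]] z yz; apply: xO.
    have := ball_triangle xy yz; apply: le_ball; lra.
  exists (e / 2); first by rewrite divr_gt0.
  have e2 : 0 < e / 2 by rewrite divr_gt0.
  move=> y [x Ex yx]; have := H (e / 2); rewrite /= sub0r normrN gtr0_norm// => /(_ _ e2 x).
  apply; first lra.
    exact: subset_closure.
  by rewrite -ball_normE /= distrC.
have [M [_ HM]] := compact_bounded cE.
(* The closure of the neighbourhood of radius 10 d lies in that of radius 11 d = e. *)
pose d := e / 11.
have d0 : 0 < d by rewrite divr_gt0.
have bd s x : thickening E s x -> `|x| <= M + 1 + s.
  move=> [y Ey xy]; rewrite -[x](subrK y) addrC (le_trans (ler_normD _ _))// lerD ?(ltW xy)//.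
  by apply: HM; [rewrite ltrDl|exact: subset_closure].
have sub : closure (thickening E (10 * d)) `<=` thickening E e.
  by apply: subset_trans (closure_thickening (d := d) d0) _; apply: thickening_le; rewrite /d; lra.
exists d, (M + 1 + e); split => //.
- split; first exact: open_thickening.
    apply: (@closed_bounded_compact _ (M + 1 + e)); first exact: closed_closure.
    by move=> x /sub; exact: bd.
  exact: subset_trans sub eO.
- by move=> x /(@subset_closure _ _) /sub; exact: bd.
Unshelve. all: by end_near. Qed.

End thickening.

Section lebesgue_spaces.
Context {R : realType} {N : nat}.
Local Notation leb := (lebesgue_rV N).
Local Notation X := 'rV[R]_N.
Implicit Types (x y z : X) (phi psi w v : X -> R) (A E K Omega : set X) (q : R).

Lemma integral_powR_restrict q E psi : q != 0 ->
  (\int[leb]_x (`|(psi \_ E) x| `^ q)%:E = \int[leb]_(x in E) (`|psi x| `^ q)%:E)%E.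
Proof.
move=> q0; rewrite [RHS]integral_mkcond; apply: eq_integral => x _.
by rewrite /= !patchE; case: ifP => // _; rewrite normr0 powR0.
Qed.

Lemma LpP q E psi : 0 < q -> measurable E -> Lp q%:E E psi <->
  measurable_fun E psi /\ (\int[leb]_(x in E) (`|psi x| `^ q)%:E < +oo)%E.
Proof.
move=> q0 mE; have qn : q != 0 by rewrite gt_eqF.
have -> : measurable_fun E psi <-> measurable_fun setT (psi \_ E).
  by split=> ?; exact/(measurable_restrictT _ mE).
rewrite -(integral_powR_restrict _ _ qn) /Lp; split.
  rewrite inE => /andP[/[!inE]/= mpsi] /(poweR_lty q).
  by rewrite powR_Lnorm.
move=> [mpsi foo]; rewrite inE; apply/andP; split; rewrite inE//= /finite_norm.
by rewrite unlock /=; exact: poweR_lty.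
Qed.

Lemma Lp1P E psi : measurable E -> Lp 1%E E psi <-> leb.-integrable E (EFin \o psi).
Proof.
move=> mE; rewrite (LpP _ ltr01 mE); split=> [[mpsi foo]|].
  apply/integrableP; split; first exact/measurable_EFinP.
  by apply: le_lt_trans foo; apply: ge0_le_integral => //= *; rewrite ?powRr1//;
    apply/measurable_EFinP; [exact: measurableT_comp|
      apply: (measurableT_comp (measurable_powR _)); exact: measurableT_comp].
move=> /[dup] /integrable_measurable mpsi /integrableP[_ foo]; split => //.
by apply: le_lt_trans foo; rewrite le_eqVlt; apply/orP; left; apply/eqP/eq_integral => x _ /=;
  rewrite powRr1.
Qed.

Lemma Lp_infty_bounded E psi : measurable E -> Lp +oo%E E psi ->
  measurable_fun E psi /\ exists2 M, 1 <= M & {ae leb, forall x, E x -> `|psi x| <= M}.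
Proof.
move=> mE; rewrite /Lp inE => /andP[/[!inE]/= mpsi].
rewrite /finite_norm unlock /= => H; split; first exact/(measurable_restrictT _ mE).
(* The norm of exponent +oo is defined by cases on whether the whole space has positive measure. If
   it has not, any bound holds almost everywhere. *)
move: H; case: ifPn => [_ H|T0 _]; last first.
  exists 1 => //; exists setT; split => //; apply/eqP.
  by rewrite eq_le measure_ge0 andbT leNgt.
set S := ess_sup_inf.ess_sup _ _ in H.
have [M SM] : exists M, (S <= M%:E)%E.
  case: S H => [s _|//|_]; first by exists s.
  by exists 0; rewrite leNye.
(* A bound at least 1 is what [powR_interpolation] uses to enlarge powers of it. *)
exists (Num.max M 1); first by rewrite le_max lexx orbT.
have : {ae leb, forall x, (abse \o (EFin \o (psi \_ E))) x <= S}%E by exact: ess_sup_inf.ess_sup_ge.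
apply: filterS => x /= H1 Ex.
have := le_trans H1 SM; rewrite patchE mem_set// lee_fin => {}H1.
by rewrite le_max H1.
Qed.

Lemma Lnorm_on_le q E psi (B : R) : 0 < q ->
  (\int[leb]_(x in E) (`|psi x| `^ q)%:E <= B%:E)%E ->
  (Lnorm_on q%:E E psi <= (B `^ q^-1)%:E)%E.
Proof.
move=> q0 H; have qn : q != 0 by rewrite gt_eqF.
rewrite /Lnorm_on unlock /= -poweR_EFin; rewrite -integral_powR_restrict// in H.
have I0 : (0 <= \int[leb]_x (`|(psi \_ E) x| `^ q)%:E)%E.
  by apply: integral_ge0 => x _; rewrite lee_fin powR_ge0.
have i0 : 0 <= q^-1 by rewrite invr_ge0 ltW.
move: (\int[leb]_x _)%E I0 H => I I0 H.
by apply: gt0_ler_poweR => //; rewrite in_itv/= leey andbT// (le_trans I0).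
Qed.

Lemma Lnorm_on1 E psi : measurable E ->
  Lnorm_on 1%E E psi = (\int[leb]_(x in E) (`|psi x|)%:E)%E.
Proof.
move=> mE; rewrite /Lnorm_on Lnorm1 [RHS]integral_mkcond; apply: eq_integral => x _.
by rewrite /= !patchE; case: ifP => // _; rewrite normr0.
Qed.

End lebesgue_spaces.

Section weak_partial.
Context {R : realType} {N : nat}.
Local Notation leb := (lebesgue_rV N).
Local Notation X := 'rV[R]_N.
Implicit Types (x y z : X) (phi u v w : X -> R) (A D E K S Omega : set X) (d r : R).

Lemma Rintegral_eq_on D S (f g : X -> R) : measurable S -> S `<=` D ->
  measurable_fun S f -> measurable_fun S g -> {ae leb, forall x, S x -> f x = g x} ->
  (forall x, D x -> ~ S x -> f x = 0) -> \int[leb]_(x in D) f x = \int[leb]_(x in S) g x.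
Proof.
move=> mS SD mf mg fg f0.
have -> : \int[leb]_(x in D) f x = \int[leb]_(x in S) f x.
  rewrite Rintegral_mkcond [RHS]Rintegral_mkcond; apply: eq_Rintegral => x _.
  rewrite !patchE.
  have [Sx|Sx] := pselect (S x); first by rewrite !mem_set//; exact: SD.
  rewrite [x \in S]memNset//; case: ifPn => // /set_mem Dx; exact: f0.
rewrite /Rintegral; congr fine; apply: ae_eq_integral => //.
- exact/measurable_EFinP.
- exact/measurable_EFinP.
by apply: filterS fg => x H Sx; rewrite /= H.
Qed.

Lemma compactly_inside_trans E S Omega : compactly_inside E S -> S `<=` Omega ->
  compactly_inside E Omega.
Proof. by move=> [oE cE ES] SO; split => //; exact: subset_trans SO. Qed.

Lemma compactly_inside_measurable E Omega : compactly_inside E Omega -> measurable E.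
Proof. by case=> oE _ _; apply: open_measurable_row. Qed.

Lemma compactly_inside_lty S Omega : compactly_inside S Omega -> (leb S < +oo)%E.
Proof.
move=> SO; have [_ /compact_bounded[B [_ HB]] _] := SO.
apply: le_lt_trans (@lebesgue_rV_nball R N (B + 1)); apply: le_measure; rewrite ?inE//.
- exact: compactly_inside_measurable SO.
- exact: measurable_nball.
by move=> x Sx; apply: HB; [rewrite ltrDl|exact: subset_closure].
Qed.

Lemma compactly_inside_subset E Omega : compactly_inside E Omega -> E `<=` Omega.
Proof. by case=> _ _; apply: subset_trans; exact: subset_closure. Qed.

(** Passes to representatives that agree with u and w only almost everywhere on S, such as
    truncations and extensions by zero. *)
Lemma weak_partial_restrict Omega S i u w (U W : X -> R) : weak_partial Omega i u w ->
  compactly_inside S Omega ->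
  measurable_fun S U -> measurable_fun S W ->
  {ae leb, forall x, S x -> u x = U x} -> {ae leb, forall x, S x -> w x = W x} ->
  weak_deriv S i U W.
Proof.
move=> [Lu Lw H] SO mU mW uU wW phi t.
have mS := compactly_inside_measurable SO; have SsO := compactly_inside_subset SO.
have mu : measurable_fun S u by have /(Lp1P _ mS)/integrable_measurable := Lu S SO.
have mw : measurable_fun S w by have /(Lp1P _ mS)/integrable_measurable := Lw S SO.
have tp := test_function_partial i t.
have mt : measurable_fun S phi by apply: measurable_funTS; exact: test_function_measurable t.
have mtp : measurable_fun S (partial i phi).
  by apply: measurable_funTS; exact: test_function_measurable tp.
have K (a b : X -> R) psi : test_function S psi -> measurable_fun S a -> measurable_fun S b ->
    {ae leb, forall x, S x -> a x = b x} ->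
    \int[leb]_x (b x * psi x) = \int[leb]_(x in Omega) (a x * psi x).
  move=> ts ma mb ab.
  have ms : measurable_fun S psi by apply: measurable_funTS; exact: test_function_measurable ts.
  rewrite (@Rintegral_eq_on Omega S _ (fun x => b x * psi x))//; last first.
  - by move=> x _ /(test_function_eq0 ts) ->; rewrite mulr0.
  - by apply: filterS ab => x h Sx; rewrite h.
  - exact: measurable_funM.
  - exact: measurable_funM.
  apply: Rintegral_eq_on => //.
  - exact: measurable_funM.
  - exact: measurable_funM.
  - exact: aeW.
  - by move=> x _ /(test_function_eq0 ts) ->; rewrite mulr0.
rewrite (K u U)// (K w W)//; apply: H; exact: test_function_subset t.
Qed.

Lemma weak_partial_subset Omega S i u w : weak_partial Omega i u w ->
  compactly_inside S Omega -> weak_partial S i u w.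
Proof.
move=> up SO; have mS := compactly_inside_measurable SO.
have SsO := compactly_inside_subset SO.
have [Lu Lw H] := up.
have mu : measurable_fun S u by have /(Lp1P _ mS)/integrable_measurable := Lu S SO.
have mw : measurable_fun S w by have /(Lp1P _ mS)/integrable_measurable := Lw S SO.
split=> [E ES|E ES|phi t].
- by apply: Lu; exact: compactly_inside_trans ES SsO.
- by apply: Lw; exact: compactly_inside_trans ES SsO.
have mt : measurable_fun S phi by apply: measurable_funTS; exact: test_function_measurable t.
have tp := test_function_partial i t.
have mtp : measurable_fun S (partial i phi).
  by apply: measurable_funTS; exact: test_function_measurable tp.
have := H phi (test_function_subset SsO t).
rewrite (@Rintegral_eq_on Omega S _ (fun x => u x * partial i phi x))//; first last.
- by move=> x _ /(test_function_eq0 tp) ->; rewrite mulr0.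
- exact: aeW.
- exact: measurable_funM.
- exact: measurable_funM.
rewrite (@Rintegral_eq_on Omega S _ (fun x => w x * phi x))//.
- exact: measurable_funM.
- exact: measurable_funM.
- exact: aeW.
- by move=> x _ /(test_function_eq0 t) ->; rewrite mulr0.
Qed.

Lemma Lp1_loc_integrable S u : measurable S -> leb.-integrable S (EFin \o u) ->
  Lp_loc 1%E S u.
Proof.
move=> mS Iu E ES; have mE := compactly_inside_measurable ES.
by apply/(Lp1P _ mE); apply: integrableS Iu => //; exact: compactly_inside_subset ES.
Qed.

Lemma integrable_test_functionM_on S u phi : measurable S -> leb.-integrable S (EFin \o u) ->
  test_function S phi -> leb.-integrable S (EFin \o (fun x => u x * phi x)).
Proof.
move=> mS Iu t; have [M _ pM] := test_function_bounded t.
apply: (@integrable_mulr_bounded _ _ _ _ _ _ M) => //.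
by apply: measurable_funTS; exact: test_function_measurable t.
Qed.

Lemma weak_partialD S i u w v v' : measurable S ->
  leb.-integrable S (EFin \o u) -> leb.-integrable S (EFin \o w) ->
  leb.-integrable S (EFin \o v) -> leb.-integrable S (EFin \o v') ->
  weak_partial S i u w -> weak_partial S i v v' ->
  weak_partial S i (fun x => u x + v x) (fun x => w x + v' x).
Proof.
move=> mS Iu Iw Iv Iz [_ _ H1] [_ _ H2]; split.
- by apply: Lp1_loc_integrable => //; exact: integrable_addr.
- by apply: Lp1_loc_integrable => //; exact: integrable_addr.
move=> phi t; have tp := test_function_partial i t.
under eq_Rintegral do rewrite mulrDl.
rewrite RintegralD//; [|exact: integrable_test_functionM_on..].
under [in RHS]eq_Rintegral do rewrite mulrDl.
rewrite RintegralD//; [|exact: integrable_test_functionM_on..].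
by rewrite H1// H2// opprD.
Qed.

Lemma weak_deriv_weak_partial S i w v : measurable S ->
  leb.-integrable setT (EFin \o w) -> leb.-integrable setT (EFin \o v) ->
  weak_deriv S i w v -> weak_partial S i w v.
Proof.
move=> mS Iw Iv H.
have IwS : leb.-integrable S (EFin \o w) by exact: integrableS Iw.
have IvS : leb.-integrable S (EFin \o v) by exact: integrableS Iv.
split; [exact: Lp1_loc_integrable..|move=> phi t].
have tp := test_function_partial i t.
have K (a : X -> R) psi : leb.-integrable S (EFin \o a) -> test_function S psi ->
    \int[leb]_(x in S) (a x * psi x) = \int[leb]_x (a x * psi x).
  move=> Ia ts; have ms : measurable_fun S psi.
    by apply: measurable_funTS; exact: test_function_measurable ts.
  apply/esym; apply: Rintegral_eq_on => //.
  - by apply: measurable_funM => //; exact: integrable_measurable Ia.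
  - by apply: measurable_funM => //; exact: integrable_measurable Ia.
  - exact: aeW.
  - by move=> x _ /(test_function_eq0 ts) ->; rewrite mulr0.
by rewrite !K//; exact: H.
Qed.

(** Take smooth approximations with tolerance min(1 / (k + 1), d / 3). They converge in W^{1,1}, and
    their supports stay in the closure of the neighbourhood of A of radius d / 2, a compact subset
    of S. *)
Lemma W11_0_intro S A w (v : 'I_N -> X -> R) d r : measurable S -> 0 < d ->
  thickening A d `<=` S -> (forall x, A x -> `|x| <= r) ->
  (forall x, w x != 0 -> A x) -> (forall i x, v i x != 0 -> A x) ->
  leb.-integrable setT (EFin \o w) -> (forall i, leb.-integrable setT (EFin \o v i)) ->
  (forall i, weak_deriv setT i w (v i)) -> W11_0 S w v.
Proof.
move=> mS d0 AS Ar wA vA Iw Iv wd.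
have bs f : (forall x, f x != 0 -> A x) -> bounded_support r f.
  by move=> fA x; rewrite ltNge; apply: contraNeq => /fA; exact: Ar.
have d2 : 0 < d / 2 by rewrite divr_gt0.
pose K := closure (thickening A (d / 2)).
have KS : K `<=` S.
  apply: subset_trans AS; have := @closure_thickening _ _ A (d / 2) (d / 2) d2.
  by have -> : d / 2 + d / 2 = d by [field].
have cK : compact K.
  have Ar' x : thickening A d x -> `|x| <= r + d.
    move=> [y /Ar yr xy]; rewrite -[x](subrK y) addrC (le_trans (ler_normD _ _))// lerD//.
    exact: ltW.
  apply: (@closed_bounded_compact _ _ _ (r + d)); first exact: closed_closure.
  move=> x Kx; apply: Ar'; have := @closure_thickening _ _ A (d / 2) (d / 2) d2 x Kx.
  by have -> : d / 2 + d / 2 = d by [field].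
have /boolp.choice[phi phiP] : forall k, exists phi, [/\ test_function S phi,
    (\int[leb]_x (`|w x - phi x|%R)%:E <= (harmonic k)%:E)%E &
    forall i, (\int[leb]_x (`|v i x - partial i phi x|%R)%:E <= (harmonic k)%:E)%E].
  move=> k; pose e := Num.min (harmonic k) (d / 3).
  have e0 : 0 < e by rewrite lt_min harmonic_gt0/= divr_gt0.
  have eh : e <= harmonic k by rewrite ge_min lexx.
  have [phi [sp ph H1 H2]] := weak_deriv_approx Iw Iv (bs _ wA) (fun i => bs _ (vA i)) wd e0.
  exists phi; split.
  - apply: (@test_function_intro _ _ _ K) => // x /ph[y yx /wA Ay].
    apply: subset_closure; exists y => //; rewrite distrC (le_lt_trans yx)//.
    rewrite /e gt_min; apply/orP; right; lra.
  - by apply: (le_trans H1); rewrite lee_fin.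
  - by move=> i; apply: (le_trans (H2 i)); rewrite lee_fin.
split.
- move=> i; apply: weak_deriv_weak_partial => //.
  exact: weak_deriv_subset (wd i).
- by apply/(Lp1P _ mS); exact: integrableS Iw.
- by move=> i; apply/(Lp1P _ mS); exact: integrableS (Iv i).
have cvg0 (F G : nat -> X -> R) : (forall k, measurable_fun setT (fun x => F k x - G k x)) ->
    (forall k, \int[leb]_x (`|F k x - G k x|%R)%:E <= (harmonic k)%:E)%E ->
    (Lnorm_on 1%E S (F k \- G k) @[k --> \oo] --> 0%E).
  move=> mFG H; apply: (@squeeze_cvge _ _ _ _ (cst 0%E) _ (fun k => (harmonic k)%:E)).
  - near=> k; rewrite Lnorm_on1//; apply/andP; split; first exact: integral_ge0.
    apply: le_trans (H k); apply: integral_norm_subset => //; exact: mFG.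
  - exact: cvg_cst.
  - exact: cvge_harmonic.
exists phi; split=> [k||i].
- by have [] := phiP k.
- apply: (cvg0 (fun=> w) phi) => k; have [t H1 H2] := phiP k => //.
  apply: measurable_funB; first exact: integrable_measurable Iw.
  exact: test_function_measurable t.
- apply: (cvg0 (fun=> v i) (fun k => partial i (phi k))) => k; have [t H1 H2] := phiP k => //.
  apply: measurable_funB; first exact: integrable_measurable (Iv i).
  exact: test_function_measurable (test_function_partial i t).
Unshelve. all: by end_near. Qed.

End weak_partial.

(** For small t the linear term dominates, and t takes both signs. *)
Lemma eq0_of_quadratic_bound {R : realType} (a b : R) :
  (forall t, `|t| <= 1 -> 0 <= t * a + t ^+ 2 * b) -> a = 0.
Proof.
move=> H.
have H1 (c : R) : (forall t, `|t| <= 1 -> 0 <= t * c + t ^+ 2 * b) -> 0 <= c.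
  move=> Hc; rewrite leNgt; apply/negP => c0.
  (* Small enough that t |b| <= - c / 2, which makes c + t b negative. *)
  pose t := Num.min 1 (- c / (`|b| + 1) / 2).
  have b1 : 0 < `|b| + 1 by rewrite ltr_wpDl.
  have t0 : 0 < t by rewrite lt_min ltr01 !divr_gt0// oppr_gt0.
  have t1 : `|t| <= 1 by rewrite gtr0_norm// ge_min lexx.
  have tb : t * (`|b| + 1) <= - c / 2.
    have : t <= - c / (`|b| + 1) / 2 by rewrite ge_min lexx orbT.
    move=> /(ler_wpM2r (ltW b1)) /le_trans; apply.
    by rewrite le_eqVlt; apply/orP; left; apply/eqP; field; rewrite gt_eqF.
  have := Hc t t1; have -> : t * c + t ^+ 2 * b = t * (c + t * b) by ring.
  rewrite pmulr_rge0// => h; have := ler_norm b; nra.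
apply/eqP; rewrite eq_le; apply/andP; split; last exact: H1.
rewrite -oppr_ge0; apply: H1 => t t1; have := H (- t); rewrite normrN => /(_ t1).
by rewrite sqrrN mulNr mulrN.
Qed.

(** * The Euler-Lagrange equation *)

Section euler_lagrange.
Context {R : realType} {N : nat}.
Local Notation leb := (lebesgue_rV N).
Local Notation X := 'rV[R]_N.
Variables (Omega S A : set X) (p : 'I_N -> R) (g : 'I_N -> R -> R) (f u : X -> R).
Variables (Du : 'I_N -> X -> R) (C delta d r M : R).
Hypotheses (p2 : forall i, 2 <= p i) (g0 : forall i s, 0 <= g i s)
  (C2g : forall i, C2 (g i)) (C1 : 1 <= C) (d0 : 0 <= delta)
  (gg : forall i, growth C delta (p i) (g i)) (um : local_minimizer Omega p g f u Du)
  (SO : compactly_inside S Omega)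
  (If : leb.-integrable S (EFin \o f)) (mu : measurable_fun S u)
  (uM : {ae leb, forall x, S x -> `|u x| <= M})
  (dp : 0 < d) (AS : thickening A d `<=` S) (Ar : forall x, A x -> `|x| <= r).

Let mS : measurable S. Proof. exact: compactly_inside_measurable SO. Qed.

Let Sfin : (leb S < +oo)%E. Proof. exact: compactly_inside_lty SO. Qed.

Let LDu i : measurable_fun S (Du i) /\ (\int[leb]_(x in S) (`|Du i x| `^ p i)%:E < +oo)%E.
Proof.
have [[_ L] _] := um; apply/LpP => //; last exact: L.
exact: lt_le_trans (p2 i).
Qed.

Let IDu i : leb.-integrable S (EFin \o Du i).
Proof.
have [[wg _] _] := um; have [_ L _] := wg i.
exact/(Lp1P _ mS)/L.
Qed.

Let Iu : leb.-integrable S (EFin \o u).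
Proof.
apply/integrableP; split; first exact/measurable_EFinP.
apply: (@le_lt_trans _ _ (\int[leb]_(x in S) `|M|%:E)%E).
  apply: ae_ge0_le_integral => //.
  - by apply: measurableT_comp => //; exact/measurable_EFinP.
  - apply: filterS uM => x H /H h; by rewrite /= lee_fin (le_trans h)// ler_norm.
by rewrite (integral_cst leb mS (`|M|%:E))// lte_mul_pinfty.
Qed.

Let Ifu : leb.-integrable S (EFin \o (fun x => f x * u x)).
Proof.
have mf := integrable_measurable If.
have If' : leb.-integrable S (EFin \o (fun x => `|f x| * `|M|)).
  apply: (@integrable_mulr_bounded _ _ _ _ _ _ `|M|) => //; last by move=> x _; rewrite normr_id.
  exact: integrable_norm.
apply/integrableP; split; first by apply/measurable_EFinP/measurable_funM.
have /integrableP[_] := If'; apply: le_lt_trans.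
apply: ae_ge0_le_integral => //.
- by apply: measurableT_comp => //; apply/measurable_EFinP/measurable_funM.
- by apply: measurableT_comp => //; have /integrableP[] := If'.
apply: filterS uM => x H /H h; rewrite /= lee_fin !normrM !normr_id ler_wpM2l//.
by rewrite (le_trans h)// ler_norm.
Qed.

(** For |t| <= 1 the function u + t w is a competitor on S, and the integrated Taylor bounds of the
    g_i majorize its energy by a quadratic polynomial in t whose linear coefficient is the first
    variation. The bound B on w makes f w integrable, f being known here only as an integrable
    function. *)
Lemma euler_lagrange (w : X -> R) (v : 'I_N -> X -> R) (B : R) :
  (forall x, w x != 0 -> A x) -> (forall i x, v i x != 0 -> A x) ->
  leb.-integrable setT (EFin \o w) -> (forall i, leb.-integrable setT (EFin \o v i)) ->
  (forall i, weak_deriv setT i w (v i)) -> (forall x, `|w x| <= B) ->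
  (forall i, \int[leb]_x (`|v i x| `^ p i)%:E < +oo)%E ->
  [/\ forall i, leb.-integrable S (EFin \o (fun x => derive1 (g i) (Du i x) * v i x)),
      leb.-integrable S (EFin \o (fun x => f x * w x)) &
      \sum_(i < N) \int[leb]_(x in S) (derive1 (g i) (Du i x) * v i x)
        + \int[leb]_(x in S) (f x * w x) = 0].
Proof.
move=> wA vA Iw Iv wd wB vp.
have mw := integrable_measurable Iw.
have mv i : measurable_fun setT (v i) := integrable_measurable (Iv i).
have IwS : leb.-integrable S (EFin \o w) by exact: integrableS Iw.
have IvS i : leb.-integrable S (EFin \o v i) by exact: integrableS (Iv i).
have mwS := integrable_measurable IwS.
have mvS i : measurable_fun S (v i) := integrable_measurable (IvS i).
have mg i : measurable_fun setT (g i).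
  apply: continuous_measurable_fun.
  exact: is_derive_continuous (integrand_derive1 (C2g i)).
have mg' i : measurable_fun setT (derive1 (g i)).
  apply: continuous_measurable_fun.
  exact: is_derive_continuous (integrand_derive2 (C2g i)).
have /boolp.choice[K KP] : forall i, exists K, 0 <= K /\ forall a b,
    [/\ g i a <= K * growth_sum (p i) a b, `|derive1 (g i) a * b| <= K * growth_sum (p i) a b &
      forall t, `|t| <= 1 -> g i (a + t * b) <=
        g i a + t * (derive1 (g i) a * b) + t ^+ 2 * (K * growth_sum (p i) a b)].
  by move=> i; have [K K0 H] := integrand_growth (C2g i) (gg i) C1 (p2 i); exists K.
pose L i x := derive1 (g i) (Du i x) * v i x.
pose G i x := K i * growth_sum (p i) (Du i x) (v i x).
have pp i : 0 < p i by exact: lt_le_trans (p2 i).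
have mpow (q : R) (a : X -> R) : measurable_fun S a -> measurable_fun S (fun x => `|a x| `^ q).
  by move=> ma; apply: (measurableT_comp (measurable_powR _)); exact: measurableT_comp.
have IG i : leb.-integrable S (EFin \o G i).
  apply: integrable_scaler => //; apply: integrable_addr => //; last first.
    apply: ge0_integrable_lty => //.
    by rewrite (integral_cst leb mS 1%E) mul1e.
  have [mDu fDu] := LDu i.
  apply: (integrable_addr mS).
    by apply: (ge0_integrable_lty mS (mpow _ _ mDu) _ fDu) => x _; exact: powR_ge0.
  apply: (ge0_integrable_lty mS (mpow _ _ (mvS i))) => [x _|]; first exact: powR_ge0.
  apply: le_lt_trans (vp i); apply: ge0_subset_integral => //.
  apply/measurable_EFinP; apply: (measurableT_comp (measurable_powR _)).
  exact: measurableT_comp.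
have mDu i : measurable_fun S (Du i) by have [] := LDu i.
have IL i : leb.-integrable S (EFin \o L i).
  apply: (@integrable_dominated _ _ _ _ _ (G i)) => //.
    by apply: measurable_funM => //; exact: measurableT_comp.
  by move=> x _; have [_ H] := KP i; have [_ ] := H (Du i x) (v i x).
have Ig i : leb.-integrable S (EFin \o (fun x => g i (Du i x))).
  apply: (@integrable_dominated _ _ _ _ _ (G i)) => //.
    exact: measurableT_comp.
  by move=> x _; have [_ H] := KP i; have [? _] := H (Du i x) (v i x); rewrite ger0_norm.
have Ifw : leb.-integrable S (EFin \o (fun x => f x * w x)).
  by apply: (integrable_mulr_bounded _ If mwS (fun x _ => wB x)).
split => //.
pose SL := \sum_(i < N) \int[leb]_(x in S) L i x; pose SG := \sum_(i < N) \int[leb]_(x in S) G i x.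
pose Sg := \sum_(i < N) \int[leb]_(x in S) g i (Du i x).
apply: (@eq0_of_quadratic_bound _ _ SG) => t t1.
have [[wg _] min] := um.
have Itw : leb.-integrable setT (EFin \o (fun x => t * w x)) by exact: integrable_scaler.
have Itv i : leb.-integrable setT (EFin \o (fun x => t * v i x)) by exact: integrable_scaler.
have ItwS : leb.-integrable S (EFin \o (fun x => t * w x)) by exact: integrableS Itw.
have ItvS i : leb.-integrable S (EFin \o (fun x => t * v i x)) by exact: integrableS (Itv i).
have wdt i : weak_deriv setT i (fun x => t * w x) (fun x => t * v i x) by exact: weak_derivZ.
have := min S SO (fun x => u x + t * w x) (fun i x => Du i x + t * v i x).
have H1 : weak_gradient S (fun x => u x + t * w x) (fun i x => Du i x + t * v i x).
  move=> i; apply: weak_partialD => //; first exact: weak_partial_subset SO.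
  by apply: weak_deriv_weak_partial => //; exact: weak_deriv_subset (wdt i).
have H2 : W1p_0 S p ((fun x => u x + t * w x) \- u).
  have -> : (fun x => u x + t * w x) \- u = fun x => t * w x.
    by apply/funext => x /=; rewrite addrAC subrr add0r.
  exists (fun i x => t * v i x); split.
    apply: (W11_0_intro mS dp AS Ar) => //.
      by move=> x; rewrite mulf_eq0 negb_or => /andP[_ /wA].
    by move=> i x; rewrite mulf_eq0 negb_or => /andP[_ /vA].
  move=> i; apply/LpP => //; split; first exact: integrable_measurable (ItvS i).
  apply: le_lt_trans (vp i); apply: (@le_trans _ _ (\int[leb]_x (`|t * v i x| `^ p i)%:E)%E).
    apply: ge0_subset_integral => //.
    apply/measurable_EFinP; apply: (measurableT_comp (measurable_powR _)).
    by apply: measurableT_comp => //; exact: measurable_funM.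
  apply: ge0_le_integral => //.
  - apply/measurable_EFinP; apply: (measurableT_comp (measurable_powR _)).
    by apply: measurableT_comp => //; exact: measurable_funM.
  - apply/measurable_EFinP; apply: (measurableT_comp (measurable_powR _)).
    exact: measurableT_comp.
  move=> x _; rewrite lee_fin; apply: ge0_ler_powR; rewrite ?nnegrE ?(ltW (pp i))//.
  by rewrite normrM ler_piMl.
move=> /(_ H1 H2).
(* The energy of u is finite, so minimality becomes an inequality between real numbers once the
   competitor is majorized. *)
have -> : energy g f u Du S = (Sg + \int[leb]_(x in S) (f x * u x))%:E.
  rewrite /energy EFinD EFin_Rintegral//; congr (_ + _)%E.
  by rewrite -sumEFin; apply: eq_bigr => i _; rewrite EFin_Rintegral.
have Ifuw : leb.-integrable S (EFin \o (fun x => f x * (u x + t * w x))).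
  have -> : (fun x => f x * (u x + t * w x)) = fun x => f x * u x + t * (f x * w x).
    by apply/funext => x; ring.
  by apply: integrable_addr => //; exact: integrable_scaler.
have fE : \int[leb]_(x in S) (f x * (u x + t * w x)) =
    \int[leb]_(x in S) (f x * u x) + t * \int[leb]_(x in S) (f x * w x).
  under eq_Rintegral do rewrite mulrDr mulrCA.
  by rewrite RintegralD// ?RintegralZl//; exact: integrable_scaler.
have upper : (energy g f (fun x => u x + t * w x)%R (fun i x => Du i x + t * v i x)%R S <=
    (Sg + t * SL + t ^+ 2 * SG + (\int[leb]_(x in S) (f x * u x) + t * \int[leb]_(x in S) (f x *
      w x)))%:E)%E.
  rewrite /energy EFinD -fE [X in (_ <= _ + X)%E]EFin_Rintegral//; apply: leeD2r.
  have -> : Sg + t * SL + t ^+ 2 * SG =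
      \sum_(i < N) (\int[leb]_(x in S) g i (Du i x) + t * \int[leb]_(x in S) L i x + t ^+ 2 *
        \int[leb]_(x in S) G i x).
    by rewrite !big_split/= -!mulr_sumr.
  rewrite -sumEFin; apply: lee_sum => i _.
  have I1 : leb.-integrable S (EFin \o (fun x => g i (Du i x) + t * L i x)).
    by apply: integrable_addr => //; exact: integrable_scaler.
  have I2 : leb.-integrable S (EFin \o (fun x => t ^+ 2 * G i x)) by exact: integrable_scaler.
  have -> : \int[leb]_(x in S) g i (Du i x) + t * \int[leb]_(x in S) L i x + t ^+ 2 *
    \int[leb]_(x in S) G i x
      = \int[leb]_(x in S) (g i (Du i x) + t * L i x + t ^+ 2 * G i x).
    rewrite RintegralD// RintegralD//; last exact: integrable_scaler.
    by rewrite (RintegralZl t mS (IL i)) (RintegralZl (t ^+ 2) mS (IG i)).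
  rewrite EFin_Rintegral//; last exact: integrable_addr.
  apply: ge0_le_integral => //.
  - by move=> x _; rewrite lee_fin.
  - apply/measurable_EFinP; apply: (measurableT_comp (mg i)).
    by apply: measurable_funD => //; exact: measurable_funM.
  - apply/measurable_EFinP; exact: integrable_measurable (integrable_addr mS I1 I2).
  by move=> x _; have [_ H] := KP i; have [_ _ /(_ t t1)] := H (Du i x) (v i x); rewrite lee_fin.
move=> /le_trans /(_ upper); rewrite lee_fin -/SL; lra.
Qed.

End euler_lagrange.

(** * The estimate of the difference quotients *)

Section powR_integrable.
Context {R : realType} {N : nat}.
Local Notation leb := (lebesgue_rV N).
Local Notation X := 'rV[R]_N.
Implicit Types (x y z : X) (f u v w psi : X -> R) (A D E S Omega : set X) (q c r : R).

Lemma measurable_normr_powR D q w : measurable_fun D w -> measurable_fun D (fun x => `|w x| `^ q).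
Proof. by move=> mw; apply: (measurableT_comp (measurable_powR _)); exact: measurableT_comp. Qed.

Lemma ge0_Rintegral_le D f c : measurable D -> measurable_fun D f -> (forall x, D x -> 0 <= f x) ->
  (\int[leb]_(x in D) (f x)%:E <= c%:E)%E ->
  leb.-integrable D (EFin \o f) /\ \int[leb]_(x in D) f x <= c.
Proof.
move=> mD mf f0 H; have If : leb.-integrable D (EFin \o f).
  by apply: ge0_integrable_lty => //; apply: le_lt_trans H _; exact: ltry.
by split => //; rewrite -lee_fin EFin_Rintegral.
Qed.

Definition powR_integrable q w :=
  measurable_fun setT w /\ leb.-integrable setT (EFin \o (fun x => `|w x| `^ q)).

Lemma powR_integrable_lty q w : powR_integrable q w -> (\int[leb]_x (`|w x| `^ q)%:E < +oo)%E.
Proof.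
move=> [mw /integrableP[_]]; apply: le_lt_trans; rewrite le_eqVlt; apply/orP; left; apply/eqP.
by apply: eq_integral => x _; congr (_%:E); rewrite [RHS]ger0_norm ?powR_ge0.
Qed.

Lemma lty_powR_integrable q w : measurable_fun setT w ->
  (\int[leb]_x (`|w x| `^ q)%:E < +oo)%E -> powR_integrable q w.
Proof.
move=> mw foo; split => //; apply: ge0_integrable_lty => //; exact: measurable_normr_powR.
Qed.

Lemma normr_powRD q (a b : R) : 0 <= q -> `|a + b| `^ q <= 2 `^ q * (`|a| `^ q + `|b| `^ q).
Proof.
move=> q0; wlog ab : a b / `|a| <= `|b| => [H|].
  by have [/H//|/ltW/H] := leP `|a| `|b|; rewrite addrC [X in _ * X]addrC.
apply: (@le_trans _ _ ((2 * `|b|) `^ q)).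
  apply: ge0_ler_powR; rewrite ?nnegrE ?mulr_ge0//.
  by rewrite (le_trans (ler_normD _ _))//; lra.
by rewrite powRM// ler_wpM2l ?powR_ge0// lerDr powR_ge0.
Qed.

Lemma powR_integrableD q u v : 0 <= q -> powR_integrable q u -> powR_integrable q v ->
  powR_integrable q (fun x => u x + v x).
Proof.
move=> q0 [mu Iu] [mv Iv]; have mD := measurable_funD mu mv.
split; first exact: mD.
apply: (@integrable_dominated _ _ _ _ _ (fun x => 2 `^ q * (`|u x| `^ q + `|v x| `^ q))) => //.
- exact: measurable_normr_powR mD.
- by move=> x _; rewrite ger0_norm ?powR_ge0//; exact: normr_powRD.
by apply: integrable_scaler => //; exact: integrable_addr.
Qed.

Lemma powR_integrableM q c u v : 0 <= q -> powR_integrable q u -> measurable_fun setT v ->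
  (forall x, `|v x| <= c) -> powR_integrable q (fun x => v x * u x).
Proof.
move=> q0 [mu Iu] mv vc; have mM := measurable_funM mv mu.
split; first exact: mM.
apply: (@integrable_dominated _ _ _ _ _ (fun x => c `^ q * `|u x| `^ q)) => //.
- exact: measurable_normr_powR mM.
- move=> x _; have c0 : 0 <= c by exact: le_trans (vc x).
  rewrite ger0_norm ?powR_ge0// normrM powRM// ler_wpM2r ?powR_ge0//.
  by apply: ge0_ler_powR; rewrite ?nnegrE.
exact: integrable_scaler.
Qed.

Lemma powR_integrable_shift q u a : powR_integrable q u -> powR_integrable q (fun x => u (x + a)).
Proof.
by move=> [mu Iu]; split; [exact: measurable_fun_shift|exact: (integrable_shift a Iu)].
Qed.

Lemma powR_integrable_bounded q c r u : 0 < q -> measurable_fun setT u ->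
  (forall x, `|u x| <= c) -> bounded_support r u -> powR_integrable q u.
Proof.
move=> q0 mu uc ur; split => //; apply: (@integrable_bounded_support _ _ _ (c `^ q) r).
- exact: measurable_normr_powR.
- move=> x; rewrite ger0_norm ?powR_ge0//; apply: ge0_ler_powR; rewrite ?nnegrE ?(ltW q0)//.
  by apply: le_trans (uc x).
- by move=> x /ur ->; rewrite normr0 powR0// gt_eqF.
Qed.

Lemma powR_integrable_restrict q S u : 0 < q -> measurable S -> measurable_fun S u ->
  (\int[leb]_(x in S) (`|u x| `^ q)%:E < +oo)%E -> powR_integrable q (u \_ S).
Proof.
move=> q0 mS mu foo; apply: lty_powR_integrable; first exact/(measurable_restrictT _ mS).
by rewrite integral_powR_restrict// gt_eqF.
Qed.

End powR_integrable.

Section local_difference_quotient.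
Context {R : realType} {N : nat}.
Local Notation leb := (lebesgue_rV N).
Local Notation X := 'rV[R]_N.
Variables (E : set X) (d r : R).
Local Notation T s := (thickening E (s * d)).
Hypotheses (d0 : 0 < d) (Tr : forall x, T 10 x -> `|x| <= r).

Lemma thickening_mono (k l : R) : k <= l -> T k `<=` T l.
Proof. by move=> kl; apply: thickening_le; rewrite ler_pM2r. Qed.

Lemma thickening_move (k l : R) x v : k + 1 <= l -> T k x -> `|v| <= d -> T l (x + v).
Proof.
move=> kl /thickening_shift H /H; apply: thickening_le.
by rewrite -[X in _ + X]mul1r -mulrDl ler_pM2r.
Qed.

(** The cutoff is 1 up to distance d from T k and vanishes outside of T (k + 3); as k + 3 < l, its
    support is compact in T l. *)
Lemma cutoff_thickening (k l : R) : k + 3 < l -> l <= 10 ->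
  exists zeta : X -> R, test_function (T l) zeta /\
    forall y v, T k y -> `|v| < d -> zeta (y + v) = 1.
Proof.
move=> kl l10.
have sub : closure (T (k + 3)) `<=` T l.
  have dl : 0 < (l - (k + 3)) * d by rewrite mulr_gt0// subr_gt0.
  have := @closure_thickening _ _ E ((k + 3) * d) _ dl.
  by rewrite -mulrDl [k + 3 + _]addrC subrK.
have [||zeta [sz z1 z2]] := @cutoff_exists R N (T k) d r => //.
  move=> x Tx; apply: Tr; apply: thickening_mono Tx; lra.
have zT y : zeta y != 0 -> T (k + 3) y.
  move=> /z2[x Tx yx]; have -> : y = x + (y - x) by rewrite addrC subrK.
  have -> : (k + 3) * d = k * d + 3 * d by ring.
  exact: thickening_shift Tx (ltW yx).
exists zeta; split; last by move=> y v Ty vd; apply: (z1 y) => //; rewrite addrC addKr.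
apply: (test_function_intro (K := closure (T (k + 3)))) => //.
- apply: (@closed_bounded_compact _ _ _ r); first exact: closed_closure.
  by move=> x /sub H; apply: Tr; exact: thickening_mono H.
- by move=> y /zT; exact: subset_closure.
Qed.

(** Multiplying w by a cutoff equal to 1 on T 6 makes the global [difference_quotient_le]
    applicable. For x in T 4 the segment to x + h e_j stays in T 5, where the product and its weak
    derivatives coincide with w and the v i. *)
Lemma local_difference_quotient_le (w : X -> R) (v : 'I_N -> X -> R) (q h : R) (j : 'I_N) :
  leb.-integrable setT (EFin \o w) -> (forall i, leb.-integrable setT (EFin \o v i)) ->
  (forall i, weak_deriv (T 10) i w (v i)) -> 1 <= q -> `|h| <= d ->
  (\int[leb]_(x in T 4) (`|w (x + h *: basis j) - w x| `^ q)%:E <=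
   (`|h| `^ q)%:E * \int[leb]_x (`|v j x| `^ q)%:E)%E.
Proof.
move=> Iw Iv wd q1 hd.
have [] := @cutoff_thickening 6 10; [lra|lra|] => zeta [tz z1].
have tp i := test_function_partial i tz.
pose w' x := zeta x * w x; pose v' i x := zeta x * v i x + partial i zeta x * w x.
have Iw' : leb.-integrable setT (EFin \o w').
  have := integrable_test_functionM tz Iw.
  by congr (leb.-integrable _ _); apply/funext => x /=; rewrite mulrC.
have Iv' i : leb.-integrable setT (EFin \o v' i).
  have := integrable_addr measurableT (integrable_test_functionM tz (Iv i))
    (integrable_test_functionM (tp i) Iw).
  by congr (leb.-integrable _ _); apply/funext => x /=; rewrite /v' mulrC [X in _ + X]mulrC.
have wd' i : weak_deriv setT i w' (v' i) := @weak_derivM R N (T 10) setT i _ _ _ Iw (Iv i) tz (wd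
  i).
have z0 x : r < `|x| -> zeta x = 0.
  by rewrite ltNge => /negP xr; apply: (test_function_eq0 tz) => /Tr.
have pz0 i x : r < `|x| -> partial i zeta x = 0.
  by rewrite ltNge => /negP xr; apply: (test_function_eq0 (tp i)) => /Tr.
have bw' : bounded_support r w' by move=> x xr; rewrite /w' z0// mul0r.
have bv' i : bounded_support r (v' i) by move=> x xr; rewrite /v' z0// pz0// !mul0r addr0.
have zE x : T 6 x -> zeta x = 1 by move=> Tx; have := z1 x 0 Tx; rewrite addr0 normr0; exact.
have pzE i x : T 6 x -> partial i zeta x = 0.
  move=> Tx; rewrite /partial -(derive_cst (1 : R) x (basis i)).
  apply: near_eq_derive; near=> y; apply: zE; near: y.
  by apply: open_nbhs_nbhs; split => //; exact: open_thickening.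
have := @difference_quotient_le R N w' v' r q j h (T 4) (T 5) Iw' Iv' bw' bv' wd' q1.
have m4 : measurable (T 4) := measurable_thickening _ _.
have m5 : measurable (T 5) := measurable_thickening _ _.
have AB : forall (x : X) (t : R), T 4 x -> 0 <= t <= 1 -> T 5 (x + t *: (h *: basis j)).
  move=> x t Tx /andP[t0 t1]; apply: thickening_move Tx _; first lra.
  by rewrite !normrZ norm_basis mulr1 (le_trans _ hd)// ger0_norm// ler_piMl.
move=> /(_ m4 m5 AB) H.
have eL : (\int[leb]_(x in T 4) (`|w (x + h *: basis j) - w x| `^ q)%:E =
    \int[leb]_(x in T 4) (`|w' (x + h *: basis j) - w' x| `^ q)%:E)%E.
  apply: eq_integral => x /set_mem Tx.
  have T6 : T 6 x by apply: thickening_mono Tx; lra.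
  have T6' : T 6 (x + h *: basis j).
    apply: (@thickening_mono 5 6); first lra.
    by have := AB x 1 Tx; rewrite scale1r ler01 lexx; exact.
  by rewrite /w' !zE// !mul1r.
rewrite eL; apply: (le_trans H); apply: lee_wpmul2l; first by rewrite lee_fin powR_ge0.
rewrite (_ : \int[leb]_(x in T 5) (`|v' j x| `^ q)%:E = \int[leb]_(x in T 5) (`|v j x| `^ q)%:E)%E.
  apply: ge0_subset_integral => //.
  by apply/measurable_EFinP; apply: measurable_normr_powR; exact: integrable_measurable (Iv j).
apply: eq_integral => x /set_mem Tx.
have T6 : T 6 x by apply: thickening_mono Tx; lra.
by rewrite /v' zE// pzE// mul0r addr0 mul1r.
Unshelve. all: by end_near. Qed.

Lemma local_scaled_difference_le (w : X -> R) (v : 'I_N -> X -> R) (q h : R) (j : 'I_N) :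
  leb.-integrable setT (EFin \o w) -> (forall i, leb.-integrable setT (EFin \o v i)) ->
  (forall i, weak_deriv (T 10) i w (v i)) -> 1 <= q -> h != 0 -> `|h| <= d ->
  (\int[leb]_(x in T 4) (`|(w (x + h *: basis j) - w x) / `|h| | `^ q)%:E <=
   \int[leb]_x (`|v j x| `^ q)%:E)%E.
Proof.
move=> Iw Iv wd q1 h0 hd; have hp : 0 < `|h| by rewrite normr_gt0.
have H := local_difference_quotient_le j Iw Iv wd q1 hd.
have mw : measurable_fun (T 4) (fun x => w (x + h *: basis j) - w x).
  apply: measurable_funTS; apply: measurable_funB; last exact: integrable_measurable Iw.
  exact: (measurable_fun_shift _ (integrable_measurable Iw)).
rewrite (eq_integral (fun x : X => ((`|h|^-1 `^ q)%:E * (`|w (x + h *: basis j) - w x|%R `^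
  q)%:E)%E)); last first.
  by move=> x _; rewrite -EFinM normrM normfV normr_id powRM// mulrC.
rewrite ge0_integralZl//; last first.
- by apply/measurable_EFinP; exact: measurable_normr_powR.
- exact: measurable_thickening.
apply: (@le_trans _ _ ((`|h|^-1 `^ q)%:E * ((`|h| `^ q)%:E * \int[leb]_x (`|v j x| `^ q)%:E))%E).
  by apply: lee_wpmul2l => //; rewrite lee_fin powR_ge0.
by rewrite muleA -EFinM -powRM// mulVf ?gt_eqF// powR1 mul1e.
Qed.

End local_difference_quotient.

Lemma ler_young {R : realType} (x y q : R) : 0 <= x -> 0 <= y -> 1 < q ->
  x * y <= x `^ (q / (q - 1)) + y `^ q.
Proof.
move=> x0 y0 q1; have q10 : 0 < q - 1 by rewrite subr_gt0.
have q0 : 0 < q by lra.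
have c0 : 0 < q / (q - 1) by exact: divr_gt0.
have c1 : 1 <= q / (q - 1) by rewrite ler_pdivlMr//; lra.
have e : (q / (q - 1))^-1 + q^-1 = 1 by field; rewrite !gt_eqF.
apply: (le_trans (conjugate_powR x0 y0 c0 q0 e)); apply: lerD.
  by rewrite ler_pdivrMr// ler_peMr// powR_ge0.
by rewrite ler_pdivrMr// ler_peMr ?powR_ge0// ltW.
Qed.

(** * The pointwise inequality behind the Caccioppoli estimate *)

Section pointwise_estimate.
Context {R : realType} {N : nat}.
Variables (p : 'I_N -> R) (g : 'I_N -> R -> R) (C delta P chi M Z : R) (j : 'I_N).
Hypotheses (p2 : forall i, 2 <= p i) (pP : forall i, p i <= P) (C2g : forall i, C2 (g i))
  (C1 : 1 <= C) (gg : forall i, growth C delta (p i) (g i)) (chi1 : 1 < chi)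
  (M1 : 1 <= M) (Z0 : 0 <= Z).
Local Notation rate := (Num.min (p j / P + p j / 2 * (chi - 1)) 1).

(** [a] and [b] stand for the gradients at x and at x + h e_j, and the two real arguments for the
    difference quotients of u and f; p_j / (p_j - 1) is the conjugate exponent of p_j. Along a
    translation its integral is bounded independently of h. *)
Definition estimate_density (a b : 'I_N -> R) (x y : R) :=
  \sum_(i < N) (`|a i| `^ (p i * chi) + `|b i| `^ (p i * chi)) +
    (`|x| `^ (p j * chi) + `|y| `^ (p j / (p j - 1)) + 1).

(** The first two terms on the right are the difference of the two Euler-Lagrange integrands, whose
    integral vanishes; what remains carries the power of h to be proved. *)
Lemma pointwise_estimate : exists2 K, 0 <= K & forall (a b z' : 'I_N -> R) (z dU dF h : R),
  `|z| <= Z -> (forall i, `|z' i| <= Z) -> `|dU| <= M -> 0 < h -> h <= 1 ->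
  \sum_(i < N) (z ^+ 2 * (Vfun (g i) (b i) - Vfun (g i) (a i)) ^+ 2 / 2) <=
    \sum_(i < N) ((derive1 (g i) (b i) - derive1 (g i) (a i)) *
      (z ^+ 2 * (b i - a i) + 2 * z * z' i * dU)) + dF * (z ^+ 2 * dU)
    + K * h `^ (2 * rate) * estimate_density a b (dU / h) (dF / h).
Proof.
have addL (t1 t2 t3 t4 : R) : 0 <= t2 + t4 -> t1 + t3 <= t1 + t2 + (t3 + t4) by move=> ?; lra.
have /boolp.choice[k kP] : forall i, exists k, 0 <= k /\ forall a d h, 0 <= a -> 0 <= d ->
    d <= M -> 0 < h -> h <= 1 -> a `^ (p i - 2) * d ^+ 2 <=
    k * h `^ (2 * rate) * (a `^ (p i * chi) + (d / h) `^ (p j * chi) + 1).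
  by move=> i; have [k k0 H] := powR_interpolation (p2 i) (pP i) (p2 j) chi1 M1; exists k.
(* The 2 of [integrand_caccioppoli] times 6, a generous count of the terms left when each of the
   three summands of [growth_bound] is interpolated; Z bounds the gradient of the cutoff and C comes
   from the growth condition. *)
pose c i := 12 * Z ^+ 2 * C * k i.
have C0 : 0 <= C by exact: le_trans C1.
have c0 i : 0 <= c i by have [k0 _] := kP i; rewrite !mulr_ge0// sqr_ge0.
exists (\sum_(i < N) c i + Z ^+ 2) => [|a b z' z dU dF h zZ z'Z dM h0 h1].
  by rewrite addr_ge0 ?sqr_ge0// sumr_ge0.
set D := estimate_density _ _ _ _; set H := h `^ _.
pose x := `|dU / h| `^ (p j * chi); pose y := `|dF / h| `^ (p j / (p j - 1)).
have x0 : 0 <= x by exact: powR_ge0.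
have y0 : 0 <= y by exact: powR_ge0.
have H0 : 0 <= H by exact: powR_ge0.
have s0 i : 0 <= `|a i| `^ (p i * chi) + `|b i| `^ (p i * chi) by rewrite addr_ge0// powR_ge0.
have DE : D = \sum_(i < N) (`|a i| `^ (p i * chi) + `|b i| `^ (p i * chi)) + (x + y + 1) by [].
have xyD : x + y + 1 <= D by rewrite DE lerDr sumr_ge0.
have siD i : `|a i| `^ (p i * chi) + `|b i| `^ (p i * chi) + (x + y + 1) <= D.
  by rewrite DE lerD2r (bigD1 i)//= lerDl sumr_ge0.
have pj2 := p2 j.
have dh : `|dU / h| = `|dU| / h by rewrite normrM normfV (gtr0_norm h0).
(* The term with f is of order h ^ 2, admissible because the rate is capped at 1. *)
have hH : h ^+ 2 <= H.
  rewrite -powR_mulrn ?(ltW h0)// /H; apply: ger_powR; first by rewrite h0 h1.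
  by rewrite -[leRHS]mulr1 ler_pM2l// ge_min lexx orbT.
have yo : `|dF / h| * `|dU / h| <= y + `|dU / h| `^ p j.
  by apply: ler_young => //; lra.
have xp : `|dU / h| `^ p j <= x + 1.
  have [u1|u1] := leP 1 `|dU / h|.
    apply: (@le_trans _ _ x); last by rewrite lerDl.
    have pc : p j <= p j * chi by rewrite -[leLHS]mulr1 ler_pM2l ?(ltW chi1)//; lra.
    exact: ler_powR.
  apply: (@le_trans _ _ 1); last by rewrite lerDr.
  by apply: powR_le1; rewrite ?(ltW u1)//; lra.
have xE : `|dU / h| `^ (p j * chi) = x by [].
have HE : h `^ (2 * rate) = H by [].
clearbody x y H D.
have termi i : z ^+ 2 * (Vfun (g i) (b i) - Vfun (g i) (a i)) ^+ 2 / 2 <=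
    (derive1 (g i) (b i) - derive1 (g i) (a i)) * (z ^+ 2 * (b i - a i) + 2 * z * z' i * dU)
    + c i * H * D.
  have Ca := integrand_caccioppoli (C2g i) (gg i) C1 (p2 i) (a i) (b i) z (z' i) dU.
  have [k0 ki] := kP i.
  have n0 := normr_ge0.
  have ka := ki `|a i| `|dU| h (n0 _ _ _) (n0 _ _ _) dM h0 h1.
  have kb := ki `|b i| `|dU| h (n0 _ _ _) (n0 _ _ _) dM h0 h1.
  (* The constant summand of [growth_bound] is interpolated as the power of the base 1. *)
  have k1 := ki 1 `|dU| h ler01 (n0 _ _ _) dM h0 h1.
  have one q : 1 `^ q = 1 :> R by rewrite powR1.
  rewrite !one mul1r -dh xE HE in k1; rewrite -dh xE HE in ka; rewrite -dh xE HE in kb.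
  have kH : 0 <= k i * H by rewrite mulr_ge0.
  have pa : 0 <= `|a i| `^ (p i * chi) by exact: powR_ge0.
  have pb : 0 <= `|b i| `^ (p i * chi) by exact: powR_ge0.
  have G : dU ^+ 2 * growth_bound C (p i) (a i) (b i) <= 6 * C * (k i * H * D).
    rewrite -(real_normK (num_real dU)) /growth_bound.
    have : k i * H * (`|a i| `^ (p i * chi) + `|b i| `^ (p i * chi) + (x + y + 1)) <= k i * H * D.
      exact: ler_wpM2l.
    have : k i * H * (x + y + 1) <= k i * H * D by exact: ler_wpM2l.
    have kx : 0 <= k i * H * x by rewrite mulr_ge0.
    have ky : 0 <= k i * H * y by rewrite mulr_ge0.
    have kpa := mulr_ge0 kH pa; have kpb := mulr_ge0 kH pb.
    move=> e1 e2.
    have e3 : `|dU| ^+ 2 * (`|a i| `^ (p i - 2) + `|b i| `^ (p i - 2) + 1) <= 6 * (k i * H * D).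
      rewrite !mulrDr in e1 e2 ka kb k1 *.
      move: (k i * H * D) (k i * H * x) (k i * H * y) (k i * H * _) (k i * H * _) e1 e2 ka kb k1
        kx ky kpa kpb => t1 t2 t3 t4 t5 e1 e2.
      by rewrite mulrC [X in _ + X + _ <= _]mulrC mulr1; lra.
    by rewrite mulrCA -mulrA [X in _ <= X]mulrCA ler_wpM2l.
  have z2 : (z' i) ^+ 2 <= Z ^+ 2.
    by rewrite -(real_normK (num_real (z' i))) ler_sqr ?nnegrE.
  have G2 : 2 * (z' i) ^+ 2 * dU ^+ 2 * growth_bound C (p i) (a i) (b i) <= c i * H * D.
    have g0 : 0 <= dU ^+ 2 * growth_bound C (p i) (a i) (b i).
      by rewrite mulr_ge0 ?sqr_ge0// growth_bound_ge0.
    have := ler_pM (sqr_ge0 _) g0 z2 G.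
    rewrite /c; set t := growth_bound _ _ _ _; lra.
  lra.
have termF : 0 <= dF * (z ^+ 2 * dU) + Z ^+ 2 * H * D.
  have z2 : z ^+ 2 <= Z ^+ 2 by rewrite -(real_normK (num_real z)) ler_sqr ?nnegrE.
  have e1 : `|dF * (z ^+ 2 * dU)| = z ^+ 2 * (h ^+ 2 * (`|dF / h| * `|dU / h|)).
    rewrite (normrM dF (z ^+ 2 * dU)) (normrM (z ^+ 2) dU) (ger0_norm (sqr_ge0 z)).
    rewrite (normrM dF h^-1) dh normfV (gtr0_norm h0).
    by field; rewrite gt_eqF.
  have e2 : `|dF * (z ^+ 2 * dU)| <= Z ^+ 2 * (H * D).
    have q1 : 0 <= `|dF / h| * `|dU / h| by exact: mulr_ge0.
    have q2 : `|dF / h| * `|dU / h| <= D.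
      by apply: (le_trans yo); apply: le_trans xyD; rewrite [x + y]addrC -addrA lerD2l.
    rewrite e1; apply: ler_pM z2 (ler_pM (sqr_ge0 h) q1 hH q2); first exact: sqr_ge0.
    exact: mulr_ge0 (sqr_ge0 h) q1.
  rewrite -lerBlDl sub0r -mulrA; apply: le_trans e2; rewrite -normrN; exact: ler_norm.
have := ler_sum (index_enum _) (fun i (_ : true) => termi i).
rewrite big_split/= -!mulr_suml => /le_trans; apply.
by rewrite (mulrDl _ _ H) (mulrDl _ _ D); exact: addL.
Qed.

End pointwise_estimate.

(** * The integrated estimate of the increments *)

Section nirenberg.
Context {R : realType} {N : nat}.
Local Notation leb := (lebesgue_rV N).
Local Notation X := 'rV[R]_N.
Variables (E : set X) (d r : R) (p : 'I_N -> R) (g : 'I_N -> R -> R) (C delta P chi M : R).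
Variables (j : 'I_N) (U F : X -> R) (a DF : 'I_N -> X -> R).
Local Notation T s := (thickening E (s * d)).
Hypotheses (mE : measurable E) (d0 : 0 < d) (Tr : forall x, T 10 x -> `|x| <= r).
Hypotheses (p2 : forall i, 2 <= p i) (pP : forall i, p i <= P) (C2g : forall i, C2 (g i))
  (C1 : 1 <= C) (gg : forall i, growth C delta (p i) (g i)) (chi1 : 1 < chi)
  (M1 : 1 <= M) (UM : forall x, `|U x| <= M).
Hypotheses (IU : leb.-integrable setT (EFin \o U))
  (Ia : forall i, leb.-integrable setT (EFin \o a i))
  (wU : forall i, weak_deriv (T 10) i U (a i))
  (pa : forall i, powR_integrable (p i) (a i))
  (pchi : forall i, powR_integrable (p i * chi) (a i))
  (IF : leb.-integrable setT (EFin \o F))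
  (IDF : forall i, leb.-integrable setT (EFin \o DF i))
  (wF : forall i, weak_deriv (T 10) i F (DF i))
  (pDF : powR_integrable (p j / (p j - 1)) (DF j)).
Hypothesis EL : forall (w : X -> R) (v : 'I_N -> X -> R) (B : R),
  (forall x, w x != 0 -> T 5 x) -> (forall i x, v i x != 0 -> T 5 x) ->
  leb.-integrable setT (EFin \o w) -> (forall i, leb.-integrable setT (EFin \o v i)) ->
  (forall i, weak_deriv setT i w (v i)) -> (forall x, `|w x| <= B) ->
  (forall i, powR_integrable (p i) (v i)) ->
  [/\ forall i, leb.-integrable setT (EFin \o (fun x => derive1 (g i) (a i x) * v i x)),
      leb.-integrable setT (EFin \o (fun x => F x * w x)) &
      \sum_(i < N) \int[leb]_x (derive1 (g i) (a i x) * v i x) + \int[leb]_x (F x * w x) = 0].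
Local Notation rate := (Num.min (p j / P + p j / 2 * (chi - 1)) 1).

Let m4 : measurable (T 4). Proof. exact: measurable_thickening. Qed.

Let mU : measurable_fun setT U := integrable_measurable IU.
Let mF : measurable_fun setT F := integrable_measurable IF.
Let ma i : measurable_fun setT (a i) := integrable_measurable (Ia i).

Let leb4 : (leb (T 4) < +oo)%E.
Proof.
apply: le_lt_trans (@lebesgue_rV_nball R N r); apply: le_measure; rewrite ?inE//.
  exact: measurable_nball.
by move=> x /(thickening_mono (l := 10) d0) H; apply: Tr; apply: H; lra.
Qed.

Let density (e : X) (h : R) x := estimate_density p chi j (a^~ x) (a^~ (x + e))
  ((U (x + e) - U x) / h) ((F (x + e) - F x) / h).

(** Translation invariance handles the shifted gradient, and [local_scaled_difference_le] bounds the
    difference quotients of U and F by their weak derivatives, integrable to exactly the powers p_j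
    chi and p_j / (p_j - 1). *)
Let density_integrable : exists2 B : R, 0 <= B & forall h : R, h != 0 -> `|h| <= d ->
  leb.-integrable (T 4) (EFin \o density (h *: basis j) `|h|) /\
  \int[leb]_(x in T 4) density (h *: basis j) `|h| x <= B.
Proof.
pose A i := \int[leb]_x (`|a i x| `^ (p i * chi)).
pose FF := \int[leb]_x (`|DF j x| `^ (p j / (p j - 1))).
have A0 i : 0 <= A i by apply: Rintegral_ge0 => x _; exact: powR_ge0.
have F0 : 0 <= FF by apply: Rintegral_ge0 => x _; exact: powR_ge0.
have l0 : 0 <= fine (leb (T 4)) by rewrite fine_ge0.
exists (\sum_(i < N) (A i + A i) + (A j + FF + fine (leb (T 4)))) => [|h h0 hd].
  have S0 : 0 <= \sum_(i < N) (A i + A i) by apply: sumr_ge0 => i _; exact: addr_ge0 (A0 i) (A0 i).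
  exact: addr_ge0 S0 (addr_ge0 (addr_ge0 (A0 j) F0) l0).
set e : X := h *: basis j.
have pc1 i : 1 <= p i * chi.
  by apply: (@le_trans _ _ (p i)); [apply: le_trans (p2 i);
    rewrite ler1n|rewrite ler_peMr ?(ltW chi1)// (le_trans _ (p2 i))].
have q1 : 1 <= p j / (p j - 1).
  have := p2 j => pj; rewrite ler_pdivlMr; lra.
have H1 i : leb.-integrable (T 4) (EFin \o (fun x => `|a i x| `^ (p i * chi))) /\
    \int[leb]_(x in T 4) `|a i x| `^ (p i * chi) <= A i.
  have [_ I] := pchi i.
  apply: ge0_Rintegral_le => //.
  - by apply: measurable_normr_powR; exact: measurable_funTS.
  rewrite /A EFin_Rintegral//; apply: ge0_subset_integral => //.
  by apply/measurable_EFinP; exact: measurable_normr_powR.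
have H2 i : leb.-integrable (T 4) (EFin \o (fun x => `|a i (x + e)| `^ (p i * chi))) /\
    \int[leb]_(x in T 4) `|a i (x + e)| `^ (p i * chi) <= A i.
  have [_ I] := pchi i.
  have m1 : measurable_fun setT (fun x : X => `|a i (x + e)| `^ (p i * chi)).
    by apply: measurable_normr_powR; exact: (measurable_fun_shift e (ma i)).
  apply: ge0_Rintegral_le => //.
  - exact: measurable_funTS.
  rewrite /A EFin_Rintegral//.
  rewrite -(ge0_integral_shift e (F := fun x => (`|a i x| `^ (p i * chi))%:E)).
  - apply: ge0_subset_integral => //; exact/measurable_EFinP.
  - by apply/measurable_EFinP; exact: measurable_normr_powR.
  - by move=> x; rewrite lee_fin powR_ge0.
have H3 : leb.-integrable (T 4) (EFin \o (fun x => `|(U (x + e) - U x) / `|h| | `^ (p j * chi))) /\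
    \int[leb]_(x in T 4) (`|(U (x + e) - U x) / `|h| | `^ (p j * chi)) <= A j.
  have [_ I] := pchi j.
  apply: ge0_Rintegral_le => //.
  - apply: measurable_normr_powR; apply: measurable_funTS; apply: measurable_funM => //.
    by apply: measurable_funB => //; exact: (measurable_fun_shift e mU).
  rewrite /A EFin_Rintegral//; exact: (local_scaled_difference_le d0 Tr).
have H4 : leb.-integrable (T 4) (EFin \o (fun x => `|(F (x + e) - F x) / `|h| | `^ (p j / (p j -
  1)))) /\
    \int[leb]_(x in T 4) (`|(F (x + e) - F x) / `|h| | `^ (p j / (p j - 1))) <= FF.
  have [_ I] := pDF.
  apply: ge0_Rintegral_le => //.
  - apply: measurable_normr_powR; apply: measurable_funTS; apply: measurable_funM => //.
    by apply: measurable_funB => //; exact: (measurable_fun_shift e mF).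
  rewrite /FF EFin_Rintegral//; exact: (local_scaled_difference_le d0 Tr).
have I1 : leb.-integrable (T 4) (EFin \o (fun=> 1 : R)).
  by apply: ge0_integrable_lty => //; rewrite (integral_cst leb m4 1%E) mul1e.
have R1 : \int[leb]_(x in T 4) (1 : R) = fine (leb (T 4)).
  by rewrite /Rintegral (integral_cst leb m4 1%E) mul1e.
have Is i := integrable_addr m4 (proj1 (H1 i)) (proj1 (H2 i)).
have Ip := integrable_addr m4 (integrable_addr m4 (proj1 H3) (proj1 H4)) I1.
have Iss := integrable_sumr (index_enum 'I_N) m4 Is.
split; first exact: (integrable_addr m4 Iss Ip).
rewrite /density /estimate_density (RintegralD m4 Iss Ip).
rewrite (RintegralD m4 (integrable_addr m4 (proj1 H3) (proj1 H4)) I1) (RintegralD m4 (proj1 H3)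
  (proj1 H4)) R1.
rewrite (Rintegral_sumr _ m4 Is); apply: lerD.
  apply: ler_sum => i _; rewrite (RintegralD m4 (proj1 (H1 i)) (proj1 (H2 i))).
  by apply: lerD; [have [] := H1 i|have [] := H2 i].
by apply: lerD => //; apply: lerD; [have [] := H3|have [] := H4].
Qed.

(* The cutoff function [zeta] and the test function [eta] live in [T 4], and the
   translate [eta'] of [eta] in [T 5]. *)
Lemma nirenberg_estimate : exists2 B : R, 0 <= B & forall (h : R) i, h != 0 -> `|h| <= d ->
  `|h| <= 1 ->
  (\int[leb]_(x in E) ((Vfun (g i) (a i (x + h *: basis j)) - Vfun (g i) (a i x)) ^+ 2)%:E
    <= (B * `|h| `^ (2 * rate))%:E)%E.
Proof.
(* The neighbourhood of radius 0 is empty, so E is first enlarged by d / 2; the cutoff then fits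
   since 1 / 2 + 3 < 4. *)
have [zeta [tz z1]] : exists zeta : X -> R, test_function (T 4) zeta /\
    forall y v, T 2^-1 y -> `|v| < d -> zeta (y + v) = 1.
  by apply: (cutoff_thickening d0 Tr); lra.
have zE x : E x -> zeta x = 1.
  move=> Ex; rewrite -[x]addr0; apply: z1; last by rewrite normr0.
  by apply: subset_thickening Ex; rewrite mulr_gt0.
have sz := test_function_smooth tz.
have tp i := test_function_partial i tz.
have [Z Z0 zZ] : exists2 Z : R, 0 <= Z & forall x, `|zeta x| <= Z /\ forall i, `|partial i zeta
  x| <= Z.
  have [Z0 Z00 H0] := test_function_bounded tz.
  have /boolp.choice[Zi ZiP] : forall i, exists Z, 0 <= Z /\ forall x, `|partial i zeta x| <= Z.
    by move=> i; have [Z ZZ H] := test_function_bounded (tp i); exists Z.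
  have S0 : 0 <= \sum_(i < N) Zi i by apply: sumr_ge0 => i _; have [] := ZiP i.
  exists (Z0 + \sum_(i < N) Zi i) => [|x]; first exact: addr_ge0.
  split=> [|i]; first by rewrite (le_trans (H0 x))// lerDl.
  have [_ H] := ZiP i; rewrite (le_trans (H x))// (bigD1 i)//= addrCA lerDl addr_ge0//.
  by apply: sumr_ge0 => k _; have [] := ZiP k.
(* The interpolation is applied to increments of U, which are bounded by 2 M. *)
have M2 : 1 <= 2 * M.
  by apply: (le_trans M1); rewrite ler_peMl ?ler1n// (le_trans ler01).
have [K K0 KP] := @pointwise_estimate R N p g C delta P chi (2 * M) Z j p2 pP C2g C1 gg chi1 M2 Z0.
have [B B0 BP] := density_integrable.
exists (2 * (K * B)) => [|h i0 h0 hd h1]; first by rewrite !mulr_ge0.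
have hp : 0 < `|h| by rewrite normr_gt0.
have [ID DB] := BP h h0 hd.
set e : X := h *: basis j in ID DB *.
have ed : `|e| <= d by rewrite /e normrZ norm_basis mulr1.
pose dU x := U (x + e) - U x; pose da i x := a i (x + e) - a i x.
have IdU : leb.-integrable setT (EFin \o dU).
  by apply: integrable_subr => //; exact: (integrable_shift e IU).
have Ida i : leb.-integrable setT (EFin \o da i).
  by apply: integrable_subr => //; exact: (integrable_shift e (Ia i)).
have T410 : T 4 `<=` T 10 by apply: (thickening_mono d0); lra.
have T45 : T 4 `<=` T 5 by apply: (thickening_mono d0); lra.
have wdU i : weak_deriv (T 4) i dU (da i).
  apply: weak_derivB => //; [exact: (integrable_shift e IU)|exact: (integrable_shift e (Ia i))| |].
    apply: weak_deriv_shift (wU i) => // x Tx; apply: (thickening_move d0 _ Tx ed); lra.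
  exact: weak_deriv_subset (wU i).
pose z2 x := zeta x * zeta x.
have tz2 : test_function (T 4) z2 by exact: test_functionM.
have tp2 i := test_function_partial i tz2.
have pz2 i x : partial i z2 x = zeta x * partial i zeta x + zeta x * partial i zeta x.
  by rewrite /z2 partialM.
pose eta x := z2 x * dU x; pose etai i x := z2 x * da i x + partial i z2 x * dU x.
have weta i : weak_deriv setT i eta (etai i) := @weak_derivM R N (T 4) setT i _ _ _ IdU (Ida i)
  tz2 (wdU i).
have Ieta : leb.-integrable setT (EFin \o eta).
  have := integrable_test_functionM tz2 IdU.
  by congr (leb.-integrable _ _); apply/funext => x /=; rewrite mulrC.
have Ietai i : leb.-integrable setT (EFin \o etai i).
  have := integrable_addr measurableT (integrable_test_functionM tz2 (Ida i))
    (integrable_test_functionM (tp2 i) IdU).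
  by congr (leb.-integrable _ _); apply/funext => x /=; rewrite /etai mulrC [X in _ + X]mulrC.
have dUM x : `|dU x| <= 2 * M.
  rewrite (le_trans (ler_normB _ _))//; have := UM (x + e); have := UM x; lra.
have z2Z x : `|z2 x| <= Z * Z by rewrite normrM ler_pM//; have [] := zZ x.
have etaB x : `|eta x| <= Z * Z * (2 * M) by rewrite normrM ler_pM.
have eta0 x : ~ T 4 x -> eta x = 0 by move=> Tx; rewrite /eta (test_function_eq0 tz2)// mul0r.
have etai0 i x : ~ T 4 x -> etai i x = 0.
  by move=> Tx; rewrite /etai (test_function_eq0 tz2)// (test_function_eq0 (tp2 i))// !mul0r addr0.
have etaT x : eta x != 0 -> T 4 x by move=> /eqP ex; apply: contrapT => /eta0.
have etaiT i x : etai i x != 0 -> T 4 x by move=> /eqP ex; apply: contrapT => /(etai0 i).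
have mz2 : measurable_fun setT z2 := test_function_measurable tz2.
have mdU : measurable_fun setT dU := integrable_measurable IdU.
have pp i : 0 < p i by rewrite (lt_le_trans _ (p2 i)).
have petai i : powR_integrable (p i) (etai i).
  have p0 := ltW (pp i).
  apply: powR_integrableD => //.
    apply: (powR_integrableM p0 _ mz2 z2Z).
    have -> : da i = fun x => a i (x + e) + (-1) * a i x by apply/funext => x; rewrite mulN1r.
    apply: powR_integrableD => //; first exact: powR_integrable_shift.
    by apply: (@powR_integrableM _ _ _ 1) => // x; rewrite normrN1.
  have [Y _ YP] := test_function_bounded (tp2 i).
  apply: (@powR_integrable_bounded _ _ _ (Y * (2 * M)) r) => //.
  - by apply: measurable_funM => //; exact: test_function_measurable (tp2 i).
  - by move=> x; rewrite normrM ler_pM.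
  - move=> x; rewrite ltNge => /negP xr; rewrite (test_function_eq0 (tp2 i)) ?mul0r// => Tx.
    by apply: xr; apply: Tr; exact: T410.
have [I1 J1 S1] := EL (fun x ex => T45 x (etaT x ex)) (fun i x ex => T45 x (etaiT i x ex))
  Ieta Ietai weta etaB petai.
pose eta' x := eta (x - e); pose etai' i x := etai i (x - e).
have T45' x : T 4 (x - e) -> T 5 x.
  move=> Tx; have -> : x = x - e + e by rewrite subrK.
  by apply: (thickening_move d0 _ Tx ed); lra.
have [I2 J2 S2] := EL (w := eta') (v := etai') (fun x ex => T45' x (etaT _ ex))
  (fun i x ex => T45' x (etaiT i _ ex)) (integrable_shift (- e) Ieta)
  (fun i => integrable_shift (- e) (Ietai i))
  (fun i => @weak_deriv_shift R N setT setT i _ _ (- e) (fun x _ => I) Ieta (Ietai i) (weta i))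
  (fun x => etaB (x - e)) (fun i => powR_integrable_shift (- e) (petai i)).
have I2' i : leb.-integrable setT (EFin \o (fun x => derive1 (g i) (a i (x + e)) * etai i x)).
  have := integrable_shift e (I2 i); congr (leb.-integrable _ _).
  by apply/funext => x /=; rewrite /etai' addrK.
have J2' : leb.-integrable setT (EFin \o (fun x => F (x + e) * eta x)).
  have := integrable_shift e J2; congr (leb.-integrable _ _).
  by apply/funext => x /=; rewrite /eta' addrK.
have {}S2 : \sum_(i < N) \int[leb]_x (derive1 (g i) (a i (x + e)) * etai i x)
    + \int[leb]_x (F (x + e) * eta x) = 0.
  rewrite -[RHS]S2; congr (_ + _).
    apply: eq_bigr => i _; rewrite -[RHS](Rintegral_shift e);
      last exact: integrable_measurable (I2 i).
    by apply: eq_Rintegral => x _; rewrite /etai' addrK.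
  rewrite -[RHS](Rintegral_shift e); last exact: integrable_measurable J2.
  by apply: eq_Rintegral => x _; rewrite /eta' addrK.
pose q i x := (derive1 (g i) (a i (x + e)) - derive1 (g i) (a i x)) * etai i x.
pose qF x := (F (x + e) - F x) * eta x.
pose Q x := \sum_(i < N) q i x + qF x.
have Iq i : leb.-integrable setT (EFin \o q i).
  have := integrable_subr measurableT (I2' i) (I1 i).
  by congr (leb.-integrable _ _); apply/funext => x /=; rewrite /q mulrBl.
have IqF : leb.-integrable setT (EFin \o qF).
  have := integrable_subr measurableT J2' J1.
  by congr (leb.-integrable _ _); apply/funext => x /=; rewrite /qF mulrBl.
have Iqs := integrable_sumr (index_enum 'I_N) measurableT Iq.
have IQ : leb.-integrable setT (EFin \o Q) by exact: (integrable_addr measurableT Iqs IqF).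
have IQ4 : leb.-integrable (T 4) (EFin \o Q) by exact: integrableS IQ.
have sum0 (s t s' t' : R) : s + t = 0 -> s' + t' = 0 -> s - s' + (t - t') = 0.
  by move=> e1 e2; rewrite addrACA -opprD e1 e2 subr0.
(* Both equations are integrals over the whole space, while the density is known to be integrable
   only on T 4; Q vanishes outside of it. *)
have Q0 : \int[leb]_(x in T 4) Q x = 0.
  have -> : \int[leb]_(x in T 4) Q x = \int[leb]_x Q x.
    apply/esym; apply: Rintegral_eq_on => //; try exact: integrable_measurable IQ4.
      exact: aeW.
    move=> x _ Tx; rewrite /Q /qF eta0// mulr0 addr0 big1// => i _.
    by rewrite /q etai0// mulr0.
  rewrite /Q (RintegralD measurableT Iqs IqF) (Rintegral_sumr _ measurableT Iq).
  have -> : \int[leb]_x qF x = \int[leb]_x (F (x + e) * eta x) - \int[leb]_x (F x * eta x).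
    by rewrite -RintegralB//; apply: eq_Rintegral => x _; rewrite /qF mulrBl.
  have -> : \sum_(i < N) \int[leb]_x q i x =
      \sum_(i < N) \int[leb]_x (derive1 (g i) (a i (x + e)) * etai i x) -
      \sum_(i < N) \int[leb]_x (derive1 (g i) (a i x) * etai i x).
    rewrite -sumrB; apply: eq_bigr => i _.
    by rewrite -RintegralB//; apply: eq_Rintegral => x _; rewrite /q mulrBl.
  exact: sum0 S2 S1.
pose H := `|h| `^ (2 * rate).
have H0 : 0 <= H by exact: powR_ge0.
pose dV i x := Vfun (g i) (a i (x + e)) - Vfun (g i) (a i x).
have main x : zeta x ^+ 2 * dV i0 x ^+ 2 <= 2 * (Q x + K * H * density e `|h| x).
  have [zx pzx] := zZ x.
  have := KP (a^~ x) (a^~ (x + e)) (fun i => partial i zeta x) (zeta x) (dU x) (F (x + e) - F x)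
    `|h|
    zx pzx (dUM x) hp h1.
  have e1 : \sum_(i < N) (derive1 (g i) (a i (x + e)) - derive1 (g i) (a i x)) *
      (zeta x ^+ 2 * (a i (x + e) - a i x) + 2 * zeta x * partial i zeta x * dU x) = \sum_(i < N)
        q i x.
    apply: eq_bigr => i _; rewrite /q /etai pz2 /z2 /da; congr (_ * _); ring.
  have e2 : (F (x + e) - F x) * (zeta x ^+ 2 * dU x) = qF x by rewrite /qF /eta /z2 expr2.
  rewrite e1 e2 -/(Q x) -/H -/(density e `|h| x) => le1.
  have : zeta x ^+ 2 * dV i0 x ^+ 2 / 2 <=
      \sum_(i < N) zeta x ^+ 2 * (Vfun (g i) (a i (x + e)) - Vfun (g i) (a i x)) ^+ 2 / 2.
    rewrite (bigD1 i0)//= lerDl sumr_ge0// => i _.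
    by rewrite divr_ge0// mulr_ge0// sqr_ge0.
  move=> /le_trans /(_ le1) {le1}; rewrite ler_pdivrMr//; congr (_ <= _); exact: mulrC.
have mV i : measurable_fun setT (Vfun (g i)).
  apply: continuous_measurable_fun.
  exact: is_derive_continuous (Vfun_is_derive (C2g i)).
have mdV : measurable_fun setT (fun x => dV i0 x ^+ 2).
  apply: measurable_funX; apply: measurable_funB; apply: (measurableT_comp (mV _)) => //.
  exact: (measurable_fun_shift e (ma i0)).
have mz : measurable_fun setT (fun x => zeta x ^+ 2 * dV i0 x ^+ 2).
  by apply: measurable_funM => //; apply: measurable_funX; exact: test_function_measurable tz.
have IKD := integrable_scaler (K * H) m4 ID.
have IR := integrable_scaler 2 m4 (integrable_addr m4 IQ4 IKD).
have ET : E `<=` T 4 by apply: subset_thickening; rewrite mulr_gt0.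
apply: (@le_trans _ _ (\int[leb]_(x in T 4) (zeta x ^+ 2 * dV i0 x ^+ 2)%:E)%E).
  rewrite (eq_integral (fun x : X => (zeta x ^+ 2 * dV i0 x ^+ 2)%R%:E)); last first.
    by move=> x /set_mem Ex; rewrite zE// expr1n mul1r.
  apply: ge0_subset_integral => //; last by move=> x _; rewrite lee_fin mulr_ge0// sqr_ge0.
  by apply/measurable_EFinP; exact: measurable_funTS.
apply: (@le_trans _ _ (\int[leb]_(x in T 4) (2 * (Q x + K * H * density e `|h| x))%:E)%E).
  apply: ge0_le_integral => //.
  - by move=> x _; rewrite lee_fin mulr_ge0// sqr_ge0.
  - by apply/measurable_EFinP; exact: measurable_funTS.
  - by apply/measurable_EFinP; exact: integrable_measurable IR.
  - by move=> x _; rewrite lee_fin.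
rewrite -EFin_Rintegral// lee_fin (RintegralZl _ m4 (integrable_addr m4 IQ4 IKD)).
rewrite (RintegralD m4 IQ4 IKD) Q0 add0r (RintegralZl _ m4 ID) -/H.
rewrite (_ : 2 * (K * B) * H = 2 * (K * H * B)); last by ring.
by apply: ler_wpM2l => //; apply: ler_wpM2l DB; exact: mulr_ge0.
Qed.

End nirenberg.

(** * Finiteness of the Nikolskii seminorm *)

Section seminorm.
Context {R : realType} {N : nat}.
Local Notation leb := (lebesgue_rV N).
Local Notation X := 'rV[R]_N.
Implicit Types (E : set X) (psi : X -> R).

(** By compactness of [0, 1], having the whole segment in E persists under small displacements of x.
    Openness gives the measurability of the set. *)
Lemma open_segment_in E (v : X) : open E -> open (segment_in E v).
Proof.
move=> oE; rewrite openE => x [Ex sx].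
have cK : compact `[(0 : R), 1]%classic by exact: segment_compact.
have H : \forall y \near x, `[(0 : R), 1]%classic `<=` [set s | E (y + s *: v)].
  move: cK => /compact_near_coveringP cv.
  apply: (cv _ (nbhs x) (fun y s => E (y + s *: v))) => s /=; rewrite in_itv/= => s01.
  have : (fun z : R * X => z.2 + z.1 *: v) @ (s, x) --> x + s *: v.
    apply: cvgD; first exact: cvg_snd.
    by apply: cvgZr_tmp; exact: cvg_fst.
  by apply; apply: open_nbhs_nbhs; split => //; exact: sx.
apply: filterS H => y Hy; split=> [|s s01]; last by apply: (Hy s); rewrite /= in_itv.
by have := Hy 0; rewrite /= scale0r addr0 in_itv/= lexx ler01; exact.
Qed.

(** The supremum runs over all h, the estimate only over |h| <= h0. For larger h the weight |h| ^
    (-2 t) is at most h0 ^ (-2 t), and the L^2 norm of psi bounds that of its increments. *)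
Lemma nikolskii_seminorm_lty E psi (t B h0 : R) (j : 'I_N) : open E -> Lp 2%:E E psi ->
  0 <= t -> 0 <= B -> 0 < h0 ->
  (forall h, h != 0 -> `|h| <= h0 ->
    (\int[leb]_(x in segment_in E (h *: basis j)) ((psi (x + h *: basis j) - psi x) ^+ 2)%:E <=
     (B * `|h| `^ (2 * t))%:E)%E) ->
  (nikolskii_seminorm t 2%:E j E psi < +oo)%E.
Proof.
move=> oE Lpsi t0 B0 h00 H.
have mE : measurable E by exact: open_measurable_row.
have [mpsi fpsi] := (LpP _ (ltr0n R 2) mE).1 Lpsi.
pose W : X -> R := psi \_ E.
have mW : measurable_fun setT W by exact/(measurable_restrictT _ mE).
pose I := \int[leb]_x W x ^+ 2.
have IW : leb.-integrable setT (EFin \o (fun x => W x ^+ 2)).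
  apply: ge0_integrable_lty => //.
  - exact: measurable_funX.
  - by move=> x _; exact: sqr_ge0.
  move: fpsi; rewrite -integral_powR_restrict//; apply: le_lt_trans.
  rewrite le_eqVlt; apply/orP; left; apply/eqP; apply: eq_integral => x _.
  by rewrite powR_mulrn// real_normK ?num_real.
have I0 : 0 <= I by apply: Rintegral_ge0 => x _; exact: sqr_ge0.
have c0 : 0 <= h0 `^ (- (2 * t)) by exact: powR_ge0.
(* The first summand serves |h| <= h0, the second one larger h, through (a - b) ^ 2 <= 2 a ^ 2 + 2 b
   ^ 2. *)
pose B' := B + h0 `^ (- (2 * t)) * (2 * I + 2 * I).
have B'0 : 0 <= B' by rewrite addr_ge0// mulr_ge0// addr_ge0// mulr_ge0.
apply: (@le_lt_trans _ _ (B' `^ 2^-1)%:E); last exact: ltry.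
apply: ge_ereal_sup => _ [h /= hn0 <-].
set e : X := h *: basis j; set A := segment_in E e.
have mA : measurable A by apply: open_measurable_row; exact: open_segment_in.
have hp : 0 < `|h| by rewrite normr_gt0.
have AE : A `<=` E by move=> x [].
have AE' x : A x -> E (x + e) by move=> [_ /(_ 1)]; rewrite scale1r ler01 lexx; exact.
have AW x : A x -> psi (x + e) - psi x = W (x + e) - W x.
  by move=> Ax; rewrite /W !patchE !mem_set//; [exact: AE|exact: AE'].
have mWe : measurable_fun setT (fun x : X => W (x + e)) := measurable_fun_shift e mW.
have mD : measurable_fun A (fun x => (W (x + e) - W x) ^+ 2).
  by apply: measurable_funTS; apply: measurable_funX; exact: measurable_funB.
apply: Lnorm_on_le => //.
have -> : (\int[leb]_(x in A) (`|diff_quot t j h psi x| `^ 2)%:E =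
    \int[leb]_(x in A) ((`|h| `^ (- (2 * t)))%:E * ((W (x + e) - W x) ^+ 2)%:E))%E.
  apply: eq_integral => x /set_mem Ax; rewrite /diff_quot -/e AW// -EFinM; congr (_%:E).
  rewrite powR_mulrn// real_normK ?num_real// exprMn; congr (_ * _).
  by rewrite -powR_mulrn ?powR_ge0// -powRrM mulNr mulrC.
rewrite ge0_integralZl//; last first.
- by move=> x _; rewrite lee_fin sqr_ge0.
- exact/measurable_EFinP.
have [hh|hh] := leP `|h| h0.
  apply: (@le_trans _ _ ((`|h| `^ (- (2 * t)))%:E * (B * `|h| `^ (2 * t))%:E)%E).
    apply: lee_wpmul2l; first by rewrite lee_fin powR_ge0.
    rewrite (eq_integral (fun x : X => ((psi (x + e) - psi x) ^+ 2)%R%:E)); first exact: H.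
    by move=> x /set_mem Ax; rewrite AW.
  rewrite -EFinM lee_fin mulrCA powRN mulVf ?mulr1; last by rewrite gt_eqF// powR_gt0.
  by rewrite /B' lerDl mulr_ge0// addr_ge0// mulr_ge0.
have IWe : leb.-integrable setT (EFin \o (fun x => W (x + e) ^+ 2)) := integrable_shift e IW.
have I2 := integrable_addr measurableT (integrable_scaler 2 measurableT IWe) (integrable_scaler 2
  measurableT IW).
apply: (@le_trans _ _ ((`|h| `^ (- (2 * t)))%:E * (2 * I + 2 * I)%:E)%E).
  apply: lee_wpmul2l; first by rewrite lee_fin powR_ge0.
  have -> : 2 * I + 2 * I = \int[leb]_x (2 * W (x + e) ^+ 2 + 2 * W x ^+ 2).
    rewrite (RintegralD measurableT (integrable_scaler 2 measurableT IWe) (integrable_scaler 2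
      measurableT IW)).
    rewrite (RintegralZl 2 measurableT IWe) (RintegralZl 2 measurableT IW); congr (2 * _ + _).
    by rewrite (Rintegral_shift e (F := fun x => W x ^+ 2))//; exact: measurable_funX.
  rewrite EFin_Rintegral//.
  apply: (@le_trans _ _ (\int[leb]_(x in A) (2 * W (x + e) ^+ 2 + 2 * W x ^+ 2)%:E)%E).
    apply: ge0_le_integral => //.
    - by move=> x _; rewrite lee_fin sqr_ge0.
    - exact/measurable_EFinP.
    - by apply/measurable_EFinP/measurable_funTS; exact: integrable_measurable I2.
    - move=> x _; rewrite lee_fin; have := sqr_ge0 (W (x + e) + W x); nra.
  apply: ge0_subset_integral => //.
  - by apply/measurable_EFinP; exact: integrable_measurable I2.
  - by move=> x _; rewrite lee_fin addr_ge0// mulr_ge0// sqr_ge0.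
rewrite -EFinM lee_fin; apply: (@le_trans _ _ (h0 `^ (- (2 * t)) * (2 * I + 2 * I))).
  rewrite ler_wpM2r//; first by rewrite addr_ge0// mulr_ge0.
  rewrite !powRN lef_pV2 ?posrE ?powR_gt0//; apply: ge0_ler_powR.
  - exact: mulr_ge0.
  - by rewrite nnegrE ltW.
  - by rewrite nnegrE.
  - exact: ltW.
by rewrite /B' lerDr.
Qed.

Lemma Lp_lower E psi (q s : R) : measurable E -> (leb E < +oo)%E -> 0 < q -> q <= s ->
  Lp s%:E E psi -> Lp q%:E E psi.
Proof.
move=> mE fE q0 qs; have s0 : 0 < s by exact: lt_le_trans qs.
move=> /(LpP _ s0 mE)[mpsi fpsi]; apply/(LpP _ q0 mE); split; first exact: mpsi.
have m1 := measurable_normr_powR s mpsi.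
apply: (@le_lt_trans _ _ (\int[leb]_(x in E) ((`|psi x| `^ s)%:E + 1))%E).
  apply: ge0_le_integral => //.
  - by apply/measurable_EFinP; exact: measurable_normr_powR.
  - by apply: emeasurable_funD => //; exact/measurable_EFinP.
  move=> x _; rewrite -EFinD lee_fin; have [x1|x1] := leP 1 `|psi x|.
    by rewrite (le_trans (ler_powR x1 qs))// lerDl.
  by rewrite (le_trans (powR_le1 _ (ltW x1) (ltW q0)))// lerDr powR_ge0.
rewrite ge0_integralD//; first by rewrite lte_add_pinfty// (integral_cst leb mE 1%E) mul1e.
- exact/measurable_EFinP.
Qed.

End seminorm.

Section restriction.
Context {R : realType} {N : nat}.
Local Notation leb := (lebesgue_rV N).
Local Notation X := 'rV[R]_N.
Implicit Types (S : set X) (f : X -> R).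

Lemma integrable_restrict S f : measurable S ->
  leb.-integrable S (EFin \o f) <-> leb.-integrable setT (EFin \o (f \_ S)).
Proof. by move=> mS; rewrite -restrict_EFin; exact: integrable_mkcond. Qed.

Lemma integrable_of_Vfun (g : R -> R) (C delta p chi : R) S f :
  C2 g -> growth C delta p g -> 1 <= C -> 0 <= delta -> 2 <= p -> 1 < chi ->
  measurable S -> (leb S < +oo)%E -> measurable_fun S f ->
  Lp (2 * chi)%:E S (fun x => Vfun g (f x)) -> (\int[leb]_(x in S) (`|f x| `^ (p * chi))%:E <
    +oo)%E.
Proof.
move=> C2g gg C1 d0 p2 chi1 mS fS mf.
have chi0 : 0 < chi by exact: lt_trans chi1.
have q0 : 0 < 2 * chi by exact: mulr_gt0.
move=> /(LpP _ q0 mS)[mV fV].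
have [K K0 HK] := Vfun_coercive C2g gg C1 d0 p2 chi0.
have I1 : leb.-integrable S (EFin \o (fun=> 1 : R)).
  by apply: ge0_integrable_lty => //; rewrite (integral_cst leb mS 1%E) mul1e.
have I2 : leb.-integrable S (EFin \o (fun x => `|Vfun g (f x)| `^ (2 * chi))).
  by apply: ge0_integrable_lty => //; exact: measurable_normr_powR.
have I3 := integrable_scaler K mS (integrable_addr mS I2 I1).
apply: (@le_lt_trans _ _ (\int[leb]_(x in S) (K * (`|Vfun g (f x)| `^ (2 * chi) + 1))%:E)%E).
  apply: ge0_le_integral => //.
  - by apply/measurable_EFinP; exact: measurable_normr_powR.
  - by apply/measurable_EFinP; exact: integrable_measurable I3.
  - by move=> x _; rewrite lee_fin.
by rewrite -EFin_Rintegral// ltry.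
Qed.

End restriction.

(* [iN] is the last index, so that [p iN] is p_N; [Du] represents the weak
   gradient of [u]. *)
Theorem proposition3p4 (R : realType) (N : nat) (Omega : set 'rV[R]_N)
    (p : 'I_N -> R) (iN : 'I_N) (f : 'rV[R]_N -> R) (g : 'I_N -> R -> R)
    (C delta : R) (u : 'rV[R]_N -> R) (Du : 'I_N -> 'rV[R]_N -> R) (chi : R) :
  (2 <= N)%N -> iN = N.-1 :> nat ->
  open Omega ->
  (forall i, 2 <= p i) ->
  (forall i j : 'I_N, (i <= j)%N -> p i <= p j) ->
  (exists Df, W1p_loc Omega (fun i => p i / (p i - 1)) f Df) ->
  (forall i s, 0 <= g i s) ->
  (forall i, C2 (g i)) ->
  (forall i, convex_function [set: R^o] (g i)) ->
  1 <= C -> 0 <= delta ->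
  (forall i, growth C delta (p i) (g i)) ->
  local_minimizer Omega p g f u Du ->
  Lp_loc +oo%E Omega u ->
  1 < chi ->
  (forall i, Lp_loc (2 * chi)%:E Omega (fun x => Vfun (g i) (Du i x))) ->
  forall i,
    nikolskii_loc
      (fun j => Num.min (p j / p iN + p j / 2 * (chi - 1)) 1) 2%:E Omega
      (fun x => Vfun (g i) (Du i x)).
Proof.
move=> N2 iNE oO p2 pmon [Df [wf Lf]] g0 C2g _ C1 d0 gg um Lu chi1 LV i0.
have chi2 : 2 <= 2 * chi by rewrite ler_peMr// ltW.
have LV2 i : Lp_loc 2%:E Omega (fun x => Vfun (g i) (Du i x)).
  move=> E EO; apply: Lp_lower chi2 (LV i E EO) => //.
    exact: compactly_inside_measurable EO.
  exact: compactly_inside_lty EO.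
split; first exact: LV2.
move=> E EO; split; first exact: LV2.
have [d [r [dp SO Sr]]] := compactly_inside_thickening oO EO.
set S := thickening E (10 * d) in SO Sr.
have mS := compactly_inside_measurable SO.
have fS := compactly_inside_lty SO.
have [[wu Lup] _] := um.
have pp i : 0 < p i by exact: lt_le_trans (p2 i).
have [mu [M M1 uM]] := Lp_infty_bounded mS (Lu S SO).
have [Lf1 _ _] := wf iN.
have If := (Lp1P f mS).1 (Lf1 S SO); have mf := integrable_measurable If.
have IDf i : (lebesgue_rV N).-integrable S (EFin \o Df i).
  by have [_ L _] := wf i; exact: (Lp1P _ mS).1 (L S SO).
have IDu i : (lebesgue_rV N).-integrable S (EFin \o Du i).
  by have [_ L _] := wu i; exact: (Lp1P _ mS).1 (L S SO).
have mDu i : measurable_fun S (Du i) := integrable_measurable (IDu i).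
(* The bound on u holds only almost everywhere; the truncation at M and -M is bounded everywhere and
   agrees with u almost everywhere on S. *)
pose U := (fun x => Num.max (- M) (Num.min (u x) M)) \_ S.
pose a i := Du i \_ S; pose F := f \_ S; pose DF i := Df i \_ S.
have mUS : measurable_fun S (fun x => Num.max (- M) (Num.min (u x) M)).
  by apply: measurable_maxr => //; exact: measurable_minr.
have mU : measurable_fun setT U by exact/(measurable_restrictT _ mS).
have M0 : 0 <= M by exact: le_trans M1.
have UM x : `|U x| <= M.
  rewrite /U patchE; case: ifP => _; last by rewrite normr0.
  rewrite ler_norml le_max lexx/= ge_max ge_min lexx orbT andbT.
  by rewrite (le_trans _ M0)// oppr_le0.
have uU : {ae lebesgue_rV N, forall x, S x -> u x = U x}.
  apply: filterS uM => x H Sx; rewrite /U patchE mem_set//.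
  by have := H Sx; rewrite ler_norml => /andP[h1 h2]; rewrite min_l// max_r.
have IU : (lebesgue_rV N).-integrable setT (EFin \o U).
  apply: (integrable_bounded_support mU UM (r := r)) => x; rewrite ltNge => /negP xr.
  by rewrite /U patchE memNset// => /Sr.
have Ia i : (lebesgue_rV N).-integrable setT (EFin \o a i) := (integrable_restrict _ mS).1 (IDu i).
have IF : (lebesgue_rV N).-integrable setT (EFin \o F) := (integrable_restrict _ mS).1 If.
have IDF i : (lebesgue_rV N).-integrable setT (EFin \o DF i) := (integrable_restrict _ mS).1 (IDf i).
have same (h : 'rV[R]_N -> R) : {ae lebesgue_rV N, forall x, S x -> h x = (h \_ S) x}.
  by apply: aeW => x Sx; rewrite patchE mem_set.
have mr (h : 'rV[R]_N -> R) : (lebesgue_rV N).-integrable setT (EFin \o (h \_ S)) -> measurable_fun S (h \_ S).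
  by move=> I; apply: measurable_funTS; exact: integrable_measurable I.
have wU i : weak_deriv S i U (a i).
  exact: weak_partial_restrict (wu i) SO (measurable_funTS mU) (mr _ (Ia i)) uU (same _).
have wF i : weak_deriv S i F (DF i).
  exact: weak_partial_restrict (wf i) SO (mr _ IF) (mr _ (IDF i)) (same _) (same _).
have pa i : powR_integrable (p i) (a i).
  apply: powR_integrable_restrict => //.
  by have /(LpP _ (pp i) mS)[] := Lup i S SO.
have chi0 : 0 < chi by exact: lt_trans chi1.
have pchi i : powR_integrable (p i * chi) (a i).
  apply: powR_integrable_restrict => //; first exact: mulr_gt0.
  exact: integrable_of_Vfun (C2g i) (gg i) C1 d0 (p2 i) chi1 mS fS (mDu i) (LV i S SO).
have pDF j : powR_integrable (p j / (p j - 1)) (DF j).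
  have q0 : 0 < p j / (p j - 1) by rewrite divr_gt0// subr_gt0 (lt_le_trans _ (p2 j))// ltr1n.
  by have /(LpP _ q0 mS)[m fin] := Lf j S SO; exact: powR_integrable_restrict.
(* [euler_lagrange] asks for a margin d between the supports of the perturbations and the complement
   of S, the neighbourhood of radius 10 d. *)
have T5S : thickening (thickening E (5 * d)) d `<=` S.
  move=> y [x Tx yx]; have -> : y = x + (y - x) by rewrite addrC subrK.
  by apply: (@thickening_move _ _ _ _ dp 5 10 _ _ _ Tx (ltW yx)); lra.
have T5S' : thickening E (5 * d) `<=` S by apply: (thickening_mono dp); lra.
have T5r x : thickening E (5 * d) x -> `|x| <= r by move=> /T5S'; exact: Sr.
have EL (w : 'rV[R]_N -> R) (v : 'I_N -> 'rV[R]_N -> R) (B : R) :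
    (forall x, w x != 0 -> thickening E (5 * d) x) ->
    (forall i x, v i x != 0 -> thickening E (5 * d) x) ->
    (lebesgue_rV N).-integrable setT (EFin \o w) -> (forall i, (lebesgue_rV N).-integrable setT (EFin \o v i)) ->
    (forall i, weak_deriv setT i w (v i)) -> (forall x, `|w x| <= B) ->
    (forall i, powR_integrable (p i) (v i)) ->
    [/\ forall i, (lebesgue_rV N).-integrable setT (EFin \o (fun x => derive1 (g i) (a i x) * v i x)),
      (lebesgue_rV N).-integrable setT (EFin \o (fun x => F x * w x)) &
      \sum_(i < N) \int[lebesgue_rV N]_x (derive1 (g i) (a i x) * v i x) + \int[lebesgue_rV N]_x (F x * w x) = 0].
  move=> wT vT Iw Iv wd wB pv.
  have [H1 H2 H3] := euler_lagrange p2 g0 C2g C1 gg um SO If mu uM dp T5S T5r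
    wT vT Iw Iv wd wB (fun i => powR_integrable_lty (pv i)).
  have e1 i : (fun x => derive1 (g i) (a i x) * v i x) = (fun x => derive1 (g i) (Du i x) * v i x) \_ S.
    apply/funext => x; rewrite /a !patchE; case: ifPn => // /negP xS.
    have -> : v i x = 0; last by rewrite mulr0.
    by apply/eqP/negPn/negP => /vT /T5S' Sx; apply: xS; exact: mem_set.
  have e2 : (fun x => F x * w x) = (fun x => f x * w x) \_ S.
    by apply/funext => x; rewrite /F !patchE; case: ifPn => // _; rewrite mul0r.
  split.
  - by move=> i; rewrite e1; exact: (integrable_restrict _ mS).1 (H1 i).
  - by rewrite e2; exact: (integrable_restrict _ mS).1 H2.
  have s1 : \int[lebesgue_rV N]_x (F x * w x) = \int[lebesgue_rV N]_(x in S) (f x * w x).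
    by rewrite [RHS]Rintegral_mkcond e2.
  have s2 i : \int[lebesgue_rV N]_x (derive1 (g i) (a i x) * v i x) =
      \int[lebesgue_rV N]_(x in S) (derive1 (g i) (Du i x) * v i x).
    by rewrite [RHS]Rintegral_mkcond e1.
  by rewrite s1 (eq_bigr _ (fun i _ => s2 i)).
have pN i : p i <= p iN by apply: pmon; rewrite iNE -ltnS prednK//; exact: leq_trans N2.
apply: lte_sum_pinfty => j _.
have oE : open E by case: EO.
have mE := open_measurable_row oE.
have [B B0 H] := nirenberg_estimate mE dp Sr p2 pN C2g C1 gg chi1 M1 UM IU Ia wU pa pchi IF IDF
  wF (pDF j) EL.
set t := Num.min _ 1.
have t0 : 0 <= t.
  have pj := pp j; have pn := pp iN.
  have c0 : 0 <= chi - 1 by rewrite subr_ge0 ltW.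
  rewrite le_min ler01 andbT; apply: addr_ge0; first exact: divr_ge0 (ltW pj) (ltW pn).
  by apply: mulr_ge0 c0; exact: divr_ge0 (ltW pj) (ler0n R 2).
(* |h| <= d keeps the translates inside the nested neighbourhoods, and |h| <= 1 is the range of the
   interpolation. *)
apply: (@nikolskii_seminorm_lty _ _ _ _ t B (Num.min d 1)) => //; first exact: LV2.
  by rewrite lt_min dp ltr01.
move=> h h0; rewrite le_min => /andP[hd h1].
apply: le_trans (H h i0 h0 hd h1).
set e := h *: basis j.
have mA : measurable (segment_in E e) by apply: open_measurable_row; exact: open_segment_in.
have ES : E `<=` S by apply: subset_thickening; rewrite mulr_gt0.
have AE : segment_in E e `<=` E by move=> x [].
(* On [segment_in E e] both x and x + e lie in E, hence in S, where [Du i0] coincides with its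
   extension by zero. *)
rewrite (eq_integral (fun x : 'rV[R]_N => ((Vfun (g i0) (a i0 (x + e)) - Vfun (g i0) (a i0 x)) ^+ 2)%:E)).
  apply: ge0_subset_integral => //; last by move=> x _; rewrite lee_fin sqr_ge0.
  have mV : measurable_fun setT (Vfun (g i0)).
    apply: continuous_measurable_fun.
    exact: is_derive_continuous (Vfun_is_derive (C2g i0)).
  have ma := integrable_measurable (Ia i0).
  apply/measurable_EFinP; apply: measurable_funTS; apply: measurable_funX; apply: measurable_funB.
    exact: (measurableT_comp mV (measurable_fun_shift e ma)).
  exact: (measurableT_comp mV ma).
move=> x /set_mem Ax; rewrite /a !patchE !mem_set//; first by apply: ES; exact: AE.
by apply: ES; case: Ax => _ /(_ 1); rewrite scale1r ler01 lexx; exact.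
Qed.
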